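(* Let $M$ be a smooth manifold, $r\ge 0$ an integer, and $(\tau,\omega)$ a doublet of class $2r+2$ on $M$ with $\tau\in\Omega^1(M)$ nowhere-vanishing and $\omega\in\Omega^2(M)$. Suppose that: (a) $\mathcal K_{(\tau,\omega)}=\operatorname{Ker}\omega$ is an integrable distribution, and (b) for every Liouville vector field $\Delta$ of $(\tau,\omega)$ and every vector field $\Gamma$ taking values in $\operatorname{Ker}\omega$, the bracket $[\Delta,\Gamma]$ takes values in $\operatorname{Ker}\omega$. Then, around any point of $M$ there exist a neighbourhood $V$ and a nowhere-vanishing function $g\in C^\infty(V)$ such that the pair $(g\tau,\ dg\wedge\tau+g\omega)$ has constant class $2r+1$ on $V$.
   Context: The characteristic distribution of a pair $(\tau,\omega)$ of a 1-form and a 2-form at $x$ is $\mathcal K_{(\tau,\omega)_x}=\operatorname{Ker}\tau_x\cap\operatorname{Ker}\omega_x$, where $\operatorname{Ker}\alpha_x=\{v\in T_xM\mid\iota_v\alpha_x=0\}$; the class of the pair at $x$ is its codimension in $T_xM$. A doublet is a pair whose class is constant on $M$; when the class is even one has $\operatorname{Ker}\omega\subset\operatorname{Ker}\tau$, so $\mathcal K_{(\tau,\omega)}=\operatorname{Ker}\omega$. A Liouville vector field of $(\tau,\omega)$ is a vector field $\Delta$ with $\iota_\Delta\omega=\tau$. *)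

(* Defs.v *)
From HB Require Import structures.
From mathcomp Require Import all_boot all_order all_algebra.
From mathcomp Require Import all_classical all_reals all_analysis.
Set Implicit Arguments.
Unset Strict Implicit.
Unset Printing Implicit Defensive.
Import Order.TTheory GRing.Theory Num.Theory.
Import numFieldNormedType.Exports.
Local Open Scope classical_set_scope.
Local Open Scope ring_scope.

(* C^oo on the open set U: all iterated directional derivatives of f are
   (Frechet) differentiable at every point of U.  Functions are total, but only
   the germs of f at points of U matter. *)
Definition smooth_on (R : realType) (m : nat) (W : normedModType R)
    (U : set 'rV[R]_m) (f : 'rV[R]_m -> W) : Prop :=
  forall (s : seq 'rV[R]_m) (y : 'rV[R]_m), U y ->
    differentiable (foldr (fun v h => 'D_v h) f s) y.

(* Homeomorphism from the open set cdom onto the open set cmap @` cdom, with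
   irrelevant values of cmap and cinv elsewhere. *)
Record chart (R : realType) (n : nat) (T : topologicalType) := Chart {
  cdom : set T;
  cmap : T -> 'rV[R]_n;
  cinv : 'rV[R]_n -> T;
  open_cdom : open cdom;
  open_cimg : open (cmap @` cdom);
  cmapK : forall x, cdom x -> cinv (cmap x) = x;
  cmap_continuous : forall x, cdom x -> {for x, continuous cmap};
  cinv_continuous : forall y, (cmap @` cdom) y -> {for y, continuous cinv}
}.

Record smooth_manifold (R : realType) (n : nat) := SmoothManifold {
  mcarrier :> topologicalType;
  mhausdorff : hausdorff_space mcarrier;
  msecond_countable : @second_countable mcarrier;
  atlas : set (chart R n mcarrier);
  atlas_cover : forall x : mcarrier, exists c, atlas c /\ cdom c x;
  atlas_smooth : forall c d, atlas c -> atlas d ->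
    smooth_on (cmap c @` (cdom c `&` cdom d)) (cmap d \o cinv c)
}.

Section Manifold.
Variables (R : realType) (n : nat) (M : smooth_manifold R n).
Implicit Types (x : M) (c : chart R n M).

(* A chart of the atlas around x, chosen once and for all.  The tangent space
   T_xM is identified with 'rV[R]_n by means of it, T_x^*M with 'rV[R]_n through
   the pairing tau(v) = v *m tau^T, and a bilinear form on T_xM with the matrix
   omega such that omega(u, v) = u *m omega *m v^T. *)
Definition chart_at x : chart R n M := projT1 (cid (atlas_cover x)).

(* Change of basis at x from chart_at x to c, and conversely. *)
Definition to_chart c x : 'M[R]_n :=
  jacobian (cmap c \o cinv (chart_at x)) (cmap (chart_at x) x).
Definition from_chart c x : 'M[R]_n :=
  jacobian (cmap (chart_at x) \o cinv c) (cmap c x).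

Definition vf_in (X : M -> 'rV[R]_n) c (y : 'rV[R]_n) : 'rV[R]_n :=
  let x := cinv c y in X x *m to_chart c x.
Definition form1_in (tau : M -> 'rV[R]_n) c (y : 'rV[R]_n) : 'rV[R]_n :=
  let x := cinv c y in tau x *m (from_chart c x)^T.
Definition form2_in (omega : M -> 'M[R]_n) c (y : 'rV[R]_n) : 'M[R]_n :=
  let x := cinv c y in from_chart c x *m omega x *m (from_chart c x)^T.

Definition vector_field (X : M -> 'rV[R]_n) : Prop :=
  forall c, atlas c -> smooth_on (cmap c @` cdom c) (vf_in X c).
Definition form1 (tau : M -> 'rV[R]_n) : Prop :=
  forall c, atlas c -> smooth_on (cmap c @` cdom c) (form1_in tau c).
Definition form2 (omega : M -> 'M[R]_n) : Prop :=
  (forall x, (omega x)^T = - omega x) /\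
  forall c, atlas c -> smooth_on (cmap c @` cdom c) (form2_in omega c).
Definition smooth_fun (V : set M) (g : M -> R) : Prop :=
  forall c, atlas c -> smooth_on (cmap c @` (V `&` cdom c)) (g \o cinv c).

(* [X, Y] = X^i d_i Y^j d_j - Y^i d_i X^j d_j in the chart chart_at x. *)
Definition lie_bracket (X Y : M -> 'rV[R]_n) x : 'rV[R]_n :=
  let c := chart_at x in
  let y := cmap c x in
  'D_(vf_in X c y) (vf_in Y c) y - 'D_(vf_in Y c y) (vf_in X c) y.

Definition differential (g : M -> R) x : 'rV[R]_n :=
  \row_i 'D_(delta_mx 0 i) (g \o cinv (chart_at x)) (cmap (chart_at x) x).

Definition wedge_form1 (alpha beta : 'rV[R]_n) : 'M[R]_n :=
  alpha^T *m beta - beta^T *m alpha.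

(* iota_v omega = omega(v, -) *)
Definition interior_product (v : 'rV[R]_n) (omega : 'M[R]_n) : 'rV[R]_n := v *m omega.

(* Linear subspaces of T_xM are given as row spaces of matrices. *)
Definition Ker1 (tau : M -> 'rV[R]_n) x : 'M[R]_n := kermx (tau x)^T.
Definition Ker2 (omega : M -> 'M[R]_n) x : 'M[R]_n := kermx (omega x).
Definition char_dist (tau : M -> 'rV[R]_n) (omega : M -> 'M[R]_n) x : 'M[R]_n :=
  (Ker1 tau x :&: Ker2 omega x)%MS.
Definition pair_class (tau : M -> 'rV[R]_n) (omega : M -> 'M[R]_n) x : nat :=
  (n - \rank (char_dist tau omega x))%N.

Definition doublet_of_class (r : nat) (tau : M -> 'rV[R]_n)
    (omega : M -> 'M[R]_n) : Prop :=
  [/\ form1 tau, form2 omega & forall x, pair_class tau omega x = r].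

Definition takes_values_in (X : M -> 'rV[R]_n) (D : M -> 'M[R]_n) : Prop :=
  forall x, (X x <= D x)%MS.

Definition liouville (tau : M -> 'rV[R]_n) (omega : M -> 'M[R]_n)
    (Delta : M -> 'rV[R]_n) : Prop :=
  vector_field Delta /\ forall x, interior_product (Delta x) (omega x) = tau x.

Definition smooth_map (k : nat) (W : set 'rV[R]_k) (h : 'rV[R]_k -> M) : Prop :=
  (forall t, W t -> {for t, continuous h}) /\
  forall c, atlas c -> smooth_on (W `&` h @^-1` cdom c) (cmap c \o h).

Definition tangent_map (k : nat) (h : 'rV[R]_k -> M) (t : 'rV[R]_k) :
    'M[R]_(k, n) :=
  jacobian (cmap (chart_at (h t)) \o h) t.

(* h is a parametrization, by the open set W of R^k, of an (immersed) integral
   manifold of D. *)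
Definition integral_manifold (D : M -> 'M[R]_n) (k : nat) (W : set 'rV[R]_k)
    (h : 'rV[R]_k -> M) : Prop :=
  [/\ open W, smooth_map W h, {in W &, injective h} &
      forall t, W t ->
        row_free (tangent_map h t) /\ (tangent_map h t == D (h t))%MS].

(* Through every point passes an integral manifold. *)
Definition integrable_distribution (D : M -> 'M[R]_n) : Prop :=
  forall x, exists (k : nat) (W : set 'rV[R]_k) (h : 'rV[R]_k -> M),
    integral_manifold D W h /\ (h @` W) x.

End Manifold.

(* Main.v *)
Require Import Defs.
From mathcomp Require Import all_boot all_order all_algebra.
From mathcomp Require Import all_classical all_reals all_analysis.
From mathcomp Require Import ring lra zify.
Import Order.TTheory GRing.Theory Num.Theory.
Import numFieldNormedType.Exports.
Local Open Scope classical_set_scope.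
Local Open Scope ring_scope.

(** Suppose that g is a nowhere-vanishing function with Delta g = - g for a Liouville
    field Delta and v g = 0 for v in Ker omega. For v in Ker tau, contracting
    dg /\ tau + g omega with v gives g iota_w omega, where w = v + (v g / g) Delta, and
    this vanishes exactly when w is in Ker omega. Hence the characteristic distribution
    of (g tau, dg /\ tau + g omega) is Ker omega + Delta. The class being even, Ker omega
    has codimension 2r+2 ([even_class_kernel]), and Delta is not in it as tau
    is nowhere 0, so the new class is 2r+1 ([gauged_class]).

    It remains to find g = exp f near a point, that is, to solve Delta f = - 1 and
    v f = 0 on Ker omega. The distribution Ker omega + Delta is involutive: Ker omega
    is, by (a) ([involutive_in], by lifting fields to integral manifolds), and Delta
    preserves it, by (b). It has a local frame of commuting fields, the projections
    X_u of the constant fields u along a constant complement. If X_u = G_u + a_u Delta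
    with G_u in Ker omega, the equations read X_u f = - a_u, and
    involutivity gives X_u a_v = X_v a_u, the integrability condition
    ([local_gauge]). Such a system is solved by integrating along curves that start
    at x and have velocity - X_u with u = x - p: the derivative of the flow along
    these curves is computed explicitly, by means of its linearised equation and
    of uniqueness ([transport]). This rests on existence, uniqueness and smooth
    dependence on initial values for ordinary differential equations: Picard
    iteration ([picard]), Gronwall's inequality ([gronwall]) and an induction in which
    the derivative of a flow is itself a flow, on pairs (point, tangent vector)
    ([family_smooth]).

    Finally, (b) is a statement about global fields. Local fields with values in
    Ker omega are extended by means of cutoff functions ([Delta_invariant_in]), and a
    global Liouville field exists ([exists_liouville]): local ones, which exist
    because omega has constant rank, are glued with the help of a countable
    cover. *)

Set Implicit Arguments.
Unset Strict Implicit.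
Unset Printing Implicit Defensive.

(** * Derivatives and smooth functions on R^m *)

Section Differentiable.
Variable R : realType.

(** Estimates on solutions of differential equations come as explicit
    inequalities; this lemma reads a differential off them. *)
Lemma differentiable_approx (V W : normedModType R) (f : V -> W) x
    (L : {linear V -> W}) : continuous L ->
  (forall e, 0 < e -> \forall h \near 0, `|f (x + h) - f x - L h| <= e * `|h|) ->
  differentiable f x /\ 'd f x = L :> (V -> W).
Proof.
move=> Lc H.
have dE : f \o shift x = cst (f x) + L +o_ 0 id.
  apply/eqaddoP => e e0; near=> h.
  rewrite /= -![(_ - _ : V -> W) _]/(_ - _) -![(_ + _ : V -> W) _]/(_ + _) /=.
  rewrite opprD addrA [h + x]addrC.
  by near: h; exact: H.
have dL := diff_unique Lc dE.
split=> //; apply/diff_locallyP; split; first by rewrite dL.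
by rewrite dL.
Unshelve. all: by end_near. Qed.

Lemma differentiable_near (V W : normedModType R) (f : V -> W) x e :
  differentiable f x -> 0 < e ->
  \forall h \near 0, `|f (x + h) - f x - 'd f x h| <= e * `|h|.
Proof.
move=> /diff_locally /eqaddoP H e0; have := H _ e0.
apply: filterS => h; rewrite /= -![(_ - _ : V -> W) _]/(_ - _) -![(_ + _ : V -> W) _]/(_ + _) /=.
by rewrite opprD addrA [h + x]addrC.
Qed.

Lemma near_eq_differentiable (V W : normedModType R) (f g : V -> W) x :
  (\near x, f x = g x) -> differentiable f x -> differentiable g x.
Proof.
move=> fg df; have [] // := @differentiable_approx _ _ g x ('d f x).
  exact: diff_continuous.
move=> e e0; have := differentiable_near df e0.
have : \forall h \near 0, f (x + h) = g (x + h).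
  by move: fg; rewrite (near_shift 0) /= => H; apply: filterS H => h; rewrite /= subr0 addrC.
move=> H1 H2; near=> h; rewrite -(nbhs_singleton fg).
have -> : g (x + h) = f (x + h) by apply/esym; near: h.
by near: h.
Unshelve. all: by end_near. Qed.

Lemma differentiable_mxP (V : normedModType R) m n (M : V -> 'M[R]_(m, n)) x :
  differentiable M x <-> forall i j, differentiable (fun y => M y i j) x.
Proof.
split=> [dM i j|dM].
  exact: (@differentiable_comp _ _ _ _ M (fun N : 'M[R]_(m, n) => N i j) x dM (differentiable_coord _ _ _)).
have -> : M = \sum_i \sum_j (fun y => M y i j *: (delta_mx i j : 'M[R]_(m, n))).
  apply/funext => y; rewrite [LHS]matrix_sum_delta fct_sumE; apply: eq_bigr => i _.
  by rewrite fct_sumE.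
apply: differentiable_sum => i; apply: differentiable_sum => j.
exact/differentiableZl.
Qed.

Lemma derive_entry (V : normedModType R) m n (M : V -> 'M[R]_(m, n)) x v i j :
  differentiable M x -> ('D_v M x) i j = 'D_v (fun y => M y i j) x.
Proof. by move=> dM; rewrite derive_mx ?mxE //; exact: diff_derivable. Qed.

Lemma deriveE_comp (U V W : normedModType R) (f : U -> V) (g : V -> W) x v :
  differentiable f x -> differentiable g (f x) ->
  'D_v (g \o f) x = 'D_('D_v f x) g (f x).
Proof.
move=> df dg; rewrite deriveE; last exact: differentiable_comp.
by rewrite diff_comp // /= -deriveE // -deriveE.
Qed.

Lemma derive_dirD (V W : normedModType R) (f : V -> W) x u v :
  differentiable f x -> 'D_(u + v) f x = 'D_u f x + 'D_v f x.
Proof. by move=> df; rewrite !deriveE // linearD. Qed.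

Lemma derive_dirZ (V W : normedModType R) (f : V -> W) x a v :
  differentiable f x -> 'D_(a *: v) f x = a *: 'D_v f x.
Proof. by move=> df; rewrite !deriveE // linearZ. Qed.

Lemma derive_dirN (V W : normedModType R) (f : V -> W) x v :
  differentiable f x -> 'D_(- v) f x = - 'D_v f x.
Proof. by move=> df; rewrite !deriveE // linearN. Qed.

Lemma derive_dirE m (W : normedModType R) (f : 'rV[R]_m -> W) x v :
  differentiable f x -> 'D_v f x = \sum_j v 0 j *: 'D_(delta_mx 0 j) f x.
Proof.
move=> df; rewrite deriveE // {1}(row_sum_delta v) linear_sum /=.
by apply: eq_bigr => j _; rewrite linearZ deriveE.
Qed.

End Differentiable.

Section DeriveReal.
Variable R : realType.
Implicit Types (f g : R -> R) (t : R).

Lemma is_derive1N (V : normedModType R) (f : R -> V) t df : is_derive t 1 f df -> is_derive t 1 (fun x => - f x) (- df).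
Proof. by move=> d; have := is_deriveN d. Qed.

Lemma is_derive1D (V : normedModType R) (f g : R -> V) t df dg : is_derive t 1 f df -> is_derive t 1 g dg ->
  is_derive t 1 (fun x => f x + g x) (df + dg).
Proof. by move=> d d'; have := is_deriveD d d'. Qed.

Lemma is_derive1B (V : normedModType R) (f g : R -> V) t df dg : is_derive t 1 f df -> is_derive t 1 g dg ->
  is_derive t 1 (fun x => f x - g x) (df - dg).
Proof. by move=> d d'; have := is_deriveB d d'. Qed.

Lemma is_derive1M f g t df dg : is_derive t 1 f df -> is_derive t 1 g dg ->
  is_derive t 1 (fun x => f x * g x) (df * g t + f t * dg).
Proof.
move=> d d'; have dM := is_deriveM d d'; apply: (is_derive_eq dM).
by rewrite addrC [df * _]mulrC.
Qed.

Lemma is_derive1Z (V : normedModType R) a (f : R -> V) t df : is_derive t 1 f df -> is_derive t 1 (fun x => a *: f x) (a *: df).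
Proof. by move=> d; have := is_deriveZ a d. Qed.

Lemma is_derive1_compose f g t df dg : is_derive (f t) 1 g dg -> is_derive t 1 f df ->
  is_derive t 1 (fun x => g (f x)) (dg * df).
Proof. by move=> d d'; have := @is_derive1_comp R g f t dg df d d'. Qed.

Lemma is_derive1V t : t != 0 -> is_derive t 1 (fun t : R => t^-1) (- t ^- 2).
Proof.
move=> t0; have d := @is_deriveV R id t 1 1 t0 _; apply: (is_derive_eq (d _)).
by rewrite /GRing.scale /= mulr1.
Qed.

Lemma is_derive1X n t : is_derive t 1 (fun s : R => s ^+ n) (n%:R * t ^+ n.-1).
Proof.
have -> : (fun s : R => s ^+ n) = (@id R) ^+ n.
  by apply/funext => s; rewrite exprfctE.
by apply: is_derive_eq; rewrite /GRing.scale /= mulr1.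
Qed.

End DeriveReal.

Section Smooth.
Variables (R : realType) (m : nat).
Implicit Types (U V : set 'rV[R]_m) (x y v : 'rV[R]_m) (k : nat).

(** Smoothness by order: the derivative of a sum, product or composite is an
    expression in derivatives of lower order of several functions, so that closure
    properties are proved by induction on [k] for all functions at once. *)
Fixpoint Ck (W : normedModType R) k U (f : 'rV[R]_m -> W) : Prop :=
  (forall y, U y -> differentiable f y) /\
  if k is k'.+1 then forall v, Ck k' U ('D_v f) else True.

Lemma Ck_diff (W : normedModType R) k U (f : 'rV[R]_m -> W) y :
  Ck k U f -> U y -> differentiable f y.
Proof. by case: k => [|k] /= [df _]; exact: df. Qed.

Lemma CkW (W : normedModType R) k U (f : 'rV[R]_m -> W) : Ck k.+1 U f -> Ck k U f.
Proof.
elim: k f => [|k IH] f [df Df]; first by split.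
by split=> // v; apply: IH; exact: Df.
Qed.

Lemma smooth_onP (W : normedModType R) U (f : 'rV[R]_m -> W) :
  smooth_on U f <-> forall k, Ck k U f.
Proof.
split=> [sf k|Cf s].
  elim: k f sf => [|k IH] f sf; first by split=> // y Uy; exact: (sf [::] y Uy).
  split=> [y Uy|v]; first exact: (sf [::] y Uy).
  by apply: IH => s y Uy; have := sf (rcons s v) y Uy; rewrite foldr_rcons.
move=> y Uy; move: (Cf (size s)).
elim/last_ind: s f {Cf} => [|s v IH] f /=; first by move=> [df _]; exact: df.
by rewrite size_rcons foldr_rcons => -[_ Df]; exact/IH/Df.
Qed.

Lemma smooth_on_diff (W : normedModType R) U (f : 'rV[R]_m -> W) y :
  smooth_on U f -> U y -> differentiable f y.
Proof. by move=> sf Uy; exact: (sf [::] y Uy). Qed.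

Lemma smooth_on_derive (W : normedModType R) U (f : 'rV[R]_m -> W) v :
  smooth_on U f -> smooth_on U ('D_v f).
Proof. by move=> sf s y Uy; have := sf (rcons s v) y Uy; rewrite foldr_rcons. Qed.

Lemma smooth_onS (W : normedModType R) U V (f : 'rV[R]_m -> W) :
  V `<=` U -> smooth_on U f -> smooth_on V f.
Proof. by move=> VU sf s y /VU; exact: sf. Qed.

Lemma near_open_eq (T : topologicalType) (W : Type) (A : set T) (f g : T -> W) (y : T) :
  open A -> A y -> (forall z, A z -> f z = g z) -> \near y, f y = g y.
Proof.
move=> oA Ay fg; have : nbhs y A by exact: open_nbhs_nbhs.
exact: filterS.
Qed.

Lemma eq_Ck (W : normedModType R) k U (f g : 'rV[R]_m -> W) : open U ->
  (forall y, U y -> f y = g y) -> Ck k U f -> Ck k U g.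
Proof.
move=> oU; elim: k f g => [|k IH] f g fg [df Df];
  (split=> [y Uy|]; first by apply: near_eq_differentiable (df y Uy); exact: near_open_eq fg) => // v.
apply: IH (Df v) => y Uy; apply: near_eq_derive.
exact: near_open_eq fg.
Qed.

Lemma eq_smooth_on (W : normedModType R) U (f g : 'rV[R]_m -> W) : open U ->
  (forall y, U y -> f y = g y) -> smooth_on U f -> smooth_on U g.
Proof.
move=> oU fg /smooth_onP sf; apply/smooth_onP => k.
exact: eq_Ck fg (sf k).
Qed.

Lemma smooth_on_local (W : normedModType R) U (f : 'rV[R]_m -> W) :
  (forall y, U y -> exists V, [/\ open V, V y & smooth_on V f]) -> smooth_on U f.
Proof. by move=> H s y /H[V [_ Vy sf]]; exact: sf. Qed.

Lemma Ck_cst (W : normedModType R) k U (a : W) : Ck k U (fun=> a).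
Proof.
elim: k a => [|k IH] a; (split => [y _|]; first exact: differentiable_cst) => // v.
have -> : 'D_v (fun=> a) = (fun=> 0) :> ('rV[R]_m -> W).
  by apply/funext => y; exact: derive_cst.
exact: IH.
Qed.

Lemma smooth_cst (W : normedModType R) U (a : W) : smooth_on U (fun=> a).
Proof. by apply/smooth_onP => k; exact: Ck_cst. Qed.

Lemma CkD (W : normedModType R) k U (f g : 'rV[R]_m -> W) : open U ->
  Ck k U f -> Ck k U g -> Ck k U (fun y => f y + g y).
Proof.
move=> oU; elim: k f g => [|k IH] f g [df Df] [dg Dg];
  (split=> [y Uy|]; first exact: (differentiableD (df y Uy) (dg y Uy))) => // v.
apply: (@eq_Ck _ _ _ (fun y => 'D_v f y + 'D_v g y)) => //; last exact: (IH _ _ (Df v) (Dg v)).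
by move=> y Uy; rewrite -deriveD //; apply: diff_derivable; solve [exact: df|exact: dg].
Qed.

Lemma CkM k U (f g : 'rV[R]_m -> R) : open U ->
  Ck k U f -> Ck k U g -> Ck k U (fun y => f y * g y).
Proof.
move=> oU; elim: k f g => [|k IH] f g Cf Cg; have [df Df] := Cf; have [dg Dg] := Cg;
  (split=> [y Uy|]; first exact: (differentiableM (df y Uy) (dg y Uy))) => // v.
apply: (@eq_Ck _ _ _ (fun y => f y * 'D_v g y + g y * 'D_v f y)) => //.
  move=> y Uy; have := @deriveM _ _ f g y v; rewrite /GRing.scale /= => <- //;
    apply: diff_derivable; solve [exact: df|exact: dg].
by apply: CkD => //; [exact: (IH _ _ (CkW Cf) (Dg v))|exact: (IH _ _ (CkW Cg) (Df v))].
Qed.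

Lemma Ck_sum I (s : seq I) k U (f : I -> 'rV[R]_m -> R) : open U ->
  (forall i, Ck k U (f i)) -> Ck k U (fun y => \sum_(i <- s) f i y).
Proof.
move=> oU sf; elim: s => [|i s IH].
  by apply: (@eq_Ck _ _ _ (fun=> 0)) => //; [move=> y _; rewrite big_nil|exact: Ck_cst].
apply: (@eq_Ck _ _ _ (fun y => f i y + \sum_(i <- s) f i y)) => //.
  by move=> y _; rewrite big_cons.
exact: CkD.
Qed.

Lemma smooth_onD (W : normedModType R) U (f g : 'rV[R]_m -> W) : open U ->
  smooth_on U f -> smooth_on U g -> smooth_on U (fun y => f y + g y).
Proof. by move=> oU /smooth_onP sf /smooth_onP sg; apply/smooth_onP => k; exact: CkD. Qed.

Lemma smooth_onM U (f g : 'rV[R]_m -> R) : open U ->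
  smooth_on U f -> smooth_on U g -> smooth_on U (fun y => f y * g y).
Proof. by move=> oU /smooth_onP sf /smooth_onP sg; apply/smooth_onP => k; exact: CkM. Qed.

Lemma smooth_on_sum I (s : seq I) U (f : I -> 'rV[R]_m -> R) : open U ->
  (forall i, smooth_on U (f i)) -> smooth_on U (fun y => \sum_(i <- s) f i y).
Proof.
move=> oU sf; apply/smooth_onP => k; apply: Ck_sum => // i.
by have /smooth_onP := sf i; exact.
Qed.

Lemma smooth_on_prod I (s : seq I) U (f : I -> 'rV[R]_m -> R) : open U ->
  (forall i, smooth_on U (f i)) -> smooth_on U (fun y => \prod_(i <- s) f i y).
Proof.
move=> oU sf; elim: s => [|i s IH].
  apply: (@eq_smooth_on _ _ (fun=> 1 : R)) => //; last exact: smooth_cst.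
  by move=> y _; rewrite big_nil.
apply: (@eq_smooth_on _ _ (fun y => f i y * \prod_(i <- s) f i y)) => //.
  by move=> y _; rewrite big_cons.
exact: smooth_onM.
Qed.

Lemma smooth_onN U (f : 'rV[R]_m -> R) : open U ->
  smooth_on U f -> smooth_on U (fun y => - f y).
Proof.
move=> oU sf; apply: (@eq_smooth_on _ _ (fun y => (- 1) * f y)) => //.
  by move=> y _; rewrite mulN1r.
by apply: smooth_onM => //; exact: smooth_cst.
Qed.

Lemma smooth_coord U (j : 'I_m) : smooth_on U (fun y => y 0 j).
Proof.
apply/smooth_onP; case=> [|k]; (split=> [y _|]; first exact: differentiable_coord) => // v.
have -> : 'D_v (fun y : 'rV[R]_m => y 0 j) = (fun=> v 0 j).
  by apply/funext => y; rewrite -derive_entry ?derive_id //; exact: differentiable_id.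
exact: Ck_cst.
Qed.

(** The reciprocal, the exponential and the function exp (-1/x) all belong to
    a family [h] of functions of one variable in which the derivative of [h i] is
    the linear combination of members encoded by [D i]. The chain rule then gives
    an induction on the order. *)
Lemma smooth_comp1 (h : nat -> R -> R) (D : nat -> seq (R * nat)) (P : set R) U
    (f : 'rV[R]_m -> R) (i : nat) : open U ->
  (forall i t, P t -> is_derive t 1 (h i) (\sum_(c <- D i) c.1 * h c.2 t)) ->
  (forall y, U y -> P (f y)) ->
  smooth_on U f -> smooth_on U (fun y => h i (f y)).
Proof.
move=> oU hD UP /smooth_onP sf; apply/smooth_onP => k.
have dh j y : U y -> differentiable (h j) (f y).
  by move=> /UP /(hD j)[dh _]; exact/derivable1_diffP.
have dc j y : U y -> differentiable (fun y => h j (f y)) y.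
  by move=> Uy; apply: (@differentiable_comp _ _ _ _ f (h j)); [exact: Ck_diff (sf 0%N) Uy|exact: dh].
elim: k i => [|k IH] i; (split=> [y Uy|]; first exact: dc) => // v.
apply: (@eq_Ck _ _ _ (fun y => 'D_v f y * \sum_(c <- D i) c.1 * h c.2 (f y))) => //.
  move=> y Uy; have df := Ck_diff (sf 0%N) Uy.
  rewrite (@deriveE_comp _ _ _ _ f (h i)) //; last exact: dh.
  have [_ <-] := hD i _ (UP y Uy).
  rewrite -[LHS]/('D_v f y *: 'D_1 (h i) (f y)) -derive_dirZ; last exact: dh.
  by rewrite /GRing.scale /= mulr1.
apply: CkM => //; first by have [_] := sf k.+1; exact.
by apply: Ck_sum => // c; apply: CkM => //; exact: Ck_cst.
Qed.

Lemma smooth_onV U (f : 'rV[R]_m -> R) : open U ->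
  (forall y, U y -> f y != 0) -> smooth_on U f -> smooth_on U (fun y => (f y)^-1).
Proof.
move=> oU f0 sf.
apply: (@smooth_comp1 (fun i t => (t^-1) ^+ i.+1) (fun i => [:: (- i.+1%:R, i.+1)]) [set t | t != 0] _ _ 0%N) => //.
move=> i t /= t0; rewrite big_cons big_nil addr0 /=.
have d := is_derive1_compose (f := fun s : R => s^-1) (is_derive1X i.+1 t^-1) (is_derive1V t0).
apply: is_derive_eq d _.
by rewrite -exprVn !exprS expr0; ring.
Qed.

Lemma smooth_expR U (f : 'rV[R]_m -> R) : open U ->
  smooth_on U f -> smooth_on U (fun y => expR (f y)).
Proof.
move=> oU; apply: (@smooth_comp1 (fun=> expR) (fun=> [:: (1, 0%N)]) setT _ _ 0%N) => //.
by move=> i t _; rewrite big_cons big_nil addr0 mul1r; exact: is_derive_expR.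
Qed.

End Smooth.

Section SmoothMatrix.
Variable R : realType.

Lemma Ck_mxP m (U : set 'rV[R]_m) p q (M : 'rV[R]_m -> 'M[R]_(p, q)) k : open U ->
  Ck k U M <-> forall i j, Ck k U (fun y => M y i j).
Proof.
move=> oU; elim: k M => [|k IH] M; split.
- by move=> [dM _] i j; split=> // y /dM /differentiable_mxP; exact.
- by move=> C; split=> // y Uy; apply/differentiable_mxP => i j; exact: Ck_diff (C i j) Uy.
- move=> [dM DM] i j; split=> [y /dM /differentiable_mxP|v]; first exact.
  apply: (@eq_Ck _ _ _ _ _ (fun y => 'D_v M y i j)) => //; last exact: ((IH _).1 (DM v) i j).
  by move=> y /dM dMy; rewrite derive_entry.
- move=> C; have dM y : U y -> differentiable M y.
    by move=> Uy; apply/differentiable_mxP => i j; exact: Ck_diff (C i j) Uy.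
  split=> // v; apply/IH => i j; apply: (@eq_Ck _ _ _ _ _ ('D_v (fun y => M y i j))) => //.
    by move=> y /dM dMy; rewrite derive_entry.
  by have [_] := C i j; exact.
Qed.

Lemma smooth_mxP m (U : set 'rV[R]_m) p q (M : 'rV[R]_m -> 'M[R]_(p, q)) : open U ->
  smooth_on U M <-> forall i j, smooth_on U (fun y => M y i j).
Proof.
move=> oU; split=> [/smooth_onP C i j|C]; apply/smooth_onP => k.
  by have /Ck_mxP := C k; exact.
apply/Ck_mxP => // i j; have /smooth_onP := C i j; exact.
Qed.

(** By induction on the order, for all [f] at once: the derivative of [f \o g]
    is a combination of the composites with [g] of the partial derivatives of [f]. *)
Lemma smooth_comp k m (U : set 'rV[R]_k) (V : set 'rV[R]_m)
    (g : 'rV[R]_k -> 'rV[R]_m) (f : 'rV[R]_m -> R) : open U ->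
  (forall y, U y -> V (g y)) -> smooth_on U g -> smooth_on V f ->
  smooth_on U (f \o g).
Proof.
move=> oU UV sg /smooth_onP sf; apply/smooth_onP => l; move: f sf.
have dg y : U y -> differentiable g y by exact: smooth_on_diff.
have df l' (f : 'rV[R]_m -> R) y : Ck l' V f -> U y -> differentiable (f \o g) y.
  move=> Cf Uy; apply: differentiable_comp; first exact: dg.
  exact: Ck_diff Cf (UV y Uy).
elim: l => [|l IH] f sf; (split=> [y Uy|]; first exact: df (sf 0%N) Uy) => // v.
apply: (@eq_Ck _ _ _ _ _ (fun y => \sum_j ('D_v g y) 0 j * 'D_(delta_mx 0 j) f (g y))) => //.
  move=> y Uy; have dfg := Ck_diff (sf 0%N) (UV y Uy).
  by rewrite (@deriveE_comp _ _ _ _ g f y v (dg y Uy) dfg) [RHS]derive_dirE.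
apply: Ck_sum => // j; apply: CkM => //.
  have /smooth_onP sDg := smooth_on_derive v sg.
  by have /Ck_mxP := sDg l; exact.
apply: (IH ('D_(delta_mx 0 j) f)) => i.
by have [_] := sf i.+1; exact.
Qed.

Section Operations.
Variables (m : nat) (U : set 'rV[R]_m).
Hypothesis oU : open U.

Lemma smooth_comp_mx k p q (V : set 'rV[R]_k)
    (g : 'rV[R]_m -> 'rV[R]_k) (f : 'rV[R]_k -> 'M[R]_(p, q)) : open V ->
  (forall y, U y -> V (g y)) -> smooth_on U g -> smooth_on V f ->
  smooth_on U (f \o g).
Proof.
move=> oV UV sg /smooth_mxP sf; apply/smooth_mxP => // i j.
exact: (smooth_comp oU UV sg (sf oV i j)).
Qed.

Lemma smooth_mulmx p q r (A : 'rV[R]_m -> 'M[R]_(p, q)) (B : 'rV[R]_m -> 'M[R]_(q, r)) :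
  smooth_on U A -> smooth_on U B -> smooth_on U (fun y => A y *m B y).
Proof.
move=> /smooth_mxP sA /smooth_mxP sB; apply/smooth_mxP => // i j.
apply: (@eq_smooth_on _ _ _ _ (fun y => \sum_l A y i l * B y l j)) => //.
  by move=> y _; rewrite mxE.
by apply: smooth_on_sum => // l; apply: smooth_onM => //; [exact: sA|exact: sB].
Qed.

Lemma smooth_scale p q (f : 'rV[R]_m -> R) (A : 'rV[R]_m -> 'M[R]_(p, q)) :
  smooth_on U f -> smooth_on U A -> smooth_on U (fun y => f y *: A y).
Proof.
move=> sf /smooth_mxP sA; apply/smooth_mxP => // i j.
apply: (@eq_smooth_on _ _ _ _ (fun y => f y * A y i j)) => //; last first.
  by apply: smooth_onM => //; exact: sA.
by move=> y _; rewrite mxE.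
Qed.

Lemma smooth_oppmx p q (A : 'rV[R]_m -> 'M[R]_(p, q)) :
  smooth_on U A -> smooth_on U (fun y => - A y).
Proof.
move=> /smooth_mxP sA; apply/smooth_mxP => // i j.
apply: (@eq_smooth_on _ _ _ _ (fun y => - A y i j)) => //; last first.
  by apply: smooth_onN => //; exact: sA.
by move=> y _; rewrite mxE.
Qed.

Lemma smooth_id : smooth_on U (fun y => y).
Proof. by apply/smooth_mxP => // i j; rewrite ord1; exact: smooth_coord. Qed.

Lemma smooth_det p (A : 'rV[R]_m -> 'M[R]_p) :
  smooth_on U A -> smooth_on U (fun y => \det (A y)).
Proof.
move=> /smooth_mxP sA; rewrite /determinant.
apply: smooth_on_sum => // s; apply: smooth_onM => //; first exact: smooth_cst.
by apply: smooth_on_prod => // i; exact: sA.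
Qed.

Lemma smooth_invmx p (A : 'rV[R]_m -> 'M[R]_p) :
  (forall y, U y -> A y \in unitmx) ->
  smooth_on U A -> smooth_on U (fun y => invmx (A y)).
Proof.
move=> uA sA; apply: (@eq_smooth_on _ _ _ _ (fun y => (\det (A y))^-1 *: \adj (A y))) => //.
  by move=> y Uy; rewrite /invmx uA.
apply: smooth_scale.
  apply: smooth_onV => //; last exact: smooth_det.
  by move=> y /uA; rewrite unitmxE unitfE.
apply/smooth_mxP => // i j.
apply: (@eq_smooth_on _ _ _ _ (fun y => (-1) ^+ (j + i) * \det (row' j (col' i (A y))))) => //.
  by move=> y _; rewrite mxE.
apply: smooth_onM => //; first exact: smooth_cst.
apply: smooth_det; apply/smooth_mxP => // k l.
apply: (@eq_smooth_on _ _ _ _ (fun y => A y (lift j k) (lift i l))) => //.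
  by move=> y _; rewrite !mxE.
by move/smooth_mxP : sA; exact.
Qed.

End Operations.
End SmoothMatrix.

Section MeanValue.
Variables (R : realType) (V : normedModType R).

Lemma is_derive_line (W : normedModType R) (f : V -> W) (a u : V) (t : R) :
  differentiable f (a + t *: u) ->
  is_derive t 1 (fun t : R => f (a + t *: u)) ('D_u f (a + t *: u)).
Proof.
move=> df.
have [dl el] : is_derive t 1 (fun s : R => a + s *: u) u.
  have dl : differentiable (fun s : R => s *: u) t.
    exact: (@differentiableZl _ _ _ (fun s : R => s) u t (ex_diff : differentiable id t)).
  have dd : differentiable (fun s : R => a + s *: u) t.
    exact: (@differentiableD _ _ _ (fun=> a) _ t (differentiable_cst _ _) dl).
  apply: DeriveDef; first exact/derivable1_diffP.
  rewrite (@deriveD _ _ _ (fun=> a) (fun s : R => s *: u)) ?derive_cst ?add0r //;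
    last exact/derivable1_diffP.
  rewrite deriveE // (@diffZl _ _ _ (fun s : R => s)) ?diff_id //.
  by rewrite diff_val scale1r.
have dl' : differentiable (fun s : R => a + s *: u) t by exact/derivable1_diffP.
apply: DeriveDef.
  by apply/derivable1_diffP; exact: (@differentiable_comp _ _ _ _ _ f t dl' df).
by rewrite (@deriveE_comp _ _ _ _ (fun s : R => a + s *: u) f t 1 dl' df) el.
Qed.

Lemma mean_value (f : V -> R) (a u : V) :
  (forall t : R, 0 <= t <= 1 -> differentiable f (a + t *: u)) ->
  exists2 t : R, 0 <= t <= 1 & f (a + u) - f a = 'D_u f (a + t *: u).
Proof.
move=> df.
have [||t] := @MVT R (fun t => f (a + t *: u)) (fun t => 'D_u f (a + t *: u)) 0 1 ltr01.
- move=> t; rewrite in_itv /= => /andP[t0 t1]; apply: is_derive_line.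
  by apply: df; rewrite !ltW.
- apply: derivable_within_continuous => t; rewrite in_itv /= => t01.
  by have [] := is_derive_line (df t t01).
rewrite in_itv /= => /andP[t0 t1]; rewrite scale1r scale0r addr0 subr0 mulr1 => e.
by exists t => //; rewrite !ltW.
Qed.

End MeanValue.

Section Schwarz.
Variables (R : realType) (m : nat).

Lemma differentiable_translate (V W : normedModType R) (f : V -> W) (x w : V) :
  differentiable f (x + w) -> differentiable (fun z => f (z + w)) x.
Proof.
move=> df; apply: (@differentiable_comp _ _ _ _ (fun z => z + w) f) => //.
Qed.

Lemma derive_translate (V W : normedModType R) (f : V -> W) (x w u : V) :
  'D_u (fun z => f (z + w)) x = 'D_u f (x + w).
Proof. by rewrite /derive; under eq_fun do rewrite /= -addrA. Qed.

(** The mean value theorem in the direction [u], applied to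
    f (z + h v) - f z, and then in the direction [v], applied to the derivative,
    turns the second difference into a value of D_v (D_u f) near [y]. *)
Lemma second_difference (U : set 'rV[R]_m) (f : 'rV[R]_m -> R) y u v e : open U -> U y ->
  smooth_on U f -> 0 < e -> \forall h \near 0^'+,
  `|h ^- 2 * (f (y + h *: u + h *: v) - f (y + h *: u) - (f (y + h *: v) - f y)) -
    'D_v ('D_u f) y| <= e.
Proof.
move=> oU Uy sf e0.
have sDu := smooth_on_derive u sf; have sDvu := smooth_on_derive v sDu.
have cD : {for y, continuous ('D_v ('D_u f))}.
  exact: differentiable_continuous (smooth_on_diff sDvu Uy).
have [d /= d0 dP] : exists2 d, 0 < d & forall z, `|z| < d -> U (y + z) /\
    `|'D_v ('D_u f) (y + z) - 'D_v ('D_u f) y| <= e.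
  have /nbhs_ballP[d1 /= d10 H1] : nbhs y U by exact: open_nbhs_nbhs.
  have /cvgrPdist_le/(_ _ e0)/nbhs_ballP[d2 /= d20 H2] := cD.
  exists (Num.min d1 d2); first by rewrite lt_min d10.
  move=> z; rewrite lt_min => /andP[z1 z2]; split.
    by apply: H1; rewrite -ball_normE /= opprD addNKr normrN.
  by rewrite distrC; apply: H2; rewrite -ball_normE /= opprD addNKr normrN.
have uv0 : 0 < `|u| + `|v| + 1 by rewrite ltr_wpDl // addr_ge0.
near=> h.
have h0 : 0 < h by near: h; exact: nbhs_right_gt.
have hP s t : 0 <= s <= 1 -> 0 <= t <= 1 -> `|s *: (h *: u) + t *: (h *: v)| < d.
  move=> /andP[s0 s1] /andP[t0 t1]; rewrite (le_lt_trans (ler_normD _ _)) //.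
  rewrite !normrZ !ger0_norm ?(ltW h0) //.
  apply: (@le_lt_trans _ _ (h * `|u| + h * `|v|)).
    by apply: lerD; rewrite ler_piMl // mulr_ge0 // ltW.
  rewrite -mulrDr; apply: (@lt_trans _ _ (h * (`|u| + `|v| + 1))).
    by rewrite ltr_pM2l // ltrDl.
  rewrite -ltr_pdivlMr //; near: h; apply: nbhs_right_lt.
  by rewrite divr_gt0.
pose f1 z := f (z + h *: v); pose phi := f1 - f.
have dphi s : 0 <= s <= 1 -> differentiable f1 (y + s *: (h *: u)) /\
                             differentiable f (y + s *: (h *: u)).
  move=> s01; split.
    apply: differentiable_translate; apply: (smooth_on_diff sf).
    by rewrite -addrA -[h *: v]scale1r; apply: (dP _ (hP _ _ s01 _)).1; rewrite ler01 lexx.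
  apply: (smooth_on_diff sf).
  by rewrite -[_ *: _]addr0 -(scale0r (h *: v)); apply: (dP _ (hP _ _ s01 _)).1; rewrite ler01 lexx.
have [|s s01 es] := @mean_value _ _ phi y (h *: u).
  by move=> s /dphi[d1 d2]; exact: differentiableB.
have [d1 d2] := dphi s s01.
have e1 : 'D_(h *: u) phi (y + s *: (h *: u)) =
  h * ('D_u f (y + s *: (h *: u) + h *: v) - 'D_u f (y + s *: (h *: u))).
  rewrite derive_dirZ; last exact: differentiableB.
  rewrite deriveB; [|exact: diff_derivable|exact: diff_derivable].
  by rewrite derive_translate.
have [|t t01 et] := @mean_value _ _ ('D_u f) (y + s *: (h *: u)) (h *: v).
  move=> t t01; apply: (smooth_on_diff sDu); rewrite -addrA.
  exact: (dP _ (hP _ _ s01 t01)).1.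
have -> : f (y + h *: u + h *: v) - f (y + h *: u) - (f (y + h *: v) - f y) =
  h ^+ 2 * 'D_v ('D_u f) (y + s *: (h *: u) + t *: (h *: v)).
  rewrite -[LHS]/(phi (y + h *: u) - phi y) es e1 et derive_dirZ.
    by rewrite /GRing.scale /= mulrA.
  apply: (smooth_on_diff sDu); rewrite -addrA.
  exact: (dP _ (hP _ _ s01 t01)).1.
rewrite mulKf ?expf_neq0 ?gt_eqF // -addrA.
exact: (dP _ (hP _ _ s01 t01)).2.
Unshelve. all: by end_near. Qed.

(** Exchanging [u] and [v] only reorders the terms of the second difference. *)
Lemma derive_comm (U : set 'rV[R]_m) (f : 'rV[R]_m -> R) y u v : open U -> U y ->
  smooth_on U f -> 'D_v ('D_u f) y = 'D_u ('D_v f) y.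
Proof.
move=> oU Uy sf; apply/eqP; rewrite -subr_eq0 -normr_le0; apply/ler_addgt0Pl => e e0.
rewrite addr0.
have e20 : 0 < e / 2 by rewrite divr_gt0.
have A := second_difference u v oU Uy sf e20.
have B := second_difference v u oU Uy sf e20.
have [h [hA hB]] := filter_ex (filterI A B).
rewrite (splitr e); apply: le_trans (lerD hA hB).
set X := h ^- 2 * _ in hA *.
have -> : h ^- 2 * (f (y + h *: v + h *: u) - f (y + h *: v) - (f (y + h *: u) - f y)) = X.
  by rewrite /X; congr (_ * _); rewrite [y + h *: v + _]addrAC; ring.
by rewrite (le_trans (ler_distD X _ _)) // distrC.
Qed.

Lemma derive_comm_mx (U : set 'rV[R]_m) p q (f : 'rV[R]_m -> 'M[R]_(p, q)) y u v :
  open U -> U y ->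
  smooth_on U f -> 'D_v ('D_u f) y = 'D_u ('D_v f) y.
Proof.
move=> oU Uy sf; apply/matrixP => i j.
have sD w z : U z -> 'D_w f z i j = 'D_w (fun z => f z i j) z.
  by move=> Uz; rewrite derive_entry //; exact: smooth_on_diff sf Uz.
have E1 := derive_entry v i j (smooth_on_diff (smooth_on_derive u sf) Uy).
have E2 := derive_entry u i j (smooth_on_diff (smooth_on_derive v sf) Uy).
have F w w' : 'D_w (fun z => ('D_w' f z) i j) y = 'D_w ('D_w' (fun z => f z i j)) y.
  by apply: near_eq_derive; apply: near_open_eq Uy _ => // z /sD.
apply: etrans E1 _; apply: etrans (esym E2); apply: etrans (F v u) _; apply: etrans (esym (F u v)).
by apply: derive_comm Uy _ => //; move/smooth_mxP : sf; exact.
Qed.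

End Schwarz.

Section Bump.
Variable R : realType.

Lemma coord_le_norm m (y : 'rV[R]_m) j : `|y 0 j| <= `|y|.
Proof.
rewrite [leRHS]/Num.Def.normr/= mx_normrE.
exact: (le_bigmax _ (fun i : 'I_1 * 'I_m => `|y i.1 i.2|) (0, j)).
Qed.

Lemma norm_le_coord m (y : 'rV[R]_m) c : 0 <= c -> (forall j, `|y 0 j| <= c) -> `|y| <= c.
Proof.
move=> c0 H; rewrite /Num.Def.normr/= mx_normrE bigmax_le //= => -[i j] _ /=.
by rewrite ord1.
Qed.

(** x^-j exp (-1/x), extended by 0 to x <= 0. The derivative of [flat j] is a
    combination of [flat j.+1] and [flat j.+2], hence all of them are smooth. *)
Definition flat (j : nat) (x : R) : R :=
  if 0 < x then x^-1 ^+ j * expR (- x^-1) else 0.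

(** The exponential series bounds exp (1/x) below by (1/x)^(j+2) / (j+2)!. The
    quadratic decay that results makes the derivative at 0 vanish. *)
Lemma flat_le j x : `|flat j x| <= j.+2`!%:R * x ^+ 2.
Proof.
rewrite /flat; case: ltP => [x0|_]; last by rewrite normr0 mulr_ge0 // sqr_ge0.
rewrite ger0_norm; last by rewrite mulr_ge0 ?expR_ge0 // exprn_ge0 // invr_ge0 ltW.
have V0 : 0 <= x^-1 by rewrite invr_ge0 ltW.
have /(le_trans _) H := expR_ge1Dxn j.+1 V0.
have {}H : x^-1 ^+ j.+2 / j.+2`!%:R <= expR x^-1 by apply: H; rewrite lerDr.
rewrite expRN ler_pdivrMr ?expR_gt0 // mulrC.
have f0 : 0 < j.+2`!%:R :> R by rewrite ltr0n fact_gt0.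
have x20 : 0 < x ^+ 2 by rewrite exprn_gt0.
rewrite -(ler_pM2l x20) -(ler_pM2l f0) in H.
apply: le_trans _ (_ : j.+2`!%:R * (x ^+ 2 * expR x^-1) <= _); last by rewrite mulrA mulrC.
apply: le_trans H; move: (j.+2`!%:R : R) f0 => f f0.
rewrite !exprS expr0; move: (x^-1 ^+ j) => a.
by rewrite le_eqVlt; apply/orP; left; apply/eqP; field; rewrite !gt_eqF.
Qed.

Lemma is_derive_flat (j : nat) (t : R) :
  is_derive t 1 (flat j) (\sum_(c <- [:: (- j%:R : R, j.+1); (1, j.+2)]) c.1 * flat c.2 t).
Proof.
rewrite big_cons big_cons big_nil addr0 /= mul1r.
have [t0|t0|->] := ltgtP t 0.
- have -> : flat j.+1 t = 0 by rewrite /flat ltNge (ltW t0).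
  have -> : flat j.+2 t = 0 by rewrite /flat ltNge (ltW t0).
  rewrite mulr0 addr0; apply: near_eq_is_derive (is_derive_cst (0 : R) t 1).
  near=> s; rewrite /flat ltNge.
  have -> // : s <= 0 by apply/ltW; near: s; exact: lt_nbhsl.
- have -> : flat j.+1 t = t^-1 ^+ j.+1 * expR (- t^-1) by rewrite /flat t0.
  have -> : flat j.+2 t = t^-1 ^+ j.+2 * expR (- t^-1) by rewrite /flat t0.
  have FE : \near t, t^-1 ^+ j * expR (- t^-1) = flat j t.
    by near=> s; rewrite /flat; have -> // : 0 < s by near: s; exact: lt_nbhsr.
  apply: (near_eq_is_derive FE).
  have t0' : t != 0 by rewrite gt_eqF.
  have dX := is_derive1_compose (f := fun s : R => s^-1) (is_derive1X j t^-1) (is_derive1V t0').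
  have dE := is_derive1_compose (f := fun s : R => - s^-1) (is_derive_expR (- t^-1)) (is_derive1N (is_derive1V t0')).
  apply: (is_derive_eq (is_derive1M dX dE)).
  rewrite opprK -exprVn; case: j {dX FE} => [|j] /=.
    by rewrite !exprS !expr0; ring.
  by rewrite !exprS; ring.
have e0 j' : flat j' 0 = 0 by rewrite /flat ltxx.
rewrite !e0 mulr0 addr0.
have [||df e] := @differentiable_approx _ _ _ (flat j) 0 ('d (cst (0 : R)) (0 : R)).
- by rewrite diff_cst => x; exact: cvg_cst.
- move=> e e0'.
  have H : 0 < e / j.+2`!%:R by rewrite divr_gt0 // ltr0n fact_gt0.
  apply: filterS (@nbhs0_le R R _ H) => h hle; rewrite diff_cst e0 add0r /= !subr0.
  apply: le_trans (flat_le _ _) _; rewrite -real_normK ?num_real // expr2 mulrA.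
  by apply: ler_wpM2r => //; rewrite mulrC -ler_pdivlMr ?ltr0n ?fact_gt0.
apply: DeriveDef; first exact/derivable1_diffP.
by rewrite deriveE // e diff_cst.
Unshelve. all: by end_near. Qed.

Definition smooth_step (x : R) := flat 0 x / (flat 0 x + flat 0 (1 - x)).

Lemma flat0_ge0 x : 0 <= flat 0 x.
Proof. by rewrite /flat expr0 mul1r; case: ifP => // _; exact: expR_ge0. Qed.

Lemma smooth_step_den x : flat 0 x + flat 0 (1 - x) != 0.
Proof.
have [x0|x0] := ltP 0 x.
  by rewrite gt_eqF // ltr_wpDr ?flat0_ge0 // /flat x0 expr0 mul1r expR_gt0.
rewrite gt_eqF // ltr_wpDl ?flat0_ge0 // /flat; case: ifP => [_|].
  by rewrite expr0 mul1r expR_gt0.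
by rewrite subr_gt0 (le_lt_trans x0).
Qed.

Lemma smooth_step0 x : x <= 0 -> smooth_step x = 0.
Proof. by move=> x0; rewrite /smooth_step {1}/flat ltNge x0 mul0r. Qed.

Lemma smooth_step1 x : 1 <= x -> smooth_step x = 1.
Proof.
move=> x1; have := smooth_step_den x; rewrite /smooth_step.
have -> : flat 0 (1 - x) = 0 by rewrite /flat subr_gt0 ltNge x1.
by rewrite addr0 => /divff.
Qed.

(** The norm of ['rV_m], a maximum, is not smooth. The cutoff is a function of
    the squared Euclidean distance [q], which is smooth and dominates the square of
    the norm. *)
Lemma smooth_bump m (a : 'rV[R]_m) (rho : R) : 0 < rho ->
  exists chi : 'rV[R]_m -> R, [/\ smooth_on setT chi, \near a, chi a = 1 &
    forall y, rho <= `|y - a| -> chi y = 0].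
Proof.
move=> rho0.
pose q (y : 'rV[R]_m) := \sum_j (y 0 j - a 0 j) * (y 0 j - a 0 j).
have sq : smooth_on setT q.
  apply: smooth_on_sum => [|j]; first exact: openT.
  have sc : smooth_on setT (fun y : 'rV[R]_m => y 0 j - a 0 j).
    by apply: smooth_onD; [exact: openT|exact: smooth_coord|exact: smooth_cst].
  by apply: smooth_onM => //; exact: openT.
pose arg y := 2 + (- 2 / rho ^+ 2) * q y.
have sarg : smooth_on setT arg.
  apply: smooth_onD; [exact: openT|exact: smooth_cst|].
  by apply: smooth_onM; [exact: openT|exact: smooth_cst|].
have sflat f : smooth_on setT f -> smooth_on [set: 'rV[R]_m] (fun y => flat 0 (f y)).
  move=> sf; apply: (@smooth_comp1 _ _ flat _ setT _ _ 0%N openT _ _ sf) => // i t _.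
  exact: is_derive_flat.
exists (smooth_step \o arg); split.
- apply: smooth_onM; [exact: openT|exact: sflat|].
  apply: smooth_onV; [exact: openT|by move=> y _; exact: smooth_step_den|].
  apply: smooth_onD; [exact: openT|exact: sflat|apply: sflat].
  apply: smooth_onD; [exact: openT|exact: smooth_cst|].
  by apply: smooth_onN; first exact: openT.
- have qa : q a = 0 by rewrite /q big1 // => j _; rewrite subrr mul0r.
  have carg : {for a, continuous arg}.
    exact: differentiable_continuous (smooth_on_diff sarg (I : setT a)).
  have H : \near a, 1 < arg a.
    apply: (carg [set t | 1 < t]); apply: open_nbhs_nbhs; split; first exact: open_gt.
    by rewrite /arg /= qa mulr0 addr0 ltr1n.
  by apply: filterS H => y /ltW /smooth_step1.
move=> y ya; apply: smooth_step0.
rewrite /arg -lerBrDl sub0r mulNr mulNr lerN2 mulrAC ler_pdivlMr ?exprn_gt0 //.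
rewrite ler_pM2l //.
have q0 j : 0 <= (y 0 j - a 0 j) * (y 0 j - a 0 j) by rewrite -expr2 sqr_ge0.
have Q0 : 0 <= q y by apply: sumr_ge0 => j _.
rewrite -(@ler_sqrt _ _ (q y)) // sqrtr_sqr ger0_norm ?(ltW rho0) //.
apply: le_trans ya _; apply: norm_le_coord; first exact: sqrtr_ge0.
move=> j; rewrite !mxE -sqrtr_sqr ler_sqrt // expr2 /q (bigD1 j) //= lerDl.
by apply: sumr_ge0 => i _.
Qed.

End Bump.

(** * Ordinary differential equations and smooth dependence on parameters *)

Section Primitive.
Variable R : realType.

Lemma is_derive_mxP m n (M : R -> 'M[R]_(m, n)) (t : R) D :
  is_derive t 1 M D <-> forall i j, is_derive t 1 (fun t => M t i j) (D i j).
Proof.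
split=> [[dM eD] i j|H].
  by apply: DeriveDef; [have /derivable_mxP := dM; exact|rewrite -eD derive_mx // mxE].
have dM : derivable M t 1 by apply/derivable_mxP => i j; have [] := H i j.
by apply: DeriveDef => //; rewrite derive_mx //; apply/matrixP => i j; rewrite mxE; have [] := H i j.
Qed.

Lemma primitive1 (f : R -> R) : continuous f ->
  exists F : R -> R, F 0 = 0 /\ forall t : R, 0 <= t <= 1 -> is_derive t 1 F (f t).
Proof.
(* Integrating from -1, inside [-1, 2], makes 0 and 1 interior points. *)
move=> cf; pose F0 (x : R) := \int[lebesgue_measure]_(t in [set` `[-1, x]]) f t.
exists (fun x => F0 x - F0 0); split; first by rewrite subrr.
move=> t /andP[t0 t1].
have t2 : t < 2 by rewrite (le_lt_trans t1) // ltr1n.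
have fi : lebesgue_measure.-integrable `[-1, 2] (EFin \o f).
  apply: continuous_compact_integrable; first exact: segment_compact.
  exact: continuous_subspaceT.
have t1' : -1 < t by rewrite (lt_le_trans _ t0) // ltrN10.
have [dF eF] := continuous_FTC1_closed t2 fi t1' (cf t).
have dF0 : is_derive t 1 F0 (f t) := DeriveDef dF (etrans (esym (derive1E _ _)) eF).
have d := is_derive1B dF0 (is_derive_cst (F0 0) t 1).
apply: is_derive_eq d _.
by rewrite subr0.
Qed.

Lemma primitive n (f : R -> 'rV[R]_n) : continuous f ->
  exists F : R -> 'rV[R]_n, F 0 = 0 /\ forall t : R, 0 <= t <= 1 -> is_derive t 1 F (f t).
Proof.
move=> cf.
have H j : exists F : R -> R, F 0 = 0 /\ forall t : R, 0 <= t <= 1 -> is_derive t 1 F (f t 0 j).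
  apply: primitive1 => t.
  apply: (@continuous_comp _ _ _ f (fun M : 'rV[R]_n => M 0 j)); first exact: cf.
  exact: coord_continuous.
have [F FP] := choice H.
exists (fun t => \row_j F j t); split.
  by apply/rowP => j; rewrite !mxE; have [] := FP j.
move=> t t01; apply/is_derive_mxP => i j; rewrite ord1.
under eq_fun do rewrite mxE.
by have [_] := FP j; exact.
Qed.

Lemma derive_le0_nincr (f df : R -> R) :
  (forall t : R, 0 <= t <= 1 -> is_derive t 1 f (df t)) ->
  (forall t : R, 0 <= t <= 1 -> df t <= 0) ->
  forall t : R, 0 <= t <= 1 -> f t <= f 0.
Proof.
move=> fd df0 t /andP[t0 t1].
apply: (@ler0_derive1_nincr R f 0 1) => //.
- by move=> s; rewrite in_itv /= => /andP[s0 s1]; have [] := fd s _; rewrite ?ltW.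
- move=> s; rewrite in_itv /= => /andP[s0 s1].
  have s01 : 0 <= s <= 1 by rewrite !ltW.
  by rewrite derive1E; have [_ ->] := fd s s01; exact: df0.
- apply: derivable_within_continuous => s; rewrite in_itv /= => s01.
  by have [] := fd s s01.
Qed.

Lemma derive_le_le (f df g dg : R -> R) :
  (forall t : R, 0 <= t <= 1 -> is_derive t 1 f (df t)) ->
  (forall t : R, 0 <= t <= 1 -> is_derive t 1 g (dg t)) ->
  (forall t : R, 0 <= t <= 1 -> df t <= dg t) -> f 0 <= g 0 ->
  forall t : R, 0 <= t <= 1 -> f t <= g t.
Proof.
move=> fd gd fg fg0 t t01.
rewrite -subr_le0; apply: le_trans (_ : f 0 - g 0 <= 0); last by rewrite subr_le0.
apply: (@derive_le0_nincr (fun t => f t - g t) (fun t => df t - dg t)) => //.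
  by move=> s s01; exact: (is_derive1B (fd s s01) (gd s s01)).
by move=> s s01; rewrite subr_le0 fg.
Qed.

(** Coordinate by coordinate, since the norm is the maximum of the
    coordinates. *)
Lemma derive_norm_le n (f df : R -> 'rV[R]_n) (g dg : R -> R) :
  (forall t : R, 0 <= t <= 1 -> is_derive t 1 f (df t)) ->
  (forall t : R, 0 <= t <= 1 -> is_derive t 1 g (dg t)) ->
  (forall t : R, 0 <= t <= 1 -> `|df t| <= dg t) -> f 0 = 0 -> 0 <= g 0 ->
  forall t : R, 0 <= t <= 1 -> `|f t| <= g t.
Proof.
move=> fd gd fg f0 g0 t t01.
have fgj j (s : R) : 0 <= s <= 1 -> `|f s 0 j| <= g s.
  move=> s01; rewrite ler_norml; apply/andP; split.
    rewrite lerNl; apply: (@derive_le_le (fun t => - f t 0 j) (fun t => - df t 0 j) g dg) => //.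
    - by move=> r r01; apply: is_derive1N; have /is_derive_mxP := fd r r01; exact.
    - move=> r r01; apply: le_trans (fg r r01); apply: le_trans (coord_le_norm _ j).
      by rewrite -normrN ler_norm.
    - by rewrite f0 mxE oppr0.
  apply: (@derive_le_le (fun t => f t 0 j) (fun t => df t 0 j) g dg) => //.
  - by move=> r r01; have /is_derive_mxP := fd r r01; exact.
  - move=> r r01; apply: le_trans (fg r r01); apply: le_trans (coord_le_norm _ j).
    exact: ler_norm.
  - by rewrite f0 mxE.
apply: norm_le_coord => [|j]; last exact: fgj.
apply: le_trans g0 _.
apply: (@derive_le_le (fun=> g 0) (fun=> 0) g dg) => //.
by move=> s s01; exact: le_trans (fg s s01).
Qed.

(** The norm is not differentiable, but the squared Euclidean norm [psi] is,
    and psi' <= a psi + N c^2 for N the dimension and a = N (2 L + 1). Hence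
    exp (- a s) psi - N c^2 s is nonincreasing. The constant [K] does not depend on
    the curve, which is what uniform estimates on families of solutions need. *)
Lemma gronwall n (L : R) : 0 <= L -> exists2 K : R, 0 <= K &
  forall (phi dphi : R -> 'rV[R]_n) (c : R),
  (forall t : R, 0 <= t <= 1 -> is_derive t 1 phi (dphi t)) -> 0 <= c ->
  (forall t : R, 0 <= t <= 1 -> `|dphi t| <= L * `|phi t| + c) ->
  forall t : R, 0 <= t <= 1 -> `|phi t| <= K * (`|phi 0| + c).
Proof.
move=> L0; pose N : R := n%:R; pose a := N * (2 * L + 1).
have N0 : 0 <= N by rewrite ler0n.
have a0 : 0 <= a by rewrite mulr_ge0 // addr_ge0 // mulr_ge0.
have sumN x : N * x = \sum_(j < n) x by rewrite sumr_const card_ord -mulr_natl.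
pose K := N * expR a.
have K0 : 0 <= K by rewrite mulr_ge0 // expR_ge0.
exists (K + 1) => [|phi dphi c dP c0 H t t01]; first by rewrite addr_ge0.
pose psi t := \sum_j phi t 0 j * phi t 0 j.
pose dpsi t := \sum_j 2 * (phi t 0 j * dphi t 0 j).
have psid (s : R) : 0 <= s <= 1 -> is_derive s 1 psi (dpsi s).
  move=> s01; rewrite /psi.
  have -> : (fun t => \sum_j phi t 0 j * phi t 0 j) =
      \sum_j (fun t => phi t 0 j * phi t 0 j).
    by apply/funext => r; rewrite fct_sumE.
  apply: is_derive_sum => j.
  have /is_derive_mxP/(_ 0 j) d := dP s s01.
  apply: is_derive_eq (is_derive1M d d) _; ring.
have psi_ge s : `|phi s| ^+ 2 <= psi s.
  have P0 : 0 <= psi s by apply: sumr_ge0 => j _; rewrite -expr2 sqr_ge0.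
  rewrite -(@sqr_sqrtr _ (psi s)) // ler_pXn2r ?nnegrE ?sqrtr_ge0 //.
  apply: norm_le_coord; first exact: sqrtr_ge0.
  move=> j; rewrite -sqrtr_sqr ler_sqrt // expr2 /psi (bigD1 j) //= lerDl.
  by apply: sumr_ge0 => i _; rewrite -expr2 sqr_ge0.
have psi0 : psi 0 <= N * `|phi 0| ^+ 2.
  rewrite /psi sumN; apply: ler_sum => j _.
  by rewrite -expr2 -real_normK ?num_real // lerXn2r ?nnegrE // coord_le_norm.
have dpsi_le (s : R) : 0 <= s <= 1 -> dpsi s <= a * psi s + N * c ^+ 2.
  move=> s01; have Hs := H s s01.
  have phi0 : 0 <= `|phi s| by [].
  apply: (@le_trans _ _ (N * (2 * (`|phi s| * (L * `|phi s| + c))))).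
    rewrite /dpsi sumN; apply: ler_sum => j _.
    rewrite ler_pM2l //; apply: le_trans (ler_norm _) _; rewrite normrM.
    apply: ler_pM => //; first exact: coord_le_norm.
    by apply: le_trans Hs; exact: coord_le_norm.
  have A : 2 * (`|phi s| * (L * `|phi s| + c)) <= (2 * L + 1) * `|phi s| ^+ 2 + c ^+ 2.
    have := sqr_ge0 (`|phi s| - c); nra.
  apply: (@le_trans _ _ (N * ((2 * L + 1) * `|phi s| ^+ 2 + c ^+ 2))).
    exact: ler_wpM2l.
  rewrite mulrDr lerD2r mulrA; apply: ler_wpM2l => //.
pose E (s : R) := expR (- a * s).
have Ed (s : R) : is_derive s 1 E (- a * E s).
  have dl := is_derive1Z (- a) (is_derive_id s (1 : R)).
  have d := is_derive1_compose (is_derive_expR (- a * s)) dl.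
  by apply: is_derive_eq d _; rewrite /GRing.scale /= mulr1 mulrC.
pose chi s := E s * psi s - N * c ^+ 2 * s.
have chid (s : R) : 0 <= s <= 1 -> is_derive s 1 chi (E s * (dpsi s - a * psi s) - N * c ^+ 2).
  move=> s01; have dl := is_derive1Z (N * c ^+ 2) (is_derive_id s (1 : R)).
  have d := is_derive1B (is_derive1M (Ed s) (psid s s01)) dl.
  by apply: is_derive_eq d _; rewrite /GRing.scale /=; ring.
have Nc : 0 <= N * c ^+ 2 by rewrite mulr_ge0 // sqr_ge0.
have := @derive_le0_nincr _ _ chid _ t t01.
rewrite /chi {3}/E mulr0 expR0 mul1r mulr0 subr0 => {}H.
have chi_le : E t * psi t - N * c ^+ 2 * t <= psi 0.
  apply: H => s /[dup] s01 /andP[s0 s1]; rewrite subr_le0.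
  apply: (@le_trans _ _ (E s * (N * c ^+ 2))).
    rewrite ler_wpM2l ?expR_ge0 // lerBlDl; exact: dpsi_le.
  rewrite ler_piMl // expR_le1 mulNr oppr_le0 mulr_ge0 //.
have /andP[t0 t1] := t01.
have Et : psi t <= expR a * (psi 0 + N * c ^+ 2).
  have -> : psi t = expR (a * t) * (E t * psi t).
    by rewrite /E mulrA mulNr -expRD subrr expR0 mul1r.
  apply: (@le_trans _ _ (expR (a * t) * (psi 0 + N * c ^+ 2))).
    rewrite ler_wpM2l ?expR_ge0 //; rewrite lerBlDr in chi_le.
    apply: le_trans chi_le _; rewrite lerD2l ler_piMr //.
  apply: ler_wpM2r; last by rewrite ler_expR ler_piMr.
  by rewrite addr_ge0 // (le_trans _ (psi_ge 0)) // sqr_ge0.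
have S : `|phi t| ^+ 2 <= ((K + 1) * (`|phi 0| + c)) ^+ 2.
  apply: le_trans (psi_ge t) _; apply: le_trans Et _.
  apply: (@le_trans _ _ (K * (`|phi 0| ^+ 2 + c ^+ 2))).
    rewrite /K [N * expR a]mulrC -mulrA; apply: ler_wpM2l; first exact: expR_ge0.
    by rewrite mulrDr lerD2r.
  have p0 : 0 <= `|phi 0| by [].
  apply: (@le_trans _ _ (K * (`|phi 0| + c) ^+ 2)).
    by apply: ler_wpM2l => //; nra.
  rewrite exprMn; apply: ler_wpM2r; first exact: sqr_ge0.
  by nra.
rewrite -(@ler_pXn2r _ 2) ?nnegrE // mulr_ge0 ?addr_ge0 //.
Qed.

End Primitive.

Section Picard.
Variable R : realType.
Local Notation geo k := ((2^-1 : R) ^+ k).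

Lemma geo_ge0 k : 0 <= geo k.
Proof. by rewrite exprn_ge0 // invr_ge0. Qed.

Lemma geo_bound_eq0 (a D : R) : 0 <= a -> (forall k, a <= D * geo k) -> a = 0.
Proof.
move=> a0 H; apply/eqP; rewrite eq_le a0 andbT leNgt; apply/negP => agt.
have D0 : 0 <= D by rewrite (le_trans a0) // (le_trans (H 0%N)) // expr0 mulr1.
have := H (Num.bound (D / a)); have := archi_boundP (divr_ge0 D0 a0).
set k := Num.bound _ => Dk; rewrite leNgt => /negP; apply.
rewrite exprVn ltr_pdivrMr ?exprn_gt0 // -ltr_pdivrMl // mulrC.
apply: lt_le_trans Dk _.
by rewrite -natrX ler_nat ltnW // ltn_expl.
Qed.

(** The intervals [low k, up k] are nested. *)
Lemma geometric_limit1 (a : nat -> R) C : 0 <= C ->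
  (forall k, `|a k.+1 - a k| <= C * geo k) ->
  exists s, forall k, `|a k - s| <= 2 * C * geo k.
Proof.
move=> C0 H; pose low k := a k - 2 * C * geo k; pose up k := a k + 2 * C * geo k.
have lowS k : low k <= low k.+1.
  have := H k; rewrite /low exprS ler_norml => /andP[+ _]; have := geo_ge0 k; nra.
have upS k : up k.+1 <= up k.
  have := H k; rewrite /up exprS ler_norml => /andP[_]; have := geo_ge0 k; nra.
have lowup k l : low k <= up l.
  have lu j : low j <= up j.
    rewrite /low /up; have := mulr_ge0 C0 (geo_ge0 j); lra.
  apply: (@le_trans _ _ (low (maxn k l))).
    by apply: (homo_leq (@lexx _ _) (@le_trans _ _)) => //; exact: leq_maxl.
  apply: le_trans (lu _) _.
  have := @homo_leq _ up (fun x y => y <= x) (@lexx _ _) (fun y x z xy yz => le_trans yz xy) upS.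
  by apply; exact: leq_maxr.
exists (sup (range low)) => k.
have s1 : low k <= sup (range low).
  apply: ub_le_sup; last by exists k.
  by exists (up 0%N) => _ [l _ <-].
have s2 : sup (range low) <= up k.
  by apply: ge_sup => [|_ [l _ <-]] //; exists (low 0%N), 0%N.
rewrite distrC ler_distl; apply/andP; split; first exact: s1.
exact: s2.
Qed.

Lemma geometric_limit n (a : nat -> 'rV[R]_n) C : 0 <= C ->
  (forall k, `|a k.+1 - a k| <= C * geo k) ->
  exists s, forall k, `|a k - s| <= 2 * C * geo k.
Proof.
move=> C0 H.
have Hj j : exists s, forall k, `|a k 0 j - s| <= 2 * C * geo k.
  apply: geometric_limit1 => // k; apply: le_trans (H k).
  by have := coord_le_norm (a k.+1 - a k) j; rewrite !mxE.
have [s sP] := choice Hj.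
exists (\row_j s j) => k; apply: norm_le_coord; first by rewrite !mulr_ge0 // geo_ge0.
by move=> j; rewrite !mxE.
Qed.

(** Equations are solved on [0, 1] only; precomposing with this retraction
    extends curves, and continuity statements, to the whole line. *)
Definition clip (t : R) : R := Num.max 0 (Num.min 1 t).

Lemma clip01 t : 0 <= clip t <= 1.
Proof. by rewrite /clip le_max lexx /= ge_max ler01 ge_min lexx. Qed.

Lemma clip_id t : 0 <= t <= 1 -> clip t = t.
Proof. by move=> /andP[t0 t1]; rewrite /clip (min_idPr t1) (max_idPr t0). Qed.

Lemma continuous_clip : continuous clip.
Proof.
move=> t; apply: (@continuous_max _ _ (fun=> 0)); first exact: cst_continuous.
by apply: (@continuous_min _ _ (fun=> 1)); first exact: cst_continuous.
Qed.

Lemma continuous_uniform_limit n (u_ : nat -> R -> 'rV[R]_n) (u : R -> 'rV[R]_n) C :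
  (forall k, continuous (u_ k)) -> 0 <= C ->
  (forall k t, `|u_ k t - u t| <= C * geo k) -> continuous u.
Proof.
move=> cu C0 H t; apply/cvgrPdist_le => e e0.
have [k kP] : exists k, C * geo k <= e / 3.
  apply: contrapT => nk; have e3 : 0 < e / 3 by rewrite divr_gt0.
  suff /eqP : e / 3 = 0 by rewrite gt_eqF.
  apply: (@geo_bound_eq0 _ C) => [|k]; first exact: ltW.
  by apply: ltW; rewrite ltNge; apply/negP => kP; apply: nk; exists k.
have /cvgrPdist_le/(_ (e / 3)) := cu k t; rewrite divr_gt0 // => /(_ isT).
apply: filterS => s us.
have -> : u t - u s = - (u_ k t - u t) + (u_ k t - u_ k s) + (u_ k s - u s).
  by rewrite opprB !addrA !subrK.
have -> : e = e / 3 + e / 3 + e / 3 by field.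
apply: le_trans (ler_normD _ _) _; apply: lerD; last exact: le_trans (H _ _) kP.
apply: le_trans (ler_normD _ _) _; apply: lerD => //.
by rewrite normrN; exact: le_trans (H _ _) kP.
Qed.

(** Picard iteration. In the norm with weight [E t] = exp (2 L t) the integral
    operator contracts by 1/2, so that the iterates converge on the whole of [0, 1],
    however large [L] is. Continuity of [F] is asked along continuous curves,
    where its primitives are taken. *)
Theorem picard n (F : R -> 'rV[R]_n -> 'rV[R]_n) L : 0 < L ->
  (forall u : R -> 'rV[R]_n, continuous u -> continuous (fun t => F t (u t))) ->
  (forall (t : R) y y', 0 <= t <= 1 -> `|F t y - F t y'| <= L * `|y - y'|) ->
  forall x, exists zeta : R -> 'rV[R]_n, zeta 0 = x /\
    forall t : R, 0 <= t <= 1 -> is_derive t 1 zeta (F t (zeta t)).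
Proof.
move=> L0 cF lF x.
pose step (u w v : R -> 'rV[R]_n) := [/\ v 0 = x,
  forall t : R, 0 <= t <= 1 -> is_derive t 1 v (F t (u t)),
  forall t, w t = v (clip t) & continuous w].
have /choice[S SP] : forall u, exists p, continuous u -> step u p.1 p.2.
  move=> u; have [cu|ncu] := pselect (continuous u); last by exists (u, u).
  have [P [P0 Pd]] := primitive (cF u cu).
  pose v (t : R) := x + P t.
  have dv (t : R) : 0 <= t <= 1 -> is_derive t 1 v (F t (u t)).
    move=> t01; apply: is_derive_eq (is_derive1D (is_derive_cst x t 1) (Pd t t01)) _.
    by rewrite add0r.
  exists (v \o clip, v) => _; split => //; first by rewrite /= /v P0 addr0.
  move=> t; apply: continuous_comp; first exact: continuous_clip.
  apply: differentiable_continuous; apply/derivable1_diffP.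
  by have [] := dv _ (clip01 t).
pose u_ := fix u_ k := if k is k'.+1 then (S (u_ k')).1 else (fun=> x).
have cu k : continuous (u_ k).
  by elim: k => [|k IH]; [exact: cst_continuous|have [] := SP _ IH].
pose v_ k := (S (u_ k)).2.
have v0 k : v_ k 0 = x by have [] := SP _ (cu k).
have dv k (t : R) : 0 <= t <= 1 -> is_derive t 1 (v_ k) (F t (u_ k t)).
  by have [_ + _ _] := SP _ (cu k); exact.
have uS k t : u_ k.+1 t = v_ k (clip t) by have [_ _ + _] := SP _ (cu k); exact.
have u_clip k t : u_ k t = u_ k (clip t).
  by case: k => [|k] //; rewrite !uS [clip (clip t)]clip_id // clip01.
have [C C0 CP] : exists2 C, 0 <= C & forall t : R, 0 <= t <= 1 -> `|F t x| <= C.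
  have cN : continuous (fun t => `|F t x|).
    move=> t; apply: (@continuous_comp _ _ _ (fun t => F t x) (fun y => `|y|)).
      exact: (cF (fun=> x) (@cst_continuous _ _ x)).
    exact: norm_continuous.
  have [c c01 cP] := @EVT_max R (fun t => `|F t x|) 0 1 ler01 (continuous_subspaceT cN).
  by exists `|F c x| => // t t01; apply: cP; rewrite in_itv.
(* The primitive of L E is E / 2. *)
pose E (t : R) := expR (2 * L * t).
have dE (t : R) : is_derive t 1 E (2 * L * E t).
  have dl := is_derive1Z (2 * L) (is_derive_id t (1 : R)).
  have d := is_derive1_compose (is_derive_expR (2 * L * t)) dl.
  by apply: is_derive_eq d _; rewrite /GRing.scale /= mulr1 mulrC.
have E1 (t : R) : 0 <= t -> 1 <= E t.
  move=> t0; rewrite -expR0 ler_expR; apply: mulr_ge0 => //.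
  by rewrite mulr_ge0 // ltW.
have hk k (t : R) : 0 <= t <= 1 -> `|u_ k.+1 t - u_ k t| <= C * geo k * E t.
  elim: k t => [|k IH] t t01.
    rewrite uS clip_id // expr0 mulr1.
    apply: (@le_trans _ _ (C * t)); last first.
      have /andP[t0 t1] := t01; apply: ler_wpM2l => //.
      by apply: le_trans t1 _; exact: E1.
    apply: (@derive_norm_le _ _ (fun t => v_ 0%N t - x) (fun t => F t x) (fun t => C * t) (fun=> C)) => //.
    - move=> s s01; apply: is_derive_eq (is_derive1B (dv 0%N s s01) (is_derive_cst x s 1)) _.
      by rewrite subr0.
    - move=> s _; apply: is_derive_eq (is_derive1Z C (is_derive_id s (1 : R))) _.
      by rewrite /GRing.scale /= mulr1.
    - by rewrite v0 subrr.
    - by rewrite mulr0.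
  rewrite !uS clip_id //.
  apply: (@derive_norm_le _ _ (fun t => v_ k.+1 t - v_ k t)
     (fun t => F t (u_ k.+1 t) - F t (u_ k t))
     (fun t => C * geo k.+1 * E t) (fun t => L * (C * geo k * E t))) => //.
  - by move=> s s01; exact: is_derive1B (dv k.+1 s s01) (dv k s s01).
  - move=> s _; apply: is_derive_eq (is_derive1Z (C * geo k.+1) (dE s)) _.
    by rewrite /GRing.scale /= exprS; field.
  - by move=> s s01; apply: le_trans (lF _ _ _ s01) _; rewrite ler_pM2l // IH.
  - by rewrite !v0 subrr.
  - by rewrite !mulr_ge0 ?geo_ge0 // expR_ge0.
pose C' := C * expR (2 * L).
have C'0 : 0 <= C' by rewrite mulr_ge0 // expR_ge0.
have hk' k t : `|u_ k.+1 t - u_ k t| <= C' * geo k.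
  rewrite u_clip [u_ k t]u_clip; have c01 := clip01 t.
  apply: le_trans (hk k _ c01) _; rewrite /C' mulrAC; apply: ler_wpM2r; first exact: geo_ge0.
  apply: ler_wpM2l => //; rewrite ler_expR; apply: ler_piMr; last by have /andP[] := c01.
  by rewrite mulr_ge0 // ltW.
have /choice[u uP] t := geometric_limit C'0 (hk'^~ t).
have C'20 : 0 <= 2 * C' by rewrite mulr_ge0.
have cont_u : continuous u.
  by apply: (@continuous_uniform_limit _ u_ _ (2 * C')) => // k t; exact: uP.
have [] := SP u cont_u; set v := (S u).2 => v0' dv' _ _.
(* Both v, the primitive of F (u), and u are limits of the primitives of F (u_k). *)
have vu (t : R) : 0 <= t <= 1 -> v t = u t.
  move=> t01; apply/eqP; rewrite -subr_eq0 -normr_eq0; apply/eqP.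
  apply: (@geo_bound_eq0 _ (L * (2 * C') + 2 * C')) => // k.
  have -> : v t - u t = (v t - v_ k t) + (u_ k.+1 t - u t).
    by rewrite uS clip_id // addrA subrK.
  rewrite mulrDl; apply: le_trans (ler_normD _ _) _; apply: lerD; last first.
    apply: le_trans (uP t k.+1) _; apply: ler_wpM2l => //.
    by rewrite exprS ler_piMl ?geo_ge0 // invf_le1 // ler1n.
  apply: (@le_trans _ _ (L * (2 * C') * geo k * t)); last first.
    by apply: ler_piMr; [rewrite !mulr_ge0 ?geo_ge0 // ltW|have /andP[] := t01].
  apply: (@derive_norm_le _ _ (fun t => v t - v_ k t) (fun t => F t (u t) - F t (u_ k t))
     (fun t => L * (2 * C') * geo k * t) (fun=> L * (2 * C') * geo k)) => //.
  - by move=> s s01; exact: is_derive1B (dv' s s01) (dv k s s01).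
  - move=> s _; apply: is_derive_eq (is_derive1Z (L * (2 * C') * geo k) (is_derive_id s (1 : R))) _.
    by rewrite /GRing.scale /= mulr1.
  - move=> s s01; apply: le_trans (lF _ _ _ s01) _; rewrite -mulrA ler_pM2l //.
    by rewrite distrC; exact: uP.
  - by rewrite v0 v0' subrr.
  - by rewrite mulr0.
exists v; split=> // t t01; rewrite vu //; exact: dv'.
Qed.

End Picard.

Lemma choice2 (T U : Type) (P Q : T -> U -> Prop) :
  (forall x, exists2 y, P x y & Q x y) -> exists f, forall x, P x (f x) /\ Q x (f x).
Proof.
move=> H; have /choice[f fP] : forall x, exists y, P x y /\ Q x y.
  by move=> x; have [y] := H x; exists y.
by exists f.
Qed.

Section BallEstimates.
Variable R : realType.

Lemma compact_norm_ball n (rho : R) : compact [set y : 'rV[R]_n | `|y| <= rho].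
Proof.
apply: bounded_closed_compact.
  exists rho; split; first exact: num_real.
  by move=> x xr y /= yr; rewrite (le_trans yr) // ltW.
apply: (@closed_comp _ _ (fun y : 'rV[R]_n => `|y|) [set x | x <= rho]); last exact: closed_le.
by move=> y _; exact: norm_continuous.
Qed.

Lemma bounded_on_ball n (g : 'rV[R]_n -> R) (rho : R) : continuous g ->
  exists2 M, 0 <= M & forall y, `|y| <= rho -> `|g y| <= M.
Proof.
move=> cg; have [rho0|rho0] := ltP rho 0.
  by exists 0 => // y /le_lt_trans/(_ rho0); rewrite normr_lt0.
pose A := [set y : 'rV[R]_n | `|y| <= rho].
have cN : continuous (fun y => `|g y|).
  by move=> y; apply: (@continuous_comp _ _ _ g (fun x => `|x|)); [exact: cg|exact: norm_continuous].
have [||c _ cP] := @EVT_max_rV R n (fun y => `|g y|) A _ (@compact_norm_ball _ _).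
- by exists 0; rewrite /A /= normr0.
- exact: continuous_subspaceT.
by exists `|g c| => // y yA; apply: cP; rewrite inE.
Qed.

Lemma derive_ball_bound n (f : 'rV[R]_n -> R) rho : smooth_on setT f ->
  exists2 L, 0 <= L & forall y w, `|y| <= rho -> `|'D_w f y| <= L * `|w|.
Proof.
move=> sf.
have /choice[M MP] : forall j, exists M, 0 <= M /\
    forall y, `|y| <= rho -> `|'D_(delta_mx 0 j) f y| <= M.
  move=> j; have sD := smooth_on_derive (delta_mx 0 j) sf.
  have [|M M0 MP] := @bounded_on_ball _ ('D_(delta_mx 0 j) f) rho; last by exists M.
  by move=> y; apply: differentiable_continuous; exact: smooth_on_diff sD I.
exists (\sum_j M j) => [|y w yr]; first by apply: sumr_ge0 => j _; have [] := MP j.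
rewrite derive_dirE; last exact: smooth_on_diff sf I.
apply: le_trans (ler_norm_sum _ _ _) _; rewrite mulr_suml; apply: ler_sum => j _.
rewrite /GRing.scale /= normrM mulrC; apply: ler_pM => //; last exact: coord_le_norm.
by have [_] := MP j; exact.
Qed.

Lemma segment_ball n (y z : 'rV[R]_n) rho t : `|y| <= rho -> `|z| <= rho ->
  0 <= t <= 1 -> `|y + t *: (z - y)| <= rho.
Proof.
move=> yr zr /andP[t0 t1].
have -> : y + t *: (z - y) = (1 - t) *: y + t *: z.
  by rewrite scalerBr scalerBl scale1r addrA addrAC.
apply: le_trans (ler_normD _ _) _; rewrite !normrZ !ger0_norm ?subr_ge0 //.
have -> : rho = (1 - t) * rho + t * rho by ring.
by apply: lerD; apply: ler_wpM2l => //; rewrite subr_ge0.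
Qed.

Lemma lipschitz_ball n (f : 'rV[R]_n -> R) rho : smooth_on setT f ->
  exists2 L, 0 <= L & forall y z, `|y| <= rho -> `|z| <= rho ->
    `|f z - f y| <= L * `|z - y|.
Proof.
move=> sf; have [L L0 LP] := derive_ball_bound rho sf.
exists L => // y z yr zr.
have [|t t01] := @mean_value _ _ f y (z - y).
  by move=> t _; exact: smooth_on_diff sf I.
rewrite [y + (z - y)]addrC subrK => ->; apply: LP.
exact: segment_ball.
Qed.

Lemma taylor_ball n (f : 'rV[R]_n -> R) rho : smooth_on setT f ->
  exists2 L, 0 <= L & forall y z, `|y| <= rho -> `|z| <= rho ->
    `|f z - f y - 'D_(z - y) f y| <= L * `|z - y| ^+ 2.
Proof.
move=> sf.
have /choice[M MP] : forall j, exists M, 0 <= M /\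
    forall y z, `|y| <= rho -> `|z| <= rho ->
    `|'D_(delta_mx 0 j) f z - 'D_(delta_mx 0 j) f y| <= M * `|z - y|.
  move=> j; have sD := smooth_on_derive (delta_mx 0 j) sf.
  by have [M M0 MP] := lipschitz_ball rho sD; exists M.
exists (\sum_j M j) => [|y z yr zr]; first by apply: sumr_ge0 => j _; have [] := MP j.
have [|t t01] := @mean_value _ _ f y (z - y).
  by move=> t _; exact: smooth_on_diff sf I.
rewrite [y + (z - y)]addrC subrK => ->.
rewrite derive_dirE ?[X in _ - X]derive_dirE; [|exact: smooth_on_diff sf I..].
rewrite -sumrB; apply: le_trans (ler_norm_sum _ _ _) _.
rewrite mulr_suml; apply: ler_sum => j _.
rewrite -scalerBr /GRing.scale /= normrM expr2 mulrCA; apply: ler_pM => //.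
  exact: coord_le_norm.
have [M0] := MP j; move=> /(_ y (y + t *: (z - y)) yr (segment_ball yr zr t01)) H.
apply: le_trans H _; apply: ler_wpM2l => //; rewrite addrC addKr normrZ.
by have /andP[t0 t1] := t01; rewrite ger0_norm // ler_piMl.
Qed.

(** Continuity and compactness bound first derivatives on the ball; the mean
    value theorem on segments, contained in the ball by convexity, then gives the
    Lipschitz and Taylor bounds. One constant serves for the three. *)
Lemma ball_estimates n p (G : 'rV[R]_n -> 'rV[R]_p) rho : smooth_on setT G ->
  exists2 L, 0 < L & [/\
    forall y w, `|y| <= rho -> `|'D_w G y| <= L * `|w|,
    forall y z, `|y| <= rho -> `|z| <= rho -> `|G z - G y| <= L * `|z - y| &
    forall y z, `|y| <= rho -> `|z| <= rho ->
      `|G z - G y - 'D_(z - y) G y| <= L * `|z - y| ^+ 2].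
Proof.
move=> sG; have dG y : differentiable G y by exact: smooth_on_diff sG I.
have /smooth_mxP sGj := sG; have {}sGj j := sGj openT 0 j.
have [A AP] := choice2 (fun j => derive_ball_bound rho (sGj j)).
have [B BP] := choice2 (fun j => lipschitz_ball rho (sGj j)).
have [C CP] := choice2 (fun j => taylor_ball rho (sGj j)).
have A0 j : 0 <= A j by have [] := AP j.
have B0 j : 0 <= B j by have [] := BP j.
have C0 j : 0 <= C j by have [] := CP j.
have sum_ge (f : 'I_p -> R) j : (forall j, 0 <= f j) -> f j <= \sum_j f j.
  by move=> f0; rewrite (bigD1 j) //= lerDl sumr_ge0.
have SA : 0 <= \sum_j A j by apply: sumr_ge0.
have SB : 0 <= \sum_j B j by apply: sumr_ge0.
have SC : 0 <= \sum_j C j by apply: sumr_ge0.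
exists (1 + \sum_j A j + \sum_j B j + \sum_j C j).
  by rewrite -!addrA ltr_pwDl // !addr_ge0.
have L0 : 0 <= 1 + \sum_j A j + \sum_j B j + \sum_j C j.
  by rewrite !addr_ge0.
split.
- move=> y w yr; apply: norm_le_coord => [|j]; first exact: mulr_ge0.
  rewrite derive_entry //; have [_ /(_ y w yr) H] := AP j; apply: le_trans H _.
  by apply: ler_wpM2r => //; have := sum_ge A j A0; lra.
- move=> y z yr zr; apply: norm_le_coord => [|j]; first exact: mulr_ge0.
  rewrite !mxE; have [_ /(_ y z yr zr) H] := BP j; apply: le_trans H _.
  by apply: ler_wpM2r => //; have := sum_ge B j B0; lra.
- move=> y z yr zr; apply: norm_le_coord => [|j]; first by rewrite mulr_ge0 // exprn_ge0.
  rewrite !mxE derive_entry //; have [_ /(_ y z yr zr) H] := CP j; apply: le_trans H _.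
  by apply: ler_wpM2r; [exact: exprn_ge0|have := sum_ge C j C0; lra].
Qed.

End BallEstimates.

Section LinearODE.
Variable R : realType.

Lemma continuous_sum (T : topologicalType) (V : normedModType R) I (s : seq I)
    (f : I -> T -> V) : (forall i, continuous (f i)) ->
  continuous (fun t => \sum_(i <- s) f i t).
Proof.
move=> cf; elim: s => [|i s IH] t.
  by under eq_fun do rewrite big_nil; exact: cst_continuous.
under eq_fun do rewrite big_cons.
by apply: continuousD; [exact: cf|exact: IH].
Qed.

(** The field is linear in [w] with bounded coefficients, hence Lipschitz, and
    Picard's theorem applies on the whole interval. *)
Lemma linearized_solution N (G : 'rV[R]_N -> 'rV[R]_N) (zeta : R -> 'rV[R]_N) rho w0 :
  smooth_on setT G ->
  (forall t : R, 0 <= t <= 1 -> {for t, continuous zeta}) ->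
  (forall t : R, 0 <= t <= 1 -> `|zeta t| <= rho) ->
  exists w : R -> 'rV[R]_N, w 0 = w0 /\
    forall t : R, 0 <= t <= 1 -> is_derive t 1 w ('D_(w t) G (zeta t)).
Proof.
move=> sG czeta zr; have dG y : differentiable G y by exact: smooth_on_diff sG I.
have [L L0 [LP _ _]] := ball_estimates rho sG.
pose F t w := 'D_w G (zeta (clip t)).
have [||w [w00 dw]] := @picard R N F L L0 _ _ w0.
- move=> u cu.
  have -> : (fun t => F t (u t)) =
      (fun t => \sum_j u t 0 j *: 'D_(delta_mx 0 j) G (zeta (clip t))).
    by apply/funext => t; rewrite /F derive_dirE.
  have cu' j : continuous (fun t => u t 0 j).
    by move=> t; apply: (@continuous_comp _ _ _ u (fun y : 'rV[R]_N => y 0 j)); [exact: cu|exact: coord_continuous].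
  have cD j : continuous ('D_(delta_mx 0 j) G \o (zeta \o clip (R := R))).
    move=> t; apply: continuous_comp.
      by apply: continuous_comp; [exact: continuous_clip|apply: czeta; exact: clip01].
    apply: differentiable_continuous.
    exact: smooth_on_diff (smooth_on_derive (delta_mx 0 j) sG) I.
  by apply: continuous_sum => j t; apply: cvgZ; [exact: cu'|exact: cD].
- move=> t y y' t01; rewrite /F.
  have -> : 'D_y G (zeta (clip t)) - 'D_y' G (zeta (clip t)) = 'D_(y - y') G (zeta (clip t)).
    by rewrite derive_dirD // derive_dirN.
  by apply: LP; apply: zr; exact: clip01.
exists w; split=> // t t01; have := dw t t01; rewrite /F clip_id //.
Qed.

End LinearODE.

Section SolutionFamily.
Variable R : realType.

Lemma continuous_mulmxr n N (A : 'M[R]_(n, N)) :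
  continuous (mulmxr A : 'rV[R]_n -> 'rV[R]_N).
Proof.
move=> y; apply: differentiable_continuous.
have := @smooth_mulmx R n setT openT 1 n N id (fun=> A).
move=> /(_ (smooth_id openT) (@smooth_cst _ _ _ _ A)) s.
exact: smooth_on_diff s I.
Qed.

Lemma near_translate (V : normedModType R) (P : set V) x :
  nbhs x P -> \forall h \near 0, P (x + h).
Proof.
rewrite -[nbhs x P]/(\forall y \near x, P y) (near_shift 0) /= => H.
by apply: filterS H => h; rewrite /= subr0 addrC.
Qed.

(** A flow restricted to times in [0, 1] and to the initial values [iota x].
    Each [z ^~ x] is only required to agree on [0, 1] with a solution, as its values at
    other times are arbitrary. *)
Definition solution_family n N (G : 'rV[R]_N -> 'rV[R]_N) (U : set 'rV[R]_n)
    (iota : 'rV[R]_n -> 'rV[R]_N) (z : R -> 'rV[R]_n -> 'rV[R]_N) : Prop :=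
  forall x, U x -> exists zeta : R -> 'rV[R]_N, zeta 0 = iota x /\
    forall t : R, 0 <= t <= 1 -> zeta t = z t x /\ is_derive t 1 zeta (G (zeta t)).

Definition locally_bounded n N (U : set 'rV[R]_n) (z : R -> 'rV[R]_n -> 'rV[R]_N) :=
  forall x, U x -> exists rho, \forall x' \near x,
    forall t : R, 0 <= t <= 1 -> `|z t x'| <= rho.

(** Let [W] be the matrix solution of the linearised equation. By Gronwall's
    inequality d = z (x + h) - z x is O(|h|); then err = d - h W satisfies the
    linearised equation up to the Taylor remainder, which is O(|h|^2), and starts
    from o(|h|), so that Gronwall's inequality bounds it by e |h|. Thus h W is the
    differential of [z t]. *)
Lemma family_differentiable n N G (U : set 'rV[R]_n) iota (z : R -> 'rV[R]_n -> 'rV[R]_N) x :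
  open U -> smooth_on setT G -> smooth_on U iota ->
  solution_family G U iota z -> locally_bounded U z -> U x ->
  forall v, exists w : R -> 'rV[R]_N, w 0 = 'D_v iota x /\
    forall t : R, 0 <= t <= 1 -> [/\ differentiable (z t) x, w t = 'D_v (z t) x &
      is_derive t 1 w ('D_(w t) G (z t x))].
Proof.
move=> oU sG si fz bz Ux; have dG y : differentiable G y by exact: smooth_on_diff sG I.
have di := smooth_on_diff si Ux.
have [zeta [z0 zP]] := fz x Ux.
have [rho zr] := bz x Ux.
have zeta_r (t : R) : 0 <= t <= 1 -> `|zeta t| <= rho.
  by move=> t01; have [-> _] := zP t t01; exact: (nbhs_singleton zr).
have czeta (t : R) : 0 <= t <= 1 -> {for t, continuous zeta}.
  move=> t01; apply: differentiable_continuous; apply/derivable1_diffP.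
  by have [_ []] := zP t t01.
have [L L0 [L1 L2 L3]] := ball_estimates rho sG.
have [K K0 KP] := @gronwall R N L (ltW L0).
have /choice[w_ wP] : forall i : 'I_n, exists w : R -> 'rV[R]_N, w 0 = 'D_(delta_mx 0 i) iota x /\
    forall t : R, 0 <= t <= 1 -> is_derive t 1 w ('D_(w t) G (zeta t)).
  by move=> i; exact: linearized_solution sG czeta zeta_r.
pose W t : 'M[R]_(n, N) := \matrix_(i, j) w_ i t 0 j.
have WE (v : 'rV[R]_n) t : v *m W t = \sum_i v 0 i *: w_ i t.
  apply/rowP => j; rewrite !mxE summxE; apply: eq_bigr => i _; by rewrite !mxE.
have dW (v : 'rV[R]_n) (t : R) : 0 <= t <= 1 ->
    is_derive t 1 (fun t => v *m W t) ('D_(v *m W t) G (zeta t)).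
  move=> t01; have -> : (fun t => v *m W t) = \sum_i (fun t => v 0 i *: w_ i t).
    by apply/funext => s; rewrite WE fct_sumE.
  have -> : 'D_(v *m W t) G (zeta t) = \sum_i v 0 i *: 'D_(w_ i t) G (zeta t).
    rewrite WE deriveE // linear_sum; apply: eq_bigr => i _.
    by rewrite linearZ deriveE.
  by apply: is_derive_sum => i; apply: is_derive1Z; have [_] := wP i; exact.
have W0 v : v *m W 0 = 'D_v iota x.
  by rewrite WE derive_dirE //; apply: eq_bigr => i _; have [-> _] := wP i.
have key (t : R) : 0 <= t <= 1 ->
    differentiable (z t) x /\ forall v, 'D_v (z t) x = v *m W t.
  move=> t01.
  have LW := @continuous_mulmxr n N (W t).
  have [|dz e] := @differentiable_approx _ _ _ (z t) x (mulmxr (W t)) LW; last first.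
    by split => // v; rewrite deriveE // e.
  move=> e e0.
  have [c c0 cP] := linear_lipschitz (diff_continuous di).
  (* Half of e bounds the error on initial values, the other half the Taylor
  remainder. *)
  have e10 : 0 < e / (2 * (K + 1)) by rewrite divr_gt0 // mulr_gt0 // ltr_wpDl.
  set e1 := e / _ in e10.
  pose D := K * (c + e1).
  have D0 : 0 <= D by rewrite mulr_ge0 // addr_ge0 // ltW.
  have M0 : 0 < e / (2 * (K * L * D ^+ 2 + 1)).
    by rewrite divr_gt0 // mulr_gt0 // ltr_wpDl // mulr_ge0 ?sqr_ge0 // mulr_ge0 // ltW.
  have nU : nbhs x U by exact: open_nbhs_nbhs.
  have H1 := near_translate nU; have H2 := near_translate zr.
  have H3 := differentiable_near di e10.
  have H4 := @nbhs0_le R 'rV[R]_n _ M0.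
  apply: filterS (filterI (filterI H1 H2) (filterI H3 H4)) => h [[Uh zhr] [ih hle]] /=.
  have [zh [zh0 zhP]] := fz _ Uh.
  have zh_r (s : R) : 0 <= s <= 1 -> `|zh s| <= rho.
    by move=> s01; have [-> _] := zhP s s01; exact: zhr.
  pose d s := zh s - zeta s.
  have dd (s : R) : 0 <= s <= 1 -> is_derive s 1 d (G (zh s) - G (zeta s)).
    by move=> s01; have [_ d1] := zhP s s01; have [_ d2] := zP s s01; exact: is_derive1B.
  have d0 : `|d 0| <= (c + e1) * `|h|.
    rewrite /d zh0 z0 -[iota (x + h) - _](subrK ('d iota x h)) mulrDl addrC.
    by apply: le_trans (ler_normD _ _) _; apply: lerD.
  have dle (s : R) : 0 <= s <= 1 -> `|d s| <= D * `|h|.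
    move=> s01; apply: (@le_trans _ _ (K * (`|d 0| + 0))).
      apply: KP dd _ _ _ s01 => // r r01; rewrite addr0.
      by apply: L2; [exact: zeta_r|exact: zh_r].
    by rewrite addr0 /D -mulrA; apply: ler_wpM2l.
  pose err s := d s - h *m W s.
  pose derr s := G (zh s) - G (zeta s) - 'D_(h *m W s) G (zeta s).
  have derrP (s : R) : 0 <= s <= 1 -> is_derive s 1 err (derr s).
    by move=> s01; exact: is_derive1B (dd s s01) (dW h s s01).
  have err0 : `|err 0| <= e1 * `|h| by rewrite /err /d zh0 z0 W0 deriveE.
  have [-> _] := zP t t01 => //.
  have -> : z t (x + h) - z t x - h *m W t = err t.
    by rewrite /err /d; have [-> _] := zhP t t01; have [-> _] := zP t t01.
  have C0 : 0 <= L * (D * `|h|) ^+ 2 by rewrite mulr_ge0 ?sqr_ge0 // ltW.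
  apply: (@le_trans _ _ (K * (`|err 0| + L * (D * `|h|) ^+ 2))).
    apply: KP derrP C0 _ _ t01 => s s01.
    have -> : derr s = 'D_(err s) G (zeta s) + (G (zh s) - G (zeta s) - 'D_(d s) G (zeta s)).
      rewrite /err derive_dirD // derive_dirN // /derr.
      by rewrite [RHS]addrC addrA subrK.
    apply: le_trans (ler_normD _ _) _; apply: lerD.
      by apply: L1; exact: zeta_r.
    apply: le_trans (L3 _ _ (zeta_r s s01) (zh_r s s01)) _; apply: ler_wpM2l; first exact: ltW.
    by apply: lerXn2r (dle s s01); rewrite nnegrE // mulr_ge0.
  have h0 : 0 <= `|h| by [].
  apply: (@le_trans _ _ (K * (e1 * `|h|) + (K * L * D ^+ 2 * `|h|) * `|h|)).
    rewrite mulrDr; apply: lerD; first exact: ler_wpM2l.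
    by rewrite le_eqVlt; apply/orP; left; apply/eqP; ring.
  rewrite mulrA -mulrDl; apply: ler_wpM2r => //.
  have -> : e = e / 2 + e / 2 by field.
  apply: lerD.
    rewrite /e1 mulrA ler_pdivrMr ?mulr_gt0 // ?ltr_wpDl //; nra.
  have Q0 : 0 <= K * L * D ^+ 2 by rewrite mulr_ge0 ?sqr_ge0 // mulr_ge0 // ltW.
  move: Q0 hle; move: (K * L * D ^+ 2) => Q Q0 hle.
  apply: (@le_trans _ _ (Q * (e / (2 * (Q + 1))))); first exact: ler_wpM2l.
  by rewrite mulrA ler_pdivrMr ?mulr_gt0 // ?ltr_wpDl //; nra.
move=> v; exists (fun t => v *m W t); split; first exact: W0.
move=> t t01; have [dz Dz] := key t t01; split => //.
by have [<- _] := zP t t01; exact: dW.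
Qed.

End SolutionFamily.

Section SmoothDependence.
Variable R : realType.

Lemma smooth_row_mx m (U : set 'rV[R]_m) k p q (A : 'rV[R]_m -> 'M[R]_(k, p))
    (B : 'rV[R]_m -> 'M[R]_(k, q)) : open U ->
  smooth_on U A -> smooth_on U B -> smooth_on U (fun y => row_mx (A y) (B y)).
Proof.
move=> oU /smooth_mxP sA /smooth_mxP sB; apply/smooth_mxP => // i j.
case: (split_ordP j) => l ->.
  by apply: eq_smooth_on (sA oU i l) => // y _; rewrite row_mxEl.
by apply: eq_smooth_on (sB oU i l) => // y _; rewrite row_mxEr.
Qed.

Lemma smooth_lsubmx p q (U : set 'rV[R]_(p + q)) : open U ->
  smooth_on U (lsubmx : 'rV[R]_(p + q) -> 'rV[R]_p).
Proof.
move=> oU; apply/smooth_mxP => // i j; rewrite ord1.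
by apply: eq_smooth_on (smooth_coord (lshift q j)) => // y _; rewrite mxE.
Qed.

Lemma smooth_rsubmx p q (U : set 'rV[R]_(p + q)) : open U ->
  smooth_on U (rsubmx : 'rV[R]_(p + q) -> 'rV[R]_q).
Proof.
move=> oU; apply/smooth_mxP => // i j; rewrite ord1.
by apply: eq_smooth_on (smooth_coord (rshift p j)) => // y _; rewrite mxE.
Qed.

Lemma is_derive_row_mx p q (f : R -> 'rV[R]_p) (g : R -> 'rV[R]_q) (t : R) df dg :
  is_derive t 1 f df -> is_derive t 1 g dg ->
  is_derive t 1 (fun t => row_mx (f t) (g t)) (row_mx df dg).
Proof.
move=> /is_derive_mxP fd /is_derive_mxP gd; apply/is_derive_mxP => i j.
case: (split_ordP j) => l ->.
  by under eq_fun do rewrite row_mxEl; rewrite row_mxEl.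
by under eq_fun do rewrite row_mxEr; rewrite row_mxEr.
Qed.

(** The Jacobian matrix as the matrix of partial derivatives: smoothness is then
    visible entry by entry. *)
Definition total_derivative n p (G : 'rV[R]_n -> 'rV[R]_p) (y : 'rV[R]_n) : 'M[R]_(n, p) :=
  \matrix_(i, j) 'D_(delta_mx 0 i) G y 0 j.

Lemma total_derivativeE n p (G : 'rV[R]_n -> 'rV[R]_p) y v : differentiable G y ->
  'D_v G y = v *m total_derivative G y.
Proof.
move=> dG; rewrite derive_dirE //; apply/rowP => j; rewrite summxE mxE.
by apply: eq_bigr => i _; rewrite !mxE.
Qed.

Lemma smooth_total_derivative n p U (G : 'rV[R]_n -> 'rV[R]_p) : open U ->
  smooth_on U G -> smooth_on U (total_derivative G).
Proof.
move=> oU sG; apply/smooth_mxP => // i j.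
have /smooth_mxP sD := smooth_on_derive (delta_mx 0 i) sG.
by apply: eq_smooth_on (sD oU 0 j) => // y _; rewrite mxE.
Qed.

(** The field on pairs (point, tangent vector) whose flow is the derivative of
    the flow of [G]. *)
Definition tangent_field N (G : 'rV[R]_N -> 'rV[R]_N) (y : 'rV[R]_(N + N)) : 'rV[R]_(N + N) :=
  row_mx (G (lsubmx y)) ('D_(rsubmx y) G (lsubmx y)).

Lemma smooth_tangent_field N (G : 'rV[R]_N -> 'rV[R]_N) : smooth_on setT G ->
  smooth_on setT (tangent_field G).
Proof.
move=> sG; have dG y : differentiable G y by exact: smooth_on_diff sG I.
have sl := @smooth_lsubmx N N setT openT.
apply: smooth_row_mx; first exact: openT.
  exact: (smooth_comp_mx openT openT _ sl sG).
have sD := smooth_total_derivative openT sG.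
have := smooth_mulmx openT (smooth_rsubmx openT) (smooth_comp_mx openT openT (fun _ _ => I) sl sD).
apply: eq_smooth_on; first exact: openT.
by move=> y _; rewrite /= total_derivativeE.
Qed.

(** By induction on [k], for all families at once: a family and its derivative
    in a fixed direction form together a family for the tangent field. *)
Lemma family_Ck n (U : set 'rV[R]_n) k N (G : 'rV[R]_N -> 'rV[R]_N) iota z : open U ->
  smooth_on setT G -> smooth_on U iota ->
  solution_family G U iota z -> locally_bounded U z ->
  forall t : R, 0 <= t <= 1 -> Ck k U (z t).
Proof.
move=> oU; elim: k N G iota z => [|k IH] N G iota z sG si fz bz t t01;
  (split=> [x Ux|]; first by have [w [_ /(_ t t01)[]]] := family_differentiable oU sG si fz bz Ux 0) => // v.
pose z' (s : R) x : 'rV[R]_(N + N) := row_mx (z s x) ('D_v (z s) x).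
pose iota' x : 'rV[R]_(N + N) := row_mx (iota x) ('D_v iota x).
have si' : smooth_on U iota'.
  by apply: smooth_row_mx => //; exact: smooth_on_derive.
have fz' : solution_family (tangent_field G) U iota' z'.
  move=> x Ux; have [zeta [z0 zP]] := fz x Ux.
  have [w [w0 wP]] := family_differentiable oU sG si fz bz Ux v.
  exists (fun s => row_mx (zeta s) (w s)); split; first by rewrite z0 w0.
  move=> s s01; have [ez dz] := zP s s01; have [_ ew dw] := wP s s01.
  split; first by rewrite ez ew.
  rewrite /tangent_field row_mxKl row_mxKr; apply: is_derive_row_mx => //.
  by rewrite ez.
have bz' : locally_bounded U z'.
  move=> x Ux; have [rho zr] := bz x Ux.
  have [L L0 [L1 _ _]] := ball_estimates rho sG.
  have [K K0 KP] := @gronwall R N L (ltW L0).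
  have [M MP] : exists M, \forall x' \near x, `|'D_v iota x'| <= M.
    have cD : {for x, continuous ('D_v iota)}.
      exact: differentiable_continuous (smooth_on_diff (smooth_on_derive v si) Ux).
    exists (`|'D_v iota x| + 1).
    have /cvgrPdist_le/(_ 1 ltr01) := cD; apply: filterS => x' /= xx'.
    rewrite -[X in `|X| <= _](subKr ('D_v iota x)) (le_trans (ler_normB _ _)) //.
    by rewrite lerD2l.
  have nU : nbhs x U by exact: open_nbhs_nbhs.
  exists (`|rho| + K * M); apply: filterS (filterI nU (filterI zr MP)) => x' [Ux' [zr' M']] s s01.
  have [w [w0 wP]] := family_differentiable oU sG si fz bz Ux' v.
  have ws : `|w s| <= K * M.
    apply: (@le_trans _ _ (K * (`|w 0| + 0))); last first.
      by rewrite addr0 w0; apply: ler_wpM2l.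
    apply: (KP w (fun s => 'D_(w s) G (z s x')) 0) => //.
      by move=> r /wP[].
    by move=> r r01; rewrite addr0; apply: L1; exact: zr'.
  have [_ ew _] := wP s s01.
  apply: norm_le_coord => [|j].
    by apply: addr_ge0 => //; apply: le_trans ws.
  have zs := zr' s s01; have nr : rho <= `|rho| by exact: ler_norm.
  have w_ge0 : 0 <= `|w s| by [].
  rewrite /z' -ew; case: (split_ordP j) => l ->.
    by rewrite row_mxEl; have := coord_le_norm (z s x') l; lra.
  by rewrite row_mxEr; have := coord_le_norm (w s) l; have := normr_ge0 rho; lra.
have /Ck_mxP C := IH _ _ _ _ (smooth_tangent_field sG) si' fz' bz' t t01.
apply/Ck_mxP => // i j; apply: eq_Ck (C oU i (rshift N j)) => // x _.
by rewrite /z' row_mxEr.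
Qed.

Lemma family_smooth n (U : set 'rV[R]_n) N (G : 'rV[R]_N -> 'rV[R]_N) iota z : open U ->
  smooth_on setT G -> smooth_on U iota ->
  solution_family G U iota z -> locally_bounded U z ->
  forall t : R, 0 <= t <= 1 -> smooth_on U (z t).
Proof.
by move=> oU sG si fz bz t t01; apply/smooth_onP => k; exact: family_Ck fz bz t t01.
Qed.

End SmoothDependence.

(** * First-order systems along commuting fields *)

Section Extension.
Variable R : realType.

Lemma open_norm_ball n (p : 'rV[R]_n) (r : R) : open [set y | `|y - p| < r].
Proof.
have -> : [set y | `|y - p| < r] = ball p r.
  by apply/seteqP; split => y; rewrite -ball_normE /= distrC.
exact: ball_open.
Qed.

Lemma norm_ball_nbhs n (p : 'rV[R]_n) (A : set 'rV[R]_n) : nbhs p A ->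
  exists2 r, 0 < r & forall y, `|y - p| < r -> A y.
Proof.
move=> /nbhs_ballP[r r0 H]; exists r => // y yp; apply: H.
by rewrite -ball_normE /= distrC.
Qed.

(** The last property is the point: the product by [chi] extends by 0 any
    function that is smooth on [U]. *)
Lemma smooth_cutoff n (U : set 'rV[R]_n) p : open U -> U p ->
  exists (chi : 'rV[R]_n -> R) (r : R),
  [/\ forall y, `|y - p| <= r -> U y, smooth_on setT chi, \near p, chi p = 1,
      forall y, r <= `|y - p| -> chi y = 0 &
      forall k l (f : 'rV[R]_n -> 'M[R]_(k, l)), smooth_on U f -> smooth_on setT (fun y => chi y *: f y)].
Proof.
move=> oU Up.
have [r r0 rU] := norm_ball_nbhs (open_nbhs_nbhs (conj oU Up)).
have r20 : 0 < r / 2 by rewrite divr_gt0.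
have r2r : r / 2 < r by rewrite ltr_pdivrMr // ltr_pMr // ltr1n.
have [chi [schi chi1 chi0]] := smooth_bump p r20.
exists chi, (r / 2); split=> // [y yr|k l f sf]; first by apply: rU; exact: le_lt_trans r2r.
apply: smooth_on_local => y _; have [Uy|nUy] := pselect (U y).
  exists U; split=> //; apply: smooth_scale => //.
  exact: smooth_onS schi.
have cN : continuous (fun y : 'rV[R]_n => `|y - p|).
  move=> z; apply: (@continuous_comp _ _ _ (fun y : 'rV[R]_n => y - p) (fun y => `|y|)).
    by apply: continuousB => //; exact: cst_continuous.
  exact: norm_continuous.
have oV : open [set y | r / 2 < `|y - p|].
  by apply: (@open_comp _ _ _ [set x | r / 2 < x]); [move=> z _; exact: cN|exact: open_gt].
exists [set y | r / 2 < `|y - p|]; split=> //.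
  have ry : r <= `|y - p| by rewrite leNgt; apply/negP => /rU.
  exact: lt_le_trans ry.
apply: (@eq_smooth_on _ _ _ _ (fun=> 0)) => //; last exact: smooth_cst.
by move=> z /= /ltW /chi0 ->; rewrite scale0r.
Qed.

Lemma smooth_extension n k l (U : set 'rV[R]_n) p (f : 'rV[R]_n -> 'M[R]_(k, l)) :
  open U -> U p -> smooth_on U f ->
  exists2 g, smooth_on setT g & \near p, g p = f p.
Proof.
move=> oU Up sf; have [chi [r [_ _ chi1 _ chif]]] := smooth_cutoff oU Up.
exists (fun y => chi y *: f y); first exact: chif.
by apply: filterS chi1 => y ->; rewrite scale1r.
Qed.

End Extension.

Section Clamp.
Variable R : realType.

(** The retraction onto a ball of the maximum norm is 1-Lipschitz, so that
    composing with it makes a locally Lipschitz field globally Lipschitz. *)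
Definition clamp n (p : 'rV[R]_n) (r : R) (y : 'rV[R]_n) : 'rV[R]_n :=
  \row_j (p 0 j + Num.max (- r) (Num.min r (y 0 j - p 0 j))).

Lemma clamp_ball n (p : 'rV[R]_n) r y : 0 <= r -> `|clamp p r y - p| <= r.
Proof.
move=> r0; apply: norm_le_coord => // j; rewrite !mxE addrC addKr ler_norml.
by rewrite le_max lexx /= ge_max ge_min lexx /= andbT; lra.
Qed.

Lemma clamp_id n (p : 'rV[R]_n) r y : `|y - p| <= r -> clamp p r y = y.
Proof.
move=> yr; apply/rowP => j; rewrite !mxE.
have := le_trans (coord_le_norm _ j) yr; rewrite !mxE ler_norml => /andP[a b].
by rewrite (min_idPr b) (max_idPr a); ring.
Qed.

Lemma clamp_lipschitz n (p : 'rV[R]_n) r y z : `|clamp p r y - clamp p r z| <= `|y - z|.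
Proof.
apply: norm_le_coord => // j; rewrite !mxE.
have := coord_le_norm (y - z) j; rewrite !mxE; move: `|y - z| => N.
rewrite !ler_norml => /andP[a b].
by case: (leP r (y 0 j - p 0 j)) => ?; case: (leP r (z 0 j - p 0 j)) => ?; 
  case: (leP (- r) r) => ?; case: (leP (- r) (y 0 j - p 0 j)) => ?;
  case: (leP (- r) (z 0 j - p 0 j)) => ?; apply/andP; split; lra.
Qed.

End Clamp.

Section DeriveLines.
Variables (R : realType) (V W : normedModType R).

Lemma derive_line_eq (V' : normedModType R) (f : V -> W) (g : V' -> W) a v b w :
  (forall h : R, f (h *: v + a) - f a = g (h *: w + b) - g b) ->
  'D_v f a = 'D_w g b.
Proof. by move=> H; rewrite /derive; under eq_fun do rewrite /= H. Qed.

Lemma derive_line_linear (f : V -> W) a v c :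
  (forall h : R, f (h *: v + a) - f a = h *: c) -> 'D_v f a = c.
Proof.
move=> H; rewrite (@derive_line_eq R f (fun h : R => h *: c) a v 0 1); last first.
  by move=> h; rewrite H scale0r subr0 addr0 [h *: 1]mulr1.
by rewrite deriveE // diff_val scale1r.
Qed.

Lemma is_derive_chain (f : V -> W) (z : R -> V) (t : R) dz :
  is_derive t 1 z dz -> differentiable f (z t) ->
  is_derive t 1 (fun t => f (z t)) ('D_dz f (z t)).
Proof.
move=> [dzt <-] df; have dz' : differentiable z t by exact/derivable1_diffP.
apply: DeriveDef.
  by apply/derivable1_diffP; exact: (@differentiable_comp _ _ _ _ z f t dz' df).
by rewrite (@deriveE_comp _ _ _ _ z f t 1 dz' df).
Qed.

End DeriveLines.

Section Transport.
Variable R : realType.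

Lemma is_derive1_scale k (a : R -> R) (g : R -> 'rV[R]_k) (t : R) da dg :
  is_derive t 1 a da -> is_derive t 1 g dg ->
  is_derive t 1 (fun t => a t *: g t) (da *: g t + a t *: dg).
Proof.
move=> ad /is_derive_mxP gd; apply/is_derive_mxP => i j.
under eq_fun do rewrite mxE.
by apply: is_derive_eq (is_derive1M ad (gd i j)) _; rewrite !mxE.
Qed.

Lemma derive_row_mx (V : normedModType R) k l (f : V -> 'rV[R]_k) (g : V -> 'rV[R]_l) x v :
  differentiable f x -> differentiable g x ->
  'D_v (fun z => row_mx (f z) (g z)) x = row_mx ('D_v f x) ('D_v g x).
Proof.
move=> df dg; have dE j : differentiable (fun z => row_mx (f z) (g z) 0 j) x /\
    'D_v (fun z => row_mx (f z) (g z) 0 j) x = row_mx ('D_v f x) ('D_v g x) 0 j.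
  case: (split_ordP j) => i ->.
    under eq_fun do rewrite row_mxEl; rewrite row_mxEl derive_entry //.
    by split => //; move/differentiable_mxP : df; exact.
  under eq_fun do rewrite row_mxEr; rewrite row_mxEr derive_entry //.
  by split => //; move/differentiable_mxP : dg; exact.
apply/rowP => j; rewrite derive_entry ?(dE j).2 //.
by apply/differentiable_mxP => i k0; rewrite ord1; exact: (dE k0).1.
Qed.

Lemma lipschitz_continuous (V W : normedModType R) (f : V -> W) L : 0 < L ->
  (forall y z, `|f y - f z| <= L * `|y - z|) -> continuous f.
Proof.
move=> L0 H y; apply/cvgrPdist_le => e e0.
have eL : 0 < e / L by rewrite divr_gt0.
have /cvgrPdist_le/(_ _ eL) : id @ y --> y by exact: cvg_id.
apply: filterS => z yz; apply: le_trans (H y z) _.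
by rewrite mulrC -ler_pdivlMr.
Qed.

(** Write T = (S | a). The fields are the maps z |-> v S(z), for constant [v], and
    the system to solve is D_{v S} f = - v a. The solution is obtained by integrating
    a along curves starting at [x] with velocity - (x - p) S. *)
Variables (n q : nat) (T : 'rV[R]_n -> 'M[R]_(n, n + q)) (p : 'rV[R]_n) (r : R).
Hypotheses (r0 : 0 < r) (sT : smooth_on setT T).
Let S y := lsubmx (T y).

(** The state (u, (z, y)) consists of the parameter u = x - p, which is constant,
    of the moving point [z] and of the integral [y] of a. With the parameter in
    the state, dependence on [x] is dependence on initial values. *)
Let G (y : 'rV[R]_(n + (n + q))) : 'rV[R]_(n + (n + q)) :=
  row_mx 0 (- (lsubmx y *m T (lsubmx (rsubmx y)))).

Let smoothG : smooth_on setT G.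
Proof.
have sl := @smooth_lsubmx R n (n + q) setT openT.
have sz : smooth_on setT (fun y : 'rV[R]_(n + (n + q)) => lsubmx (rsubmx y)).
  exact: (smooth_comp_mx openT openT _ (smooth_rsubmx openT) (smooth_lsubmx openT)).
apply: smooth_row_mx; [exact: openT|exact: smooth_cst|].
apply: smooth_oppmx; first exact: openT.
apply: smooth_mulmx => //; first exact: openT.
exact: (smooth_comp_mx openT openT _ sz sT).
Qed.

Let smooth_uT (u : 'rV[R]_n) : smooth_on setT (fun y => u *m T y).
Proof. by apply: smooth_mulmx; [exact: openT|exact: smooth_cst|]. Qed.

Lemma derive_flow_field u y z' v u' : let Y := row_mx u y in
  'D_(row_mx u' (row_mx z' v)) G Y =
  row_mx 0 (- (u' *m T (lsubmx y)) - 'D_z' (fun z => u *m T z) (lsubmx y)).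
Proof.
move=> Y; have dG : differentiable G Y by exact: smooth_on_diff smoothG I.
have -> : row_mx u' (row_mx z' v) = row_mx u' 0 + row_mx 0 (row_mx z' v).
  by rewrite add_row_mx addr0 add0r.
rewrite derive_dirD //.
have -> : 'D_(row_mx u' 0) G Y = row_mx 0 (- (u' *m T (lsubmx y))).
  apply: derive_line_linear => h; rewrite /G /Y scale_row_mx add_row_mx !row_mxKl !row_mxKr.
  rewrite scaler0 add0r opp_row_mx add_row_mx subrr opprK mulmxDl opprD subrK.
  by rewrite scale_row_mx scaler0 -scalemxAl scalerN.
have -> : 'D_(row_mx 0 (row_mx z' v)) G Y =
    'D_z' (fun z => row_mx 0 (- (u *m T z)) : 'rV[R]_(n + (n + q))) (lsubmx y).
  apply: derive_line_eq => h; rewrite /G /Y scale_row_mx add_row_mx !row_mxKl !row_mxKr.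
  rewrite scaler0 add0r; congr (row_mx _ (- (_ *m T _)) - _).
  by rewrite linearD linearZ /= row_mxKl.
have dT : differentiable (fun z => u *m T z) (lsubmx y) by exact: smooth_on_diff (smooth_uT u) I.
have -> : 'D_z' (fun z => row_mx 0 (- (u *m T z)) : 'rV[R]_(n + (n + q))) (lsubmx y) =
    row_mx 0 (- 'D_z' (fun z => u *m T z) (lsubmx y)).
  rewrite derive_row_mx //; last exact: (@differentiableN _ _ _ (fun z => u *m T z)).
  by rewrite derive_cst (@deriveN _ _ _ (fun z => u *m T z)) //; exact: diff_derivable.
by rewrite add_row_mx addr0.
Qed.

Hypothesis S_T : forall x y, `|x - p| < r -> `|y - p| < r -> S x *m T y = T y.
Hypothesis commT : forall y u v, `|y - p| < r ->
  'D_(u *m S y) (fun z => v *m T z) y = 'D_(v *m S y) (fun z => u *m T z) y.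

Lemma norm_lsubmx k l (y : 'rV[R]_(k + l)) : `|lsubmx y : 'rV[R]_k| <= `|y|.
Proof. by apply: norm_le_coord => // j; rewrite mxE coord_le_norm. Qed.

Lemma norm_row_mx k l (y : 'rV[R]_k) (z : 'rV[R]_l) : `|row_mx y z : 'rV[R]_(k + l)| <= `|y| + `|z|.
Proof.
apply: norm_le_coord => [|j]; first exact: addr_ge0.
case: (split_ordP j) => i ->.
  by rewrite row_mxEl (le_trans (coord_le_norm _ _)) // lerDl.
by rewrite row_mxEr (le_trans (coord_le_norm _ _)) // lerDr.
Qed.

Lemma mulT_bound rho : exists2 C, 0 <= C &
  forall y (u : 'rV[R]_n), `|y| <= rho -> `|u *m T y| <= C * `|u|.
Proof.
have sTij i j : smooth_on setT (fun y => T y i j).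
  by have /smooth_mxP := sT; apply; exact: openT.
have [M MP] := choice2 (fun ij : 'I_n * 'I_(n + q) => @bounded_on_ball R n (fun y => T y ij.1 ij.2) rho
   (fun y => differentiable_continuous (smooth_on_diff (sTij ij.1 ij.2) (I : setT y)))).
have M0 ij : 0 <= M ij by have [] := MP ij.
have C0 : 0 <= \sum_ij M ij by apply: sumr_ge0.
exists (\sum_ij M ij) => // y u yr; apply: norm_le_coord => [|j]; first exact: mulr_ge0.
rewrite mxE (le_trans (ler_norm_sum _ _ _)) //.
apply: (@le_trans _ _ (\sum_i M (i, j) * `|u|)).
  apply: ler_sum => i _; rewrite normrM mulrC; apply: ler_pM => //; last exact: coord_le_norm.
  by have [_] := MP (i, j); exact.
rewrite -mulr_suml; apply: ler_wpM2r => //.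
have -> : \sum_ij M ij = \sum_i \sum_j M (i, j).
  by rewrite pair_bigA; apply: eq_bigr => -[].
apply: ler_sum => i _.
by rewrite (bigD1 j) //= lerDl sumr_ge0.
Qed.

(** As long as [z] is in the ball of radius r / 2, its speed is at most
    C |x - p|, hence for small [x - p] it does not leave this ball before time 1. The
    equation is solved with the clamped field, and the clamp is then seen to be
    inactive. *)
Lemma trajectory : exists2 eps, 0 < eps & exists2 C, 0 <= C & forall x, `|x - p| < eps ->
  exists y : R -> 'rV[R]_(n + q), y 0 = row_mx x 0 /\ forall t : R, 0 <= t <= 1 ->
  [/\ is_derive t 1 y (- ((x - p) *m T (lsubmx (y t)))),
      `|y t - row_mx x 0| <= C & `|lsubmx (y t) - p| < r].
Proof.
pose r' := r / 2; have r'0 : 0 < r' by rewrite divr_gt0.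
have r'r : r' < r by rewrite ltr_pdivrMr // ltr_pMr // ltr1n.
pose rho := `|p| + r.
have clamp_rho y : `|clamp p r' y| <= rho.
  rewrite -[clamp p r' y](subrK p) addrC (le_trans (ler_normD _ _)) // lerD2l.
  by rewrite (le_trans (clamp_ball _ _ (ltW r'0))) // ltW.
have [C C0 CP] := mulT_bound rho.
have C1 : 0 < C + 1 by rewrite ltr_wpDl.
exists (r' / (C + 1)); first exact: divr_gt0.
exists r'; first exact: ltW.
move=> x; rewrite ltr_pdivlMr // => xp.
have [L L0 [_ L2 _]] := ball_estimates rho (smooth_uT (x - p)).
pose F (y : 'rV[R]_(n + q)) := - ((x - p) *m T (clamp p r' (lsubmx y))).
have lF y z : `|F y - F z| <= L * `|y - z|.
  rewrite /F -opprD normrN.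
  apply: le_trans (L2 _ _ (clamp_rho _) (clamp_rho _)) _; rewrite ler_pM2l //.
  by apply: le_trans (clamp_lipschitz _ _ _ _) _; rewrite -linearB; exact: norm_lsubmx.
have cF := lipschitz_continuous L0 lF.
have [|y [y0 dy]] := @picard R (n + q) (fun=> F) L L0 _ (fun _ y z _ => lF y z) (row_mx x 0).
  by move=> u cu t; apply: (@continuous_comp _ _ _ u F); [exact: cu|exact: cF].
exists y; split=> // t t01.
have xpC : C * `|x - p| <= r'.
  by move: xp; have := normr_ge0 (x - p); nra.
have yt : `|y t - row_mx x 0| <= C * `|x - p|.
  apply: (@le_trans _ _ (C * `|x - p| * t)); last first.
    by have /andP[t0 t1] := t01; rewrite ler_piMr // mulr_ge0.
  apply: (@derive_norm_le _ _ (fun t => y t - row_mx x 0) (fun t => F (y t))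
    (fun t => C * `|x - p| * t) (fun=> C * `|x - p|)) => //.
  - move=> s s01; apply: is_derive_eq (is_derive1B (dy s s01) (is_derive_cst (row_mx x 0) s (1 : R))) _.
    by rewrite subr0.
  - move=> s _; apply: is_derive_eq (is_derive1Z (C * `|x - p|) (is_derive_id s (1 : R))) _.
    by rewrite /GRing.scale /= mulr1.
  - by move=> s _; rewrite normrN; exact: CP.
  - by rewrite y0 subrr.
  - by rewrite mulr0.
have yp : `|lsubmx (y t) - p| < r'.
  have -> : lsubmx (y t) - p = lsubmx (y t - row_mx x 0) + (x - p).
    by rewrite linearB /= row_mxKl addrA subrK.
  apply: le_lt_trans (ler_normD _ _) _; apply: le_lt_trans xp.
  rewrite mulrDr mulr1 lerD2r mulrC; apply: le_trans yt; exact: norm_lsubmx.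
split; [|exact: le_trans yt xpC|exact: lt_trans r'r].
by apply: is_derive_eq (dy t t01) _; rewrite /F clamp_id // ltW.
Qed.

Lemma derive_linear (V W W' : normedModType R) (g : V -> W) (f : {linear W -> W'}) x v :
  continuous f -> differentiable g x -> 'D_v (f \o g) x = f ('D_v g x).
Proof.
move=> cf dg; have df : differentiable f (g x) by exact: linear_differentiable.
by rewrite (deriveE_comp v dg df) deriveE // diff_lin.
Qed.

(** The hypothesis [commT] says that the fields (v S, v a) on R^n x R^q commute.
    The flow of one of them preserves the others, so the derivative of the flow in
    the direction v S(x) can be guessed: it is the curve [c] of the proof. It
    solves the linearised equation with the right initial value, and uniqueness,
    which follows from Gronwall's inequality, identifies it. At time 1 its last
    component is - v a(x). *)
Lemma transport_global : exists (V : set 'rV[R]_n) (f : 'rV[R]_n -> 'rV[R]_q),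
  [/\ open V, V p, smooth_on V f & forall x, V x -> `|x - p| < r /\
    forall v, 'D_(v *m S x) f x = - (v *m rsubmx (T x))].
Proof.
have [eps eps0 [C C0 traj]] := trajectory.
pose V := [set x | `|x - p| < eps]; have oV : open V by exact: open_norm_ball.
have /choice[Y YP] : forall x, exists y : R -> 'rV[R]_(n + q), V x ->
    y 0 = row_mx x 0 /\ forall t : R, 0 <= t <= 1 ->
    [/\ is_derive t 1 y (- ((x - p) *m T (lsubmx (y t)))),
      `|y t - row_mx x 0| <= C & `|lsubmx (y t) - p| < r].
  move=> x; have [Vx|nVx] := pselect (V x); last by exists (fun=> 0).
  by have [y yP] := traj x Vx; exists y.
pose z (t : R) x : 'rV[R]_(n + (n + q)) := row_mx (x - p) (Y x t).
pose iota x : 'rV[R]_(n + (n + q)) := row_mx (x - p) (row_mx x 0).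
have sxp : smooth_on V (fun x => x - p).
  by apply: smooth_onD => //; [exact: smooth_id|exact: smooth_cst].
have sx0 : smooth_on V (fun x => row_mx x (0 : 'rV[R]_q)).
  by apply: smooth_row_mx => //; [exact: smooth_id|exact: smooth_cst].
have si : smooth_on V iota by exact: smooth_row_mx.
have zG x (t : R) : V x -> 0 <= t <= 1 -> is_derive t 1 (fun t => z t x) (G (z t x)).
  move=> Vx t01; have [_ /(_ t t01)[dY _ _]] := YP x Vx.
  rewrite /G /z row_mxKl row_mxKr; apply: is_derive_row_mx => //; exact: is_derive_cst.
have fz : solution_family G V iota z.
  move=> x Vx; exists (fun t => z t x); split; first by rewrite /z (YP x Vx).1.
  by move=> t t01; split=> //; exact: zG.
have bz : locally_bounded V z.
  move=> x0 Vx0; exists (eps + (`|p| + eps + C)).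
  have nV : nbhs x0 V by exact: open_nbhs_nbhs.
  apply: filterS nV => x Vx t t01.
  apply: le_trans (norm_row_mx _ _) _; apply: lerD; first exact: ltW.
  have [_ /(_ t t01)[_ YC _]] := YP x Vx.
  rewrite -[Y x t](subrK (row_mx x 0)) addrC (le_trans (ler_normD _ _)) // lerD //.
  apply: le_trans (norm_row_mx _ _) _; rewrite normr0 addr0 -[x](subrK p) addrC.
  by rewrite (le_trans (ler_normD _ _)) // lerD2l ltW.
have t01 : 0 <= (1 : R) <= 1 by rewrite ler01 lexx.
have sz1 := family_smooth oV smoothG si fz bz t01.
exists V, (rsubmx \o (rsubmx \o z 1)); split=> //.
- by rewrite /V /= subrr normr0.
- apply: (smooth_comp_mx oV openT _ _ (smooth_rsubmx openT)) => //.
  exact: (smooth_comp_mx oV openT _ sz1 (smooth_rsubmx openT)).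
move=> x Vx; have [Yx0 YxP] := YP x Vx.
have xr : `|x - p| < r.
  have t00 : 0 <= (0 : R) <= 1 by rewrite ler01 lexx.
  by have [_ _] := YxP 0 t00; rewrite Yx0 row_mxKl.
split=> // v; set u := x - p.
have [w [w0 wP]] := family_differentiable oV smoothG si fz bz Vx (v *m S x).
pose zz t := lsubmx (Y x t).
pose k0 : 'rV[R]_(n + q) := row_mx 0 (- (v *m rsubmx (T x))).
(* Moving the starting point along v S displaces the state by v T; the change of
the parameter by v S(x) adds - t v T, because S(x) T = T. The constant k0 adjusts
the initial value. *)
pose c t : 'rV[R]_(n + (n + q)) := row_mx (v *m S x) ((1 - t) *: (v *m T (zz t)) + k0).
have dc (t : R) : 0 <= t <= 1 -> is_derive t 1 c ('D_(c t) G (z t x)).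
  move=> t01'; have [dY _ zzr] := YxP t t01'; rewrite -/u -/(zz t) in dY zzr.
  have dzz : is_derive t 1 zz (- (u *m S (zz t))).
    apply/is_derive_mxP => i j; rewrite ord1 /zz.
    under eq_fun do rewrite mxE.
    move/is_derive_mxP : dY => /(_ 0 (lshift q j)) dYj; apply: is_derive_eq dYj _.
    by rewrite /S mulmx_lsub !mxE.
  have dvT : differentiable (fun y => v *m T y) (zz t) by exact: smooth_on_diff (smooth_uT v) I.
  have duT : differentiable (fun y => u *m T y) (zz t) by exact: smooth_on_diff (smooth_uT u) I.
  have dv := is_derive_chain dzz dvT.
  have d1 : is_derive t 1 (fun t : R => 1 - t) (- 1).
    by apply: is_derive_eq (is_derive1B (is_derive_cst (1 : R) t 1) (is_derive_id t 1)) _; rewrite sub0r.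
  have dm := is_derive1D (is_derive1_scale d1 dv) (is_derive_cst k0 t (1 : R)).
  apply: is_derive_eq (is_derive_row_mx (is_derive_cst (v *m S x) t (1 : R)) dm) _.
  rewrite /c /z -/u; set m := (1 - t) *: _ + k0.
  rewrite -[m in RHS]hsubmxK derive_flow_field -/(zz t).
  have -> : lsubmx m = (1 - t) *: (v *m S (zz t)).
    by rewrite linearD linearZ /= row_mxKl addr0 mulmx_lsub.
  rewrite -mulmxA S_T // derive_dirZ // derive_dirN // commT // scaleN1r addr0.
  by rewrite scalerN addrC.
have c0 : c 0 = w 0.
  rewrite w0 /iota derive_row_mx; [|exact: smooth_on_diff sxp Vx|exact: smooth_on_diff sx0 Vx].
  rewrite derive_row_mx // derive_cst (@derive_translate _ _ _ id) !derive_id.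
  rewrite /c subr0 scale1r /zz Yx0 row_mxKl /k0 -{1}[T x]hsubmxK mul_mx_row.
  by rewrite add_row_mx addr0 subrr.
have [rho zr] := bz x Vx.
have [L L0 [L1 _ _]] := ball_estimates rho smoothG.
have [K K0 KP] := @gronwall R (n + (n + q)) L (ltW L0).
have dG y : differentiable G y by exact: smooth_on_diff smoothG I.
have cw : c 1 = w 1.
  apply/eqP; rewrite -subr_eq0 -normr_le0.
  have -> : 0 = K * (`|c 0 - w 0| + 0) :> R by rewrite c0 subrr normr0 addr0 mulr0.
  apply: (KP (fun t => c t - w t) (fun t => 'D_(c t) G (z t x) - 'D_(w t) G (z t x))) => //.
    by move=> t t01'; apply: is_derive1B; [exact: dc|have [_ _] := wP t t01'].
  move=> t t01'; rewrite addr0 -derive_dirN // -derive_dirD //; apply: L1.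
  exact: (nbhs_singleton zr).
have [dz1 ew _] := wP 1 t01.
rewrite derive_linear; [|exact: continuous_rsubmx|]; last first.
  by apply: differentiable_comp => //; exact: differentiable_rsubmx.
rewrite derive_linear //; last exact: continuous_rsubmx.
by rewrite -ew -cw /c subrr scale0r add0r /= !row_mxKr.
Qed.

End Transport.

Section TransportLocal.
Variable R : realType.

(** The hypotheses, assumed near [p] only, are extended to
    globally smooth data by a cutoff. *)
Theorem transport n q (U : set 'rV[R]_n) (T : 'rV[R]_n -> 'M[R]_(n, n + q)) p :
  open U -> U p -> smooth_on U T ->
  (forall x y, U x -> U y -> lsubmx (T x) *m T y = T y) ->
  (forall y u v, U y -> 'D_(u *m lsubmx (T y)) (fun z => v *m T z) y =
                        'D_(v *m lsubmx (T y)) (fun z => u *m T z) y) ->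
  exists (V : set 'rV[R]_n) (f : 'rV[R]_n -> 'rV[R]_q),
  [/\ open V, V p, V `<=` U, smooth_on V f & forall x v, V x ->
    'D_(v *m lsubmx (T x)) f x = - (v *m rsubmx (T x))].
Proof.
move=> oU Up sT ST comm.
have [T' sT' T'T] := smooth_extension oU Up sT.
have nU : nbhs p U by exact: open_nbhs_nbhs.
have [r r0 rP] := norm_ball_nbhs (filterI nU T'T).
have rU y : `|y - p| < r -> U y by move=> /rP[].
have rT y : `|y - p| < r -> T' y = T y by move=> /rP[].
have rD y u w : `|y - p| < r -> 'D_w (fun z => u *m T' z) y = 'D_w (fun z => u *m T z) y.
  move=> yr; apply: near_eq_derive.
  by apply: near_open_eq (@open_norm_ball R n p r) yr _ => z /rT ->.
have [||V [f [oV Vp sf fP]]] := @transport_global R n q T' p r r0 sT'.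
- by move=> x y xr yr; rewrite !rT // ST //; exact: rU.
- by move=> y u v yr; rewrite !rD // rT // comm //; exact: rU.
exists V, f; split=> //; first by move=> x /fP[/rU].
by move=> x v /fP[xr /(_ v)]; rewrite rT.
Qed.

End TransportLocal.

(** * Linear algebra of a pair (tau, omega) *)

Section LinearAlgebra.
Variable F : numFieldType.

Lemma row_free_right_inverse m n (A : 'M[F]_(m, n)) : row_free A ->
  exists B : 'M[F]_(n, m), A *m B = 1%:M.
Proof. by move=> fA; exists (pinvmx A); exact: mulmxVp. Qed.

(** The restriction of a skew form to a complement of its kernel is a skew
    invertible matrix, so that (-1)^rank = 1. *)
Lemma skew_rank_even n (A : 'M[F]_n) : A^T = - A -> ~~ odd (\rank A).
Proof.
move=> skA.
have [k [B [Q [rk QP]]]] : exists k (B : 'M[F]_(k, n)) (Q : 'M[F]_(n, k)),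
    [/\ \rank A = k, B *m Q = 1%:M & (A <= B)%MS].
  have [Q QP] := row_free_right_inverse (row_base_free A).
  by exists (\rank A), (row_base A), Q; rewrite eq_row_base.
move=> /submxP[D DA]; rewrite rk.
have AQB : A *m Q *m B = A by rewrite DA -(mulmxA D) QP mulmx1.
pose S := Q^T *m A *m Q.
have skS : S^T = - S.
  by rewrite /S !trmx_mul trmxK skA mulNmx mulmxN mulmxA.
have ASB : B^T *m S *m B = A.
  have e : B^T *m Q^T *m A = A.
    have := congr1 trmx AQB; rewrite !trmx_mul skA !mulmxN mulmxA.
    exact: oppr_inj.
  by rewrite /S !mulmxA e.
have uS : S \in unitmx.
  rewrite -row_free_unit /row_free eqn_leq rank_leq_row /=.
  apply: (@leq_trans (\rank A)); first by rewrite rk.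
  by rewrite -ASB (leq_trans (mxrankM_maxl _ _)) // mxrankM_maxr.
have := congr1 determinant skS; rewrite det_tr -scaleN1r detZ => e.
apply/negP => o; move: e; rewrite -signr_odd o expr1 mulN1r => /eqP.
rewrite -subr_eq0 opprK -mulr2n -mulr_natr mulf_eq0 pnatr_eq0 orbF => /eqP d0.
by move: uS; rewrite unitmxE d0 unitr0.
Qed.

(** The codimension of Ker tau /\ Ker omega is rank omega when Ker omega is
    contained in Ker tau, and rank omega + 1 otherwise. As rank omega is even, an even
    class excludes the second case. *)
Lemma even_class_kernel n (A : 'M[F]_n) (tau : 'rV[F]_n) k : A^T = - A ->
  (n - \rank (kermx tau^T :&: kermx A)%MS)%N = (2 * k)%N ->
  (kermx A <= kermx tau^T)%MS /\ \rank A = (2 * k)%N.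
Proof.
move=> skA rk; have := skew_rank_even skA.
have := mxrank_sum_cap (kermx tau^T) (kermx A).
have := rank_leq_col (kermx tau^T + kermx A)%MS; rewrite !mxrank_ker.
have := mxrankS (capmxSr (kermx tau^T) (kermx A)); rewrite mxrank_ker.
have := rank_leq_row A; have := rank_leq_col tau^T.
move: rk; set c := \rank _; set a := \rank A; set t := \rank _; set s := \rank _.
move=> rk t1 an ca sn e oa.
have [ec ea] : c = (n - a)%N /\ a = (2 * k)%N by lia.
split=> //.
have : (kermx A <= kermx tau^T :&: kermx A)%MS.
  rewrite -(geq_leqif (mxrank_leqif_sup (capmxSr _ _))) mxrank_ker -/a -ec.
  by rewrite /c.
by rewrite sub_capmx => /andP[].
Qed.

Lemma skew_form0 n (A : 'M[F]_n) (v : 'rV[F]_n) : A^T = - A -> v *m A *m v^T = 0.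
Proof.
move=> skA; set x := v *m A *m v^T.
have : x^T = - x by rewrite /x !trmx_mul trmxK skA mulNmx mulmxN mulmxA.
rewrite [x]mx11_scalar tr_scalar_mx; set c := x 0 0 => /matrixP/(_ 0 0).
rewrite !mxE eqxx mulr1n => /eqP; rewrite -addr_eq0 -mulr2n -mulr_natr mulf_eq0.
by rewrite pnatr_eq0 orbF => /eqP ->; rewrite raddf0.
Qed.

Lemma rank_ker_add n (A : 'M[F]_n) (tau delta : 'rV[F]_n) : tau != 0 -> delta *m A = tau ->
  \rank (kermx A + delta)%MS = (n - \rank A).+1.
Proof.
move=> tau0 dA.
have d0 : delta != 0 by apply/eqP => d0; move: tau0; rewrite -dA d0 mul0mx eqxx.
rewrite mxrank_disjoint_sum; first by rewrite mxrank_ker rank_rV d0 addn1.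
apply/eqP; rewrite -submx0; apply/rV_subP => v; rewrite sub_capmx => /andP[/sub_kermxP vA].
move=> /sub_rVP[c vE]; move: vA; rewrite vE -scalemxAl dA => /eqP.
by rewrite scaler_eq0 (negbTE tau0) orbF => /eqP ->; rewrite scale0r sub0mx.
Qed.

(** Here alpha = dg, and the hypotheses on it are Delta g = - g and v g = 0 on
    Ker omega. For v in Ker tau, contracting dg /\ tau + g omega with v gives
    (v g) tau + g iota_v omega = g iota_w omega, for w = v + (v g / g) Delta. It
    vanishes exactly when w is in Ker omega, so that the characteristic distribution
    is Ker omega + Delta, one dimension more than Ker omega. *)
Lemma gauged_class n (A : 'M[F]_n) (tau delta alpha : 'rV[F]_n) g :
  A^T = - A -> (kermx A <= kermx tau^T)%MS -> tau != 0 -> delta *m A = tau ->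
  g != 0 -> delta *m alpha^T = (- g)%:M ->
  (forall v : 'rV_n, v *m A = 0 -> v *m alpha^T = 0) ->
  (n - \rank (kermx (g *: tau)^T :&:
    kermx (alpha^T *m tau - tau^T *m alpha + g *: A))%MS)%N = (\rank A).-1.
Proof.
move=> skA kA tau0 dA g0 dalpha kalpha.
set B := _ - _ + _.
have BE v : v *m B = (v *m alpha^T) *m tau - (v *m tau^T) *m alpha + g *: (v *m A).
  by rewrite /B mulmxDr mulmxBr !mulmxA scalemxAr.
have ktau v : v *m A = 0 -> v *m tau^T = 0.
  move=> vA; apply/sub_kermxP; apply: submx_trans kA; exact/sub_kermxP.
have dtau : delta *m tau^T = 0.
  have := skew_form0 delta skA; rewrite dA => /(congr1 trmx).
  by rewrite trmx_mul trmxK trmx0.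
have kgt (v : 'rV_n) : (v <= kermx (g *: tau)^T)%MS = (v *m tau^T == 0).
  rewrite sub_kermx linearZ /= -scalemxAr scaler_eq0 (negbTE g0) //.
have -> : \rank (kermx (g *: tau)^T :&: kermx B)%MS = \rank (kermx A + delta)%MS.
  apply/eqmx_rank/andP; split.
    apply/rV_subP => v; rewrite sub_capmx kgt => /andP[/eqP vtau /sub_kermxP].
    rewrite BE vtau mul0mx subr0 [v *m alpha^T]mx11_scalar mul_scalar_mx.
    set c := (v *m alpha^T) 0 0 => e.
    have -> : v = (v + (c / g) *: delta) + (- (c / g)) *: delta.
      by rewrite scaleNr addrK.
    apply: addmx_sub_adds; last exact: scalemx_sub.
    apply/sub_kermxP; rewrite mulmxDl -scalemxAl dA.
    apply: (scalerI g0); rewrite scaler0 scalerDr scalerA mulrC divfK //.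
    by rewrite addrC.
  rewrite addsmx_sub; apply/andP; split.
    apply/rV_subP => v /sub_kermxP vA; rewrite sub_capmx kgt ktau // eqxx /=.
    by apply/sub_kermxP; rewrite BE ktau // kalpha // vA !mul0mx subr0 scaler0 addr0.
  rewrite sub_capmx kgt dtau eqxx /=; apply/sub_kermxP.
  by rewrite BE dtau dalpha dA mul0mx subr0 mul_scalar_mx scaleNr addNr.
rewrite (rank_ker_add tau0 dA); have := rank_leq_row A.
have : (0 < \rank A)%N.
  by rewrite lt0n mxrank_eq0; apply/eqP => A0; move: tau0; rewrite -dA A0 mulmx0 eqxx.
by move: (\rank A) => a; lia.
Qed.

End LinearAlgebra.

Section SmoothLinearAlgebra.
Variable R : realType.

Lemma open_smooth_neq0 n (U : set 'rV[R]_n) (f : 'rV[R]_n -> R) : open U ->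
  smooth_on U f -> open [set y | U y /\ f y != 0].
Proof.
move=> oU sf; rewrite openE => y [Uy fy0].
have nU : nbhs y U by exact: open_nbhs_nbhs.
have cf : {for y, continuous f} by exact: differentiable_continuous (smooth_on_diff sf Uy).
have nf : \forall z \near y, f z != 0.
  by apply: (cf [set t | t != 0]); apply: open_nbhs_nbhs; split=> //.
exact: filterI nU nf.
Qed.

(** Columns A p N that form a basis of the column space of A p stay
    independent near [p], and by constancy of the rank they still span the column
    space of A y. The constant matrix [C] reads off coordinates in them. *)
Lemma const_rank_frame n k (U : set 'rV[R]_n) (A : 'rV[R]_n -> 'M[R]_k) p :
  open U -> U p -> smooth_on U A -> (forall y, U y -> \rank (A y) = \rank (A p)) ->
  exists l (N : 'M[R]_(k, l)) (C : 'M[R]_(l, k)) (V : set 'rV[R]_n),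
  [/\ open V, V p, V `<=` U & forall y, V y -> C *m (A y *m N) \in unitmx /\
    forall v : 'rV_k, v *m (A y *m N) = 0 -> v *m A y = 0].
Proof.
move=> oU Up sA rA.
have [N NP] := row_free_right_inverse (row_base_free (A p)).
have [C CP] : exists C : 'M[R]_(\rank (A p), k), C *m col_base (A p) = 1%:M.
  exists (pinvmx (col_base (A p))); apply: mulVpmx; exact: col_base_full.
have sCAN : smooth_on U (fun y => C *m (A y *m N)).
  apply: smooth_mulmx => //; first exact: smooth_cst.
  by apply: smooth_mulmx => //; exact: smooth_cst.
have ApN : A p *m N = col_base (A p) by rewrite -[RHS]mulmx1 -NP mulmxA mulmx_base.
have e1 : C *m (A p *m N) = 1%:M by rewrite ApN.
exists (\rank (A p)), N, C, [set y | U y /\ \det (C *m (A y *m N)) != 0]; split.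
- exact: open_smooth_neq0 oU (smooth_det oU sCAN).
- by split=> //; rewrite e1 det1 oner_neq0.
- by move=> y [].
move=> y [Uy d0]; have uCAN : C *m (A y *m N) \in unitmx by rewrite unitmxE unitfE.
split=> // v vAN; apply/sub_kermxP.
have : (v <= kermx (A y *m N))%MS by apply/sub_kermxP.
move/submx_trans; apply.
have sK : (kermx (A y) <= kermx (A y *m N))%MS.
  by apply/sub_kermxP; rewrite mulmxA mulmx_ker mul0mx.
rewrite -(geq_leqif (mxrank_leqif_sup sK)) !mxrank_ker leq_sub2l // (rA y Uy).
by apply: leq_trans (mxrankM_maxr C _); exact: eq_leq (esym (mxrank_unit uCAN)).
Qed.

(** The rows of [C] span a complement of the kernel of A y that does not
    depend on y, and S y projects onto the kernel along it. The rows
    of 1 - S x are in this complement, which S y annihilates, whence S x S y = S y. *)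
Lemma kernel_projector n k (U : set 'rV[R]_n) (A : 'rV[R]_n -> 'M[R]_k) p :
  open U -> U p -> smooth_on U A -> (forall y, U y -> \rank (A y) = \rank (A p)) ->
  exists (V : set 'rV[R]_n) (S : 'rV[R]_n -> 'M[R]_k),
  [/\ open V, V p, V `<=` U, smooth_on V S & forall y, V y ->
    [/\ S y *m A y = 0, forall v : 'rV_k, v *m A y = 0 -> v *m S y = v &
      forall x, V x -> S x *m S y = S y]].
Proof.
move=> oU Up sA rA; have [l [N [C [V [oV Vp VU VP]]]]] := const_rank_frame oU Up sA rA.
pose B y := A y *m N.
have sB : smooth_on V B.
  by apply: smooth_mulmx => //; [exact: smooth_onS sA|exact: smooth_cst].
pose S y := 1%:M - B y *m invmx (C *m B y) *m C.
exists V, S; split=> //.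
  apply: smooth_onD => //; first exact: smooth_cst.
  apply: smooth_oppmx => //; apply: smooth_mulmx => //; last exact: smooth_cst.
  apply: smooth_mulmx => //; apply: smooth_invmx => //.
    by move=> y /VP[].
  by apply: smooth_mulmx => //; exact: smooth_cst.
move=> y Vy; have [uB kB] := VP y Vy; rewrite -/(B y) in uB kB.
have CS z : V z -> C *m S z = 0.
  by move=> /VP[uz _]; rewrite /S mulmxBr mulmx1 (mulmxA C _ C) (mulmxA C (B z)) mulmxV // mul1mx subrr.
split.
- apply/row_matrixP => i; rewrite row0 row_mul; apply: kB.
  rewrite -row_mul /S mulmxBl mul1mx -!mulmxA mulVmx // mulmx1 subrr row0 //.
- by move=> v vA; rewrite /S mulmxBr mulmx1 /B !mulmxA vA !mul0mx subr0.
- move=> x Vx; rewrite -[RHS]subr0 -(mulmx0 _ (B x *m invmx (C *m B x))) -(CS y Vy).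
  by rewrite [X in X *m _]/S mulmxBl mul1mx (mulmxA _ C).
Qed.

(** Solve in the coordinates of a frame of the column space. *)
Lemma smooth_solution n k (U : set 'rV[R]_n) (A : 'rV[R]_n -> 'M[R]_k)
    (tau : 'rV[R]_n -> 'rV[R]_k) p :
  open U -> U p -> smooth_on U A -> smooth_on U tau ->
  (forall y, U y -> \rank (A y) = \rank (A p)) -> (forall y, U y -> (tau y <= A y)%MS) ->
  exists (V : set 'rV[R]_n) (X : 'rV[R]_n -> 'rV[R]_k),
  [/\ open V, V p, V `<=` U, smooth_on V X & forall y, V y -> X y *m A y = tau y].
Proof.
move=> oU Up sA st rA tA; have [l [N [C [V [oV Vp VU VP]]]]] := const_rank_frame oU Up sA rA.
have sN : smooth_on V (fun=> N) by exact: smooth_cst.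
have sB : smooth_on V (fun y => A y *m N) by apply: smooth_mulmx => //; exact: smooth_onS sA.
exists V, (fun y => tau y *m N *m invmx (C *m (A y *m N)) *m C); split=> //.
  apply: smooth_mulmx => //; last exact: smooth_cst.
  apply: smooth_mulmx => //; first by apply: smooth_mulmx => //; exact: smooth_onS st.
  apply: smooth_invmx => //; first by move=> y /VP[].
  by apply: smooth_mulmx => //; exact: smooth_cst.
move=> y Vy; have [uB kB] := VP y Vy; have /submxP[D DE] := tA y (VU y Vy).
apply/eqP; rewrite -subr_eq0 {2}DE -mulmxBl; apply/eqP; apply: kB.
by rewrite mulmxBl -(mulmxA _ C) -(mulmxA _ (invmx _)) mulVmx // mulmx1 DE mulmxA subrr.
Qed.

End SmoothLinearAlgebra.

(** * The gauge function in a chart *)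

Section Bracket.
Variable R : realType.

Definition bracket n (X Y : 'rV[R]_n -> 'rV[R]_n) y : 'rV[R]_n :=
  'D_(X y) Y y - 'D_(Y y) X y.

Lemma derive_scale m n (a : 'rV[R]_m -> R) (X : 'rV[R]_m -> 'rV[R]_n) y w :
  differentiable a y -> differentiable X y ->
  'D_w (fun z => a z *: X z) y = 'D_w a y *: X y + a y *: 'D_w X y.
Proof.
move=> da dX; have dXj j : differentiable (fun z => X z 0 j) y.
  by move/differentiable_mxP : dX; exact.
have dE j : (fun z => (a z *: X z) 0 j) = a * (fun z => X z 0 j).
  by apply/funext => z; rewrite mxE.
have daX : differentiable (fun z => a z *: X z) y.
  by apply/differentiable_mxP => i j; rewrite ord1 dE; exact: differentiableM.
apply/rowP => j; apply: etrans (derive_entry w 0 j daX) _.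
rewrite dE deriveM; [|exact: diff_derivable..].
have -> : 'D_w (fun z => X z 0 j) y = 'D_w X y 0 j by apply: esym; exact: derive_entry.
by rewrite !mxE /GRing.scale /=; ring.
Qed.

Lemma derive_mulmxr m n k (X : 'rV[R]_m -> 'rV[R]_n) (M : 'M[R]_(n, k)) y w :
  differentiable X y -> 'D_w (fun z => X z *m M) y = 'D_w X y *m M.
Proof.
move=> dX; have := @derive_linear R 'rV[R]_m 'rV[R]_n 'rV[R]_k X (mulmxr M) y w.
by apply => //; exact: continuous_mulmxr.
Qed.

Lemma bracket_combination n (D G G' : 'rV[R]_n -> 'rV[R]_n) (a a' : 'rV[R]_n -> R) y :
  differentiable D y -> differentiable G y -> differentiable G' y ->
  differentiable a y -> differentiable a' y ->
  let X z := G z + a z *: D z in let X' z := G' z + a' z *: D z in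
  bracket X X' y = bracket G G' y + a y *: bracket D G' y - a' y *: bracket D G y +
    ('D_(X y) a' y - 'D_(X' y) a y) *: D y.
Proof.
move=> dD dG dG' da da' X X'.
have dax (b : 'rV[R]_n -> R) : differentiable b y -> differentiable (fun z => b z *: D z) y.
  move=> db; apply/differentiable_mxP => i j; rewrite ord1.
  have -> : (fun z => (b z *: D z) 0 j) = b * (fun z => D z 0 j).
    by apply/funext => z; rewrite mxE.
  by apply: differentiableM => //; move/differentiable_mxP : dD; exact.
have DX H (b : 'rV[R]_n -> R) w : differentiable H y -> differentiable b y ->
    'D_w (fun z => H z + b z *: D z) y = 'D_w H y + ('D_w b y *: D y + b y *: 'D_w D y).
  move=> dH db; rewrite -derive_scale // -(@deriveD _ _ _ H (fun z => b z *: D z)) //.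
    exact: diff_derivable.
  by apply: diff_derivable; exact: dax.
rewrite /bracket /X /X' !DX //; set x := G y + _; set x' := G' y + _.
have -> : 'D_x G' y = 'D_(G y) G' y + a y *: 'D_(D y) G' y by rewrite derive_dirD // derive_dirZ.
have -> : 'D_x D y = 'D_(G y) D y + a y *: 'D_(D y) D y by rewrite derive_dirD // derive_dirZ.
have -> : 'D_x' G y = 'D_(G' y) G y + a' y *: 'D_(D y) G y by rewrite derive_dirD // derive_dirZ.
have -> : 'D_x' D y = 'D_(G' y) D y + a' y *: 'D_(D y) D y by rewrite derive_dirD // derive_dirZ.
move: ('D_x a' y) ('D_x' a y) ('D_(G y) G' y) ('D_(G' y) G y) ('D_(D y) G' y) ('D_(D y) G y).
move: ('D_(G y) D y) ('D_(G' y) D y) ('D_(D y) D y) (D y) (a y) (a' y).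
move=> d1 d2 d3 d r r' s s' b1 b2 b3 b4.
by apply/rowP => j; rewrite !mxE; ring.
Qed.

Lemma near_eq_bracket n (D X X' : 'rV[R]_n -> 'rV[R]_n) y :
  (\forall z \near y, X z = X' z) -> bracket D X y = bracket D X' y.
Proof.
move=> E; have e := near_eq_derive (D y) E.
by rewrite /bracket (nbhs_singleton E); congr (_ - _).
Qed.

End Bracket.

Section LocalGauge.
Variables (R : realType) (n : nat) (U : set 'rV[R]_n).
Variables (A : 'rV[R]_n -> 'M[R]_n) (tau Delta : 'rV[R]_n -> 'rV[R]_n) (p : 'rV[R]_n).
Hypotheses (oU : open U) (Up : U p).
Hypotheses (sA : smooth_on U A) (stau : smooth_on U tau) (sDelta : smooth_on U Delta).
Hypothesis rankA : forall y, U y -> \rank (A y) = \rank (A p).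
Hypothesis tau_neq0 : forall y, U y -> tau y != 0.
Hypothesis DeltaA : forall y, U y -> Delta y *m A y = tau y.
Hypothesis involutive : forall (V : set 'rV[R]_n) (X Y : 'rV[R]_n -> 'rV[R]_n), open V -> V `<=` U ->
  smooth_on V X -> smooth_on V Y -> (forall z, V z -> X z *m A z = 0) ->
  (forall z, V z -> Y z *m A z = 0) -> forall y, V y -> bracket X Y y *m A y = 0.
Hypothesis Delta_invariant : forall (V : set 'rV[R]_n) (X : 'rV[R]_n -> 'rV[R]_n), open V -> V `<=` U ->
  smooth_on V X -> (forall z, V z -> X z *m A z = 0) ->
  forall y, V y -> bracket Delta X y *m A y = 0.

(** Let [acol] be the linear form with value 1 on [Delta] and 0 on Ker omega. The
    kernel of [A'] = omega - acol tau is Ker omega + Delta. If S is a projector onto it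
    along a constant complement, the fields X_u = u S decompose as G_u + a_u Delta
    with G_u in Ker omega. Since Ker omega is involutive and invariant under Delta,
    [X_u, X_v] is in Ker omega + (X_u a_v - X_v a_u) Delta; but it is also in the
    constant complement, so it vanishes, and so does its coefficient along Delta.
    These are the integrability conditions of the system X_u f = - a_u, whose
    solutions satisfy Delta f = - 1 and v f = 0 for v in Ker omega. *)
Lemma local_gauge : exists (V : set 'rV[R]_n) (f : 'rV[R]_n -> R),
  [/\ open V, V p, V `<=` U, smooth_on V f & forall y, V y ->
    'D_(Delta y) f y = - 1 /\ forall v, v *m A y = 0 -> 'D_v f y = 0].
Proof.
have [j tauj] : exists j, tau p 0 j != 0 by apply/rV0Pn; exact: tau_neq0.
have stauj : smooth_on U (fun y => tau y 0 j) by move/smooth_mxP : stau; exact.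
pose U1 := [set y | U y /\ tau y 0 j != 0].
have oU1 : open U1 by exact: open_smooth_neq0.
have U1U : U1 `<=` U by move=> y [].
have U1p : U1 p by split.
pose acol y : 'cV[R]_n := (tau y 0 j)^-1 *: col j (A y).
have sacol : smooth_on U1 acol.
  apply: smooth_scale => //.
    apply: smooth_onV => //; first by move=> y [].
    exact: smooth_onS stauj.
  apply/smooth_mxP => // i k; rewrite ord1; have /smooth_mxP sAij := smooth_onS U1U sA.
  by apply: eq_smooth_on (sAij oU1 i j) => // y _; rewrite mxE.
have acolE y (v : 'rV_n) : v *m acol y = ((tau y 0 j)^-1 * (v *m A y) 0 j)%:M.
  rewrite /acol -scalemxAr; apply/matrixP => i k; rewrite !ord1 !mxE mulr1n; congr (_ * _).
  by apply: eq_bigr => l _; rewrite !mxE.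
pose A' y := A y - acol y *m tau y.
have A'E y (v : 'rV_n) : v *m A' y = v *m A y - ((tau y 0 j)^-1 * (v *m A y) 0 j) *: tau y.
  by rewrite mulmxBr mulmxA acolE mul_scalar_mx.
have DA' y : U1 y -> Delta y *m A' y = 0.
  by move=> [Uy t0]; rewrite A'E DeltaA // mulVf // scale1r subrr.
have Dacol y : U1 y -> Delta y *m acol y = 1%:M.
  by move=> [Uy t0]; rewrite acolE DeltaA // mulVf.
have sA' : smooth_on U1 A'.
  apply: smooth_onD => //; first exact: smooth_onS sA.
  apply: smooth_oppmx => //; apply: smooth_mulmx => //; exact: smooth_onS stau.
have rankA' y : U1 y -> \rank (A' y) = \rank (A' p).
  suff H z : U1 z -> (n - \rank (A' z) = (n - \rank (A p)).+1)%N.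
    move=> U1y; have := H y U1y; have := H p U1p; have := rank_leq_row (A' y).
    by have := rank_leq_row (A' p); move: (\rank _) (\rank _) (\rank _) => a b c; lia.
  move=> [Uz t0]; rewrite -(rankA Uz) -(rank_ker_add (tau_neq0 Uz) (DeltaA Uz)) -mxrank_ker.
  apply/eqmx_rank/andP; split.
    apply/rV_subP => v /sub_kermxP; rewrite A'E; set c := _ * _ => e.
    rewrite -[v](subrK (c *: Delta z)); apply: addmx_sub_adds; last exact: scalemx_sub.
    by apply/sub_kermxP; rewrite mulmxBl -scalemxAl DeltaA.
  rewrite addsmx_sub; apply/andP; split; last by apply/sub_kermxP; exact: DA'.
  by apply/rV_subP => v /sub_kermxP vA; apply/sub_kermxP; rewrite A'E vA mxE mulr0 scale0r subr0.
have [V [S [oV Vp VU1 sS SP]]] := kernel_projector oU1 U1p sA' rankA'.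
have VU y : V y -> U y by move=> /VU1[].
pose X (u z : 'rV[R]_n) : 'rV[R]_n := u *m S z.
pose a (u z : 'rV[R]_n) : R := (u *m (S z *m acol z)) 0 0.
pose G (u z : 'rV[R]_n) : 'rV[R]_n := X u z - a u z *: Delta z.
have sX (u : 'rV[R]_n) : smooth_on V (X u) by apply: smooth_mulmx => //; exact: smooth_cst.
have sSa (u : 'rV[R]_n) : smooth_on V (fun z => u *m (S z *m acol z)).
  apply: smooth_mulmx => //; first exact: smooth_cst.
  by apply: smooth_mulmx => //; exact: smooth_onS sacol.
have sa u : smooth_on V (a u) by have /smooth_mxP := sSa u; exact.
have sDV : smooth_on V Delta by exact: smooth_onS sDelta.
have sG u : smooth_on V (G u).
  apply: smooth_onD => //; apply: smooth_oppmx => //; exact: smooth_scale.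
have XA u z : V z -> X u z *m A z = a u z *: tau z.
  move=> Vz; have [SA' _ _] := SP z Vz.
  have : X u z *m A' z = 0 by rewrite /X -mulmxA SA' mulmx0.
  rewrite A'E => /eqP; rewrite subr_eq0 => /eqP ->; congr (_ *: _).
  by rewrite /a mulmxA acolE [RHS]mxE eqxx mulr1n.
have GA u z : V z -> G u z *m A z = 0.
  by move=> Vz; rewrite mulmxBl XA // -scalemxAl DeltaA ?subrr //; exact: VU.
have XE u : X u = (fun z => G u z + a u z *: Delta z).
  by apply/funext => z; rewrite /G subrK.
have comm u v y : V y -> bracket (X u) (X v) y = 0 /\
    'D_(X u y) (a v) y = 'D_(X v y) (a u) y.
  move=> Vy; set B := bracket _ _ _; set c := 'D_(X u y) (a v) y - 'D_(X v y) (a u) y.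
  have dX w : differentiable (X w) y by exact: smooth_on_diff (sX w) Vy.
  (* The bracket is c Delta up to an element of Ker omega. *)
  have BA : B *m A y = c *: tau y.
    have := @bracket_combination R n Delta (G u) (G v) (a u) (a v) y
      (smooth_on_diff sDV Vy) (smooth_on_diff (sG u) Vy) (smooth_on_diff (sG v) Vy)
      (smooth_on_diff (sa u) Vy) (smooth_on_diff (sa v) Vy).
    have Xy w : G w y + a w y *: Delta y = X w y by rewrite /G subrK.
    rewrite /= -!XE -/B !Xy -/c => ->.
    have Gz w z : V z -> G w z *m A z = 0 by exact: GA.
    have I1 := @involutive V _ _ oV VU (sG u) (sG v) (Gz u) (Gz v) y Vy.
    have I2 w := @Delta_invariant V _ oV VU (sG w) (Gz w) y Vy.
    have := I2 u; have := I2 v; move: I1.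
    move: (bracket (G u) (G v) y) (bracket Delta (G v) y) (bracket Delta (G u) y).
    move=> b1 b2 b3 e1 e2 e3; rewrite mulmxDl mulmxBl mulmxDl -!scalemxAl e1 e2 e3.
    by rewrite !scaler0 subr0 !add0r DeltaA //; exact: VU.
  have BS : B *m S y = 0.
    (* X_w(z) S(y) = X_w(y) does not depend on z. *)
    have DS w x : 'D_x (X w) y *m S y = 0.
      rewrite -derive_mulmxr //; have <- := derive_cst (X w y) y x.
      apply: near_eq_derive; apply: (near_open_eq oV Vy) => z Vz.
      by have [_ _ /(_ z Vz) e] := SP y Vy; rewrite /X -mulmxA e.
    by rewrite mulmxBl !DS subrr.
  have B0 : B = 0.
    have [_ + _] := SP y Vy => /(_ B); rewrite BS => <- //.
    have [_ t0] := VU1 y Vy.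
    by rewrite A'E BA mxE mulrCA mulVf // mulr1 subrr.
  split=> //; apply/eqP; rewrite -subr_eq0 -/c; move: BA; rewrite B0 mul0mx => /esym/eqP.
  by rewrite scaler_eq0 (negbTE (tau_neq0 (VU _ Vy))) orbF.
pose T y : 'M[R]_(n, n + 1) := row_mx (S y) (S y *m acol y).
have sT : smooth_on V T.
  apply: smooth_row_mx => //; apply: smooth_mulmx => //; exact: smooth_onS sacol.
have vT v z : v *m T z = row_mx (X v z) (v *m (S z *m acol z)) by rewrite /T mul_mx_row.
have [||V' [f [oV' V'p V'V sf fP]]] := transport oV Vp sT.
- move=> x y Vx Vy; have [_ _ SS] := SP y Vy.
  by rewrite /T row_mxKl mul_mx_row mulmxA SS.
- move=> y u v Vy; rewrite !row_mxKl -/(X u y) -/(X v y).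
  under eq_fun do rewrite vT; under [in RHS]eq_fun do rewrite vT.
  have dX w : differentiable (X w) y by exact: smooth_on_diff (sX w) Vy.
  have dSa (w : 'rV[R]_n) : differentiable (fun z => w *m (S z *m acol z)) y by exact: smooth_on_diff (sSa w) Vy.
  have [b0 ae] := comm u v y Vy.
  apply: etrans (derive_row_mx _ (dX v) (dSa v)) _.
  apply: etrans _ (esym (derive_row_mx _ (dX u) (dSa u))); congr row_mx.
    by apply/eqP; rewrite -subr_eq0 -/(bracket (X u) (X v) y) b0.
  apply/rowP => i; rewrite ord1.
  by apply: etrans (derive_entry _ _ _ (dSa v)) _; apply: etrans (esym (derive_entry _ _ _ (dSa u))).
exists V', (fun y => f y 0 0); split=> //.
- by move=> y /V'V /VU.
- by have /smooth_mxP := sf; apply.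
move=> y V'y; have Vy := V'V y V'y; have [_ SA' _] := SP y Vy.
have fE v : v *m A' y = 0 -> 'D_v (fun z => f z 0 0) y = - (v *m acol y) 0 0.
  move=> vA'; have := fP y v V'y; rewrite /T row_mxKl row_mxKr mulmxA SA' // => /matrixP/(_ 0 0).
  rewrite mxE => <-; apply: esym; apply: derive_entry; exact: smooth_on_diff sf V'y.
split=> [|v vA].
  by rewrite fE ?Dacol ?DA' //; [rewrite mxE|exact: VU1..].
rewrite fE; first by rewrite acolE vA !mxE mulr0 mul0rn oppr0.
by rewrite A'E vA mxE mulr0 scale0r subr0.
Qed.

End LocalGauge.

(** * Brackets and tensors in charts *)

Section RelatedFields.
Variable R : realType.

Lemma derive_mulmx m k n (a : 'rV[R]_m -> 'rV[R]_k) (M : 'rV[R]_m -> 'M[R]_(k, n)) y w :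
  differentiable a y -> differentiable M y ->
  'D_w (fun z => a z *m M z) y = 'D_w a y *m M y + a y *m 'D_w M y.
Proof.
move=> da dM.
have da' i : differentiable (fun z => a z 0 i) y by move/differentiable_mxP : da; exact.
have dM' i j : differentiable (fun z => M z i j) y by move/differentiable_mxP : dM; exact.
have dE j : (fun z => (a z *m M z) 0 j) = \sum_i ((fun z => a z 0 i) * (fun z => M z i j)).
  by apply/funext => z; rewrite mxE fct_sumE.
have daM : differentiable (fun z => a z *m M z) y.
  apply/differentiable_mxP => i j; rewrite ord1 dE.
  by apply: differentiable_sum => l; exact: differentiableM.
apply/rowP => j; apply: etrans (derive_entry w 0 j daM) _.
rewrite dE derive_sum => [|i]; last by apply: diff_derivable; exact: differentiableM.
rewrite !mxE -big_split /=; apply: eq_bigr => i _.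
rewrite deriveM; [|exact: diff_derivable..].
have -> : 'D_w (fun z => a z 0 i) y = 'D_w a y 0 i by apply: esym; exact: derive_entry.
have -> : 'D_w (fun z => M z i j) y = 'D_w M y i j by apply: esym; exact: derive_entry.
by rewrite /GRing.scale /=; ring.
Qed.

(** Differentiating X (psi z) = D_{X' z} psi z along Y' gives a first-order term,
    which yields the bracket of X' and Y', and a second derivative of psi, which is
    symmetric and cancels. *)
Lemma bracket_related k n (W : set 'rV[R]_k) (psi : 'rV[R]_k -> 'rV[R]_n)
    (X' Y' : 'rV[R]_k -> 'rV[R]_k) (X Y : 'rV[R]_n -> 'rV[R]_n) y :
  open W -> W y -> smooth_on W psi ->
  differentiable X' y -> differentiable Y' y ->
  differentiable X (psi y) -> differentiable Y (psi y) ->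
  (forall z, W z -> X (psi z) = 'D_(X' z) psi z) ->
  (forall z, W z -> Y (psi z) = 'D_(Y' z) psi z) ->
  bracket X Y (psi y) = 'D_(bracket X' Y' y) psi y.
Proof.
move=> oW Wy spsi dX' dY' dX dY relX relY.
have dpsi z : W z -> differentiable psi z by exact: smooth_on_diff.
have sT := smooth_total_derivative oW spsi.
have dT := smooth_on_diff sT Wy.
have chain (Z' : 'rV[R]_k -> 'rV[R]_k) (Z : 'rV[R]_n -> 'rV[R]_n) w :
    differentiable Z' y -> differentiable Z (psi y) ->
    (forall z, W z -> Z (psi z) = 'D_(Z' z) psi z) ->
    'D_('D_w psi y) Z (psi y) = 'D_('D_w Z' y) psi y + 'D_w ('D_(Z' y) psi) y.
  move=> dZ' dZ relZ; rewrite -(deriveE_comp w (dpsi y Wy) dZ).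
  have -> : 'D_w (Z \o psi) y = 'D_w (fun z => Z' z *m total_derivative psi z) y.
    apply: near_eq_derive; apply: (near_open_eq oW Wy) => z Wz.
    by rewrite /= relZ // (total_derivativeE _ (dpsi z Wz)).
  rewrite derive_mulmx // -(total_derivativeE _ (dpsi y Wy)); congr (_ + _).
  have -> : 'D_w ('D_(Z' y) psi) y = 'D_w (fun z => Z' y *m total_derivative psi z) y.
    apply: near_eq_derive; apply: (near_open_eq oW Wy) => z Wz.
    by rewrite (total_derivativeE _ (dpsi z Wz)).
  by rewrite (@derive_mulmx _ _ _ (fun=> Z' y)) // derive_cst mul0mx add0r.
rewrite /bracket (relX y Wy) (relY y Wy) (chain Y' Y) // (chain X' X) //.
have E1 := derive_comm_mx (X' y) (Y' y) oW Wy spsi.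
have E2 u v : 'D_(u - v) psi y = 'D_u psi y - 'D_v psi y.
  by rewrite (derive_dirD _ _ (dpsi y Wy)) (derive_dirN _ (dpsi y Wy)).
have cancel (a b c c' : 'rV[R]_n) : c = c' -> a + c' - (b + c) = a - b.
  by move=> ->; rewrite opprD addrACA subrr addr0.
exact (etrans (cancel _ _ _ _ E1) (esym (E2 _ _))).
Qed.

End RelatedFields.

Opaque derive jacobian.

Section Jacobian.
Variable R : realType.

Lemma mulmx_row_inj m n (A B : 'M[R]_(m, n)) : (forall v : 'rV_m, v *m A = v *m B) -> A = B.
Proof. by move=> H; apply/row_matrixP => i; rewrite !rowE. Qed.

Lemma jacobian_comp k m n (g : 'rV[R]_k -> 'rV[R]_m) (f : 'rV[R]_m -> 'rV[R]_n) y :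
  differentiable g y -> differentiable f (g y) ->
  jacobian (f \o g) y = jacobian g y *m jacobian f (g y).
Proof.
move=> dg df; apply: mulmx_row_inj => v.
have dfg : differentiable (f \o g) y by exact: differentiable_comp.
rewrite mulmxA -(deriveEjacobian v dfg) -(deriveEjacobian v dg) -(deriveEjacobian _ df).
exact: deriveE_comp.
Qed.

Lemma near_eq_jacobian m n (f g : 'rV[R]_m -> 'rV[R]_n) y : differentiable f y ->
  (\near y, f y = g y) -> jacobian f y = jacobian g y.
Proof.
move=> df fg; apply: mulmx_row_inj => v; have dg := near_eq_differentiable fg df.
apply: etrans (esym (deriveEjacobian v df)) _; apply: etrans (deriveEjacobian v dg).
exact: near_eq_derive.
Qed.

Lemma jacobian_id n (y : 'rV[R]_n) : jacobian id y = 1%:M.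
Proof. by apply: mulmx_row_inj => v; rewrite -deriveEjacobian // derive_id mulmx1. Qed.

End Jacobian.

Section ChartChange.
Variables (R : realType) (n : nat) (M : smooth_manifold R n).
Implicit Types (x : M) (c d e : chart R n M).

Lemma atlas_chart_at x : atlas (chart_at x).
Proof. by rewrite /chart_at; case: cid => c []. Qed.

Lemma cdom_chart_at x : cdom (chart_at x) x.
Proof. by rewrite /chart_at; case: cid => c []. Qed.

Definition overlap c d := cmap c @` (cdom c `&` cdom d).
Definition transition c d := cmap d \o cinv c.
(** The common form of [to_chart] and [from_chart]. *)
Definition Jchart c d x : 'M[R]_n := jacobian (transition c d) (cmap c x).

Lemma cinv_open_near c x (A : set M) : cdom c x -> open A -> A x ->
  \forall y \near cmap c x, A (cinv c y).
Proof.
move=> cx oA Ax; have := @cinv_continuous _ _ _ c (cmap c x) (ex_intro2 _ _ x cx erefl).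
by apply; rewrite cmapK //; exact: open_nbhs_nbhs.
Qed.

Lemma near_cimg c x : cdom c x -> \forall y \near cmap c x, (cmap c @` cdom c) y.
Proof.
by move=> cx; apply: open_nbhs_nbhs; split; [exact: open_cimg|exists x].
Qed.

Lemma open_chart_image c (A : set M) : open A -> open (cmap c @` (A `&` cdom c)).
Proof.
move=> oA; rewrite openE => _ [x [Ax cx] <-].
apply: filterS (filterI (near_cimg cx) (cinv_open_near cx oA Ax)) => y [[x' cx' <-]].
by rewrite cmapK // => Ax'; exists x'.
Qed.

Lemma open_overlap c d : open (overlap c d).
Proof. by rewrite /overlap setIC; apply: open_chart_image; exact: open_cdom. Qed.

Lemma smooth_transition c d : atlas c -> atlas d -> smooth_on (overlap c d) (transition c d).
Proof. exact: atlas_smooth. Qed.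

Lemma transition_cmap c d x : cdom c x -> transition c d (cmap c x) = cmap d x.
Proof. by move=> cx; rewrite /transition /= cmapK. Qed.

Lemma overlap_cmap c d x : cdom c x -> cdom d x -> overlap c d (cmap c x).
Proof. by move=> cx dx; exists x. Qed.

Lemma differentiable_transition c d x : atlas c -> atlas d -> cdom c x -> cdom d x ->
  differentiable (transition c d) (cmap c x).
Proof. by move=> ac ad cx dx; exact: smooth_on_diff (smooth_transition ac ad) (overlap_cmap cx dx). Qed.

Lemma near_overlap c d x : cdom c x -> cdom d x -> \forall y \near cmap c x, overlap c d y.
Proof.
by move=> cx dx; apply: open_nbhs_nbhs; split; [exact: open_overlap|exact: overlap_cmap].
Qed.

Lemma Jchart_comp c d e x : atlas c -> atlas d -> atlas e -> cdom c x -> cdom d x -> cdom e x ->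
  Jchart c e x = Jchart c d x *m Jchart d e x.
Proof.
move=> ac ad ae cx dx ex; rewrite /Jchart -(transition_cmap d cx) -jacobian_comp.
- apply: near_eq_jacobian; first exact: differentiable_transition.
  apply: filterS (near_overlap cx dx) => _ [x' [cx' dx'] <-].
  by rewrite /= transition_cmap // /transition /= !cmapK.
- exact: differentiable_transition.
- by rewrite transition_cmap //; exact: differentiable_transition.
Qed.

Lemma Jchart_id c x : cdom c x -> Jchart c c x = 1%:M.
Proof.
move=> cx; rewrite /Jchart -(jacobian_id (cmap c x)); apply/esym/near_eq_jacobian => //.
by apply: filterS (near_cimg cx) => _ [x' cx' <-]; rewrite transition_cmap.
Qed.

Lemma JchartK c d x : atlas c -> atlas d -> cdom c x -> cdom d x ->
  Jchart c d x *m Jchart d c x = 1%:M.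
Proof. by move=> ac ad cx dx; rewrite -Jchart_comp // Jchart_id. Qed.

Lemma to_chartK c x : atlas c -> cdom c x -> to_chart c x *m from_chart c x = 1%:M.
Proof.
by move=> ac cx; apply: JchartK => //; [exact: atlas_chart_at|exact: cdom_chart_at].
Qed.

Lemma from_chartK c x : atlas c -> cdom c x -> from_chart c x *m to_chart c x = 1%:M.
Proof.
by move=> ac cx; apply: JchartK => //; [exact: atlas_chart_at|exact: cdom_chart_at].
Qed.

Lemma JchartE c d x : Jchart c d x = jacobian (transition c d) (cmap c x). Proof. by []. Qed.
Lemma vf_inE (X : M -> 'rV[R]_n) c y : vf_in X c y = X (cinv c y) *m to_chart c (cinv c y).
Proof. by []. Qed.

Opaque to_chart from_chart Jchart.

Lemma vf_in_cmap (X : M -> 'rV[R]_n) c x : cdom c x -> vf_in X c (cmap c x) = X x *m to_chart c x.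
Proof. by move=> cx; rewrite /vf_in cmapK. Qed.

Lemma form1_in_cmap (tau : M -> 'rV[R]_n) c x : cdom c x ->
  form1_in tau c (cmap c x) = tau x *m (from_chart c x)^T.
Proof. by move=> cx; rewrite /form1_in cmapK. Qed.

Lemma form2_in_cmap (omega : M -> 'M[R]_n) c x : cdom c x ->
  form2_in omega c (cmap c x) = from_chart c x *m omega x *m (from_chart c x)^T.
Proof. by move=> cx; rewrite /form2_in cmapK. Qed.

Lemma vf_in_change (X : M -> 'rV[R]_n) c d x : atlas c -> atlas d -> cdom c x -> cdom d x ->
  vf_in X d (cmap d x) = vf_in X c (cmap c x) *m Jchart c d x.
Proof.
move=> ac ad cx dx.
have e := Jchart_comp (atlas_chart_at x) ac ad (cdom_chart_at x) cx dx.
by rewrite (vf_in_cmap X dx) (vf_in_cmap X cx) -mulmxA; congr (_ *m _); exact: e.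
Qed.

Lemma from_chart_unit c x : atlas c -> cdom c x -> from_chart c x \in unitmx.
Proof. by move=> ac cx; have [u _] := mulmx1_unit (from_chartK ac cx); exact u. Qed.

Lemma contract_form2_in (omega : M -> 'M[R]_n) c x (v : 'rV[R]_n) : atlas c -> cdom c x ->
  (v *m to_chart c x) *m form2_in omega c (cmap c x) = (v *m omega x) *m (from_chart c x)^T.
Proof.
move=> ac cx; rewrite (form2_in_cmap omega cx).
move: (to_chart c x) (from_chart c x) (to_chartK ac cx) => J F e.
by rewrite !mulmxA -(mulmxA v J) e mulmx1.
Qed.

Lemma tr_from_chart_inj c x (v w : 'rV[R]_n) : atlas c -> cdom c x ->
  v *m (from_chart c x)^T = w *m (from_chart c x)^T -> v = w.
Proof.
move=> ac cx e; have u : (from_chart c x)^T \in unitmx by rewrite unitmx_tr (from_chart_unit ac cx).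
by rewrite -[v](mulmxK u) e (mulmxK u).
Qed.

Lemma ker_form2_in (omega : M -> 'M[R]_n) c x (v : 'rV[R]_n) : atlas c -> cdom c x ->
  (v *m to_chart c x) *m form2_in omega c (cmap c x) = 0 <-> v *m omega x = 0.
Proof.
move=> ac cx; rewrite (contract_form2_in omega v ac cx); split=> [e|->]; last by rewrite mul0mx.
by apply: (tr_from_chart_inj ac cx); rewrite mul0mx.
Qed.

Lemma rank_form2_in (omega : M -> 'M[R]_n) c x : atlas c -> cdom c x ->
  \rank (form2_in omega c (cmap c x)) = \rank (omega x).
Proof.
move=> ac cx; have u := from_chart_unit ac cx.
have uf : row_full (from_chart c x) by rewrite row_full_unit u.
have ut : row_free (from_chart c x)^T by rewrite row_free_unit unitmx_tr u.
by rewrite (form2_in_cmap omega cx) (mxrankMfree _ ut) (eqmxMfull (omega x) uf).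
Qed.

(** A vector field read in two charts is related to itself by the change of
    charts, so that the definition of the bracket by means of a preferred chart is
    valid in all charts. *)
Lemma lie_bracket_in (X Y : M -> 'rV[R]_n) c x : vector_field X -> vector_field Y ->
  atlas c -> cdom c x ->
  bracket (vf_in X c) (vf_in Y c) (cmap c x) = lie_bracket X Y x *m to_chart c x.
Proof.
move=> vX vY ac cx; set d := chart_at x.
have ad : atlas d by exact: atlas_chart_at.
have dx : cdom d x by exact: cdom_chart_at.
have im z : cdom d z -> (cmap d @` cdom d) (cmap d z) by exists z.
have imc z : cdom c z -> (cmap c @` cdom c) (cmap c z) by exists z.
have dX : differentiable (vf_in X d) (cmap d x) by exact: smooth_on_diff (vX d ad) (im x dx).
have dY : differentiable (vf_in Y d) (cmap d x) by exact: smooth_on_diff (vY d ad) (im x dx).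
have dXc : differentiable (vf_in X c) (cmap c x) by exact: smooth_on_diff (vX c ac) (imc x cx).
have dYc : differentiable (vf_in Y c) (cmap c x) by exact: smooth_on_diff (vY c ac) (imc x cx).
have rel (Z : M -> 'rV[R]_n) z : overlap d c z ->
    vf_in Z c (transition d c z) = 'D_(vf_in Z d z) (transition d c) z.
  move=> [x' [dx' cx'] <-]; rewrite transition_cmap // deriveEjacobian.
    by rewrite (vf_in_change Z ad ac).
  exact: differentiable_transition.
have := @bracket_related R n n (overlap d c) (transition d c) (vf_in X d) (vf_in Y d)
  (vf_in X c) (vf_in Y c) (cmap d x) (@open_overlap d c) (overlap_cmap dx cx)
  (smooth_transition ad ac) dX dY.
rewrite transition_cmap // => /(_ dXc dYc (rel X) (rel Y)) ->.
by rewrite deriveEjacobian //; exact: differentiable_transition.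
Qed.

Lemma differential_in (g : M -> R) c x (v : 'rV[R]_n) : atlas c -> cdom c x ->
  differentiable (g \o cinv c) (cmap c x) ->
  v *m (differential g x)^T = ('D_(v *m to_chart c x) (g \o cinv c) (cmap c x))%:M.
Proof.
move=> ac cx dg; set d := chart_at x.
have ad : atlas d by exact: atlas_chart_at.
have dx : cdom d x by exact: cdom_chart_at.
have dt := differentiable_transition ad ac dx cx.
have dgt : differentiable (g \o cinv c) (transition d c (cmap d x)) by rewrite transition_cmap.
have E : \forall y \near cmap d x, ((g \o cinv c) \o transition d c) y = (g \o cinv d) y.
  by apply: filterS (near_overlap dx cx) => _ [x' [dx' cx'] <-]; rewrite /= !cmapK.
have dgd : differentiable (g \o cinv d) (cmap d x).
  by apply: near_eq_differentiable E _; exact: differentiable_comp.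
have -> : v *m (differential g x)^T = ('D_v (g \o cinv d) (cmap d x))%:M.
  rewrite (derive_dirE _ dgd); apply/matrixP => i j; rewrite !ord1 !mxE mulr1n.
  by apply: eq_bigr => k _; rewrite !mxE.
have -> : 'D_v (g \o cinv d) (cmap d x) = 'D_v ((g \o cinv c) \o transition d c) (cmap d x).
  by apply: esym; exact: near_eq_derive.
rewrite (deriveE_comp v dt dgt) (transition_cmap c dx).
by congr ('D_ _ _ _)%:M; exact: deriveEjacobian.
Qed.

End ChartChange.

(** * Integrable distributions are involutive *)

Opaque to_chart from_chart Jchart form1_in form2_in vf_in.

Section Involutive.
Variables (R : realType) (n : nat) (M : smooth_manifold R n).

Lemma open_preim_near (T T' : topologicalType) (U : set T) (V : set T') (f : T -> T') :
  open U -> open V -> (forall t, U t -> {for t, continuous f}) ->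
  open (U `&` f @^-1` V).
Proof.
move=> oU oV cf; rewrite openE => t [Ut Vft]; apply: filterI; first exact: open_nbhs_nbhs.
by apply: (cf t Ut); exact: open_nbhs_nbhs.
Qed.

Lemma sub_char_dist (tau : M -> 'rV[R]_n) (omega : M -> 'M[R]_n) x (v : 'rV[R]_n) :
  (kermx (omega x) <= kermx (tau x)^T)%MS ->
  (v <= char_dist tau omega x)%MS <-> v *m omega x = 0.
Proof.
move=> K; rewrite /char_dist sub_capmx; split=> [/andP[_ /sub_kermxP]//|v0].
have kv : (v <= kermx (omega x))%MS by apply/sub_kermxP.
by rewrite (submx_trans kv K).
Qed.

(** Let h be an integral manifold through the point. Its tangent spaces are
    the kernels, so fields in the kernel are related by [h] to fields on the
    parameter domain, which are smooth because the Jacobian of h has a smooth right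
    inverse. The bracket is then related to the bracket of the lifts, hence tangent
    to the integral manifold. *)
Lemma involutive_in (tau : M -> 'rV[R]_n) (omega : M -> 'M[R]_n) (c : chart R n M)
    (V : set 'rV[R]_n) (X Y : 'rV[R]_n -> 'rV[R]_n) :
  integrable_distribution (char_dist tau omega) ->
  (forall x, (kermx (omega x) <= kermx (tau x)^T)%MS) ->
  atlas c -> open V -> V `<=` cmap c @` cdom c -> smooth_on V X -> smooth_on V Y ->
  (forall z, V z -> X z *m form2_in omega c z = 0) ->
  (forall z, V z -> Y z *m form2_in omega c z = 0) ->
  forall y, V y -> bracket X Y y *m form2_in omega c y = 0.
Proof.
move=> Ha K ac oV VO sX sY kX kY y Vy; have [x cx xy] := VO y Vy.
have [k [W [h [[oW [ch sh] _ tang] [t0 Wt0 ht0]]]]] := Ha x.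
pose W1 := W `&` h @^-1` cdom c.
have oW1 : open W1 by apply: open_preim_near oW (@open_cdom _ _ _ c) ch.
pose hh := cmap c \o h; have shh : smooth_on W1 hh := sh c ac.
have dhh t : W1 t -> differentiable hh t by exact: smooth_on_diff shh.
have Dhh t : W1 t -> forall u : 'rV_k, 'D_u hh t = u *m (tangent_map h t *m to_chart c (h t)).
  move=> [Wt ct] u; set d := chart_at (h t).
  have ad : atlas d by exact: atlas_chart_at.
  have dt : cdom d (h t) by exact: cdom_chart_at.
  have od : open (W `&` h @^-1` cdom d) by apply: open_preim_near oW (@open_cdom _ _ _ d) ch.
  have dd : differentiable (cmap d \o h) t by exact: smooth_on_diff (sh d ad) (conj Wt dt).
  have dtr : differentiable (transition d c) ((cmap d \o h) t).
    exact: differentiable_transition.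
  have -> : 'D_u hh t = 'D_u (transition d c \o (cmap d \o h)) t.
    apply: near_eq_derive; apply: (near_open_eq od (conj Wt dt)) => s [_ ds].
    by rewrite /= transition_cmap.
  rewrite (deriveE_comp u dd dtr) (deriveEjacobian u dd) mulmxA.
  exact: deriveEjacobian.
have kerE t (w : 'rV_n) : W1 t -> w *m form2_in omega c (hh t) = 0 <-> exists u, w = 'D_u hh t.
  move=> W1t; have [Wt ct] := W1t; have [_ /andP[tD Dt]] := tang t Wt.
  split=> [kw|[u ->]].
    have [w' ww'] : exists w', w = w' *m to_chart c (h t).
      by exists (w *m from_chart c (h t)); rewrite -mulmxA (from_chartK ac ct) mulmx1.
    have kw' : w' *m omega (h t) = 0.
      apply: (ker_form2_in omega w' ac ct).1.
      exact: (eq_ind w (fun z => z *m form2_in omega c (cmap c (h t)) = 0) kw _ ww').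
    have := (sub_char_dist w' (K (h t))).2 kw'.
    move=> /submx_trans/(_ Dt)/submxP[u uw]; exists u.
    by rewrite (Dhh t W1t) mulmxA -uw -ww'.
  have e : 'D_u hh t = (u *m tangent_map h t) *m to_chart c (h t).
    by rewrite (Dhh t W1t) mulmxA.
  have tm0 : u *m tangent_map h t *m omega (h t) = 0.
    by apply: (sub_char_dist _ (K (h t))).1; apply: submx_trans tD; exact: submxMl.
  have H := (ker_form2_in omega (u *m tangent_map h t) ac ct).2 tm0.
  by apply: etrans H; congr (_ *m _).
have hht0 : hh t0 = y by rewrite /hh /= ht0.
have W1t0 : W1 t0 by split=> //; rewrite /preimage /= ht0.
pose J t := total_derivative hh t.
have JE t u : W1 t -> 'D_u hh t = u *m J t by move=> /dhh; exact: total_derivativeE.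
have sJ : smooth_on W1 J by exact: smooth_total_derivative.
(* A right inverse at t0 gives right inverses C (J t C)^-1 nearby. *)
have [C CP] : exists C, J t0 *m C = 1%:M.
  apply: row_free_right_inverse; have [_ ct] := W1t0; have [rf _] := tang t0 Wt0.
  have -> : J t0 = tangent_map h t0 *m to_chart c (h t0).
    by apply: mulmx_row_inj => u; rewrite -JE // (Dhh t0 W1t0).
  have [_ ut] := mulmx1_unit (from_chartK ac ct).
  by rewrite /row_free mxrankMfree ?row_free_unit //; exact: rf.
pose W2 := W1 `&` hh @^-1` V.
have oW2 : open W2.
  by apply: open_preim_near oW1 oV _ => t /dhh; exact: differentiable_continuous.
have W21 : W2 `<=` W1 by move=> t [].
have sJC : smooth_on W2 (fun t => J t *m C).
  by apply: smooth_mulmx => //; [exact: smooth_onS sJ|exact: smooth_cst].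
pose W3 := [set t | W2 t /\ \det (J t *m C) != 0].
have oW3 : open W3 by exact: (open_smooth_neq0 oW2 (smooth_det oW2 sJC)).
have W32 : W3 `<=` W2 by move=> t [].
have W3t0 : W3 t0.
  split; last by rewrite CP det1 oner_neq0.
  by split=> //; rewrite /preimage /= -/(hh t0) hht0.
pose lift (Z : 'rV[R]_n -> 'rV[R]_n) t : 'rV[R]_k := Z (hh t) *m (C *m invmx (J t *m C)).
have uJC t : W3 t -> J t *m C \in unitmx by move=> [_ d0]; rewrite unitmxE unitfE.
have shh3 : smooth_on W3 hh by apply: smooth_onS shh => t /W32/W21.
have slift Z : smooth_on V Z -> smooth_on W3 (lift Z).
  move=> sZ; apply: smooth_mulmx => //.
    by apply: (smooth_comp_mx oW3 oV _ shh3 sZ) => t [[]].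
  apply: smooth_mulmx => //; first exact: smooth_cst.
  by apply: smooth_invmx => //; exact: smooth_onS sJC.
have rel Z : (forall z, V z -> Z z *m form2_in omega c z = 0) ->
    forall t, W3 t -> Z (hh t) = 'D_(lift Z t) hh t.
  move=> kZ t W3t; have W2t := W32 t W3t; have W1t := W21 t W2t.
  have [u uE] := (kerE t (Z (hh t)) W1t).1 (kZ _ W2t.2).
  rewrite JE // /lift uE JE // -(mulmxA u) (mulmxA (J t)) (mulmxV (uJC t W3t)) mulmx1 //.
have := @bracket_related R k n W3 hh (lift X) (lift Y) X Y t0 oW3 W3t0 shh3
  (smooth_on_diff (slift X sX) W3t0) (smooth_on_diff (slift Y sY) W3t0).
rewrite hht0 => /(_ (smooth_on_diff sX Vy) (smooth_on_diff sY Vy) (rel X kX) (rel Y kY)) ->.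
by rewrite -hht0; apply: (kerE t0 _ W1t0).2; exists (bracket (lift X) (lift Y) t0).
Qed.

End Involutive.

(** * Global Liouville fields *)

Section ZeroExtension.
Variables (R : realType) (n : nat) (M : smooth_manifold R n).

Lemma compact_ball_at (y0 : 'rV[R]_n) (r : R) : compact [set y | `|y - y0| <= r].
Proof.
apply: (@subclosed_compact _ _ [set y | `|y| <= r + `|y0|]); last 2 first.
- exact: compact_norm_ball.
- move=> y /= yr; rewrite -[y](subrK y0) (le_trans (ler_normD _ _)) // lerD2r //.
apply: (@preimage_closed _ _ (fun y : 'rV[R]_n => `|y - y0|) [set x | x <= r]); last exact: closed_le.
move=> z _; apply: (@continuous_comp _ _ _ (fun y : 'rV[R]_n => y - y0) (fun y => `|y|)).
  by apply: continuousB => //; exact: cst_continuous.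
exact: norm_continuous.
Qed.

(** Being compact, the part of M that a chart sends to a closed ball is closed in
    the Hausdorff space M. So a point outside the domain of the chart has a
    neighbourhood where data supported in that ball vanish. *)
Lemma chart_ball_cases (c : chart R n M) (y0 : 'rV[R]_n) (r : R) x :
  (forall y, `|y - y0| <= r -> (cmap c @` cdom c) y) ->
  cdom c x \/ exists A : set M, [/\ open A, A x &
    forall x', A x' -> cdom c x' -> r < `|cmap c x' - y0|].
Proof.
move=> rO; have [|ncx] := pselect (cdom c x); [by left|right].
pose K := [set y | `|y - y0| <= r].
have cK : closed (cinv c @` K).
  apply: compact_closed; first exact: mhausdorff.
  apply: continuous_compact; last exact: compact_ball_at.
  by apply: continuous_in_subspaceT => y /set_mem Ky; exact/cinv_continuous/rO.
exists (~` (cinv c @` K)); split; first by rewrite openC.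
  by move=> [y Ky yx]; apply: ncx; have [x' cx' xy'] := rO y Ky; rewrite -yx -xy' cmapK.
move=> x' nx' cx'; rewrite ltNge; apply/negP => rx'; apply: nx'.
by exists (cmap c x'); [exact: rx'|rewrite cmapK].
Qed.

Definition zero_ext_field (c : chart R n M) (X : 'rV[R]_n -> 'rV[R]_n) (x : M) : 'rV[R]_n :=
  if `[< cdom c x >] then X (cmap c x) *m from_chart c x else 0.

Definition zero_ext_fun (c : chart R n M) (f : 'rV[R]_n -> R) (x : M) : R :=
  if `[< cdom c x >] then f (cmap c x) else 0.

Lemma zero_ext_fieldE c X x : cdom c x -> zero_ext_field c X x = X (cmap c x) *m from_chart c x.
Proof. by move=> cx; rewrite /zero_ext_field (asboolT cx). Qed.

Lemma zero_ext_funE c f x : cdom c x -> zero_ext_fun c f x = f (cmap c x).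
Proof. by move=> cx; rewrite /zero_ext_fun (asboolT cx). Qed.

Lemma jacobian_total m k (f : 'rV[R]_m -> 'rV[R]_k) y : differentiable f y ->
  jacobian f y = total_derivative f y.
Proof.
move=> df; apply: mulmx_row_inj => v; apply: etrans (total_derivativeE v df).
by apply: esym; exact: deriveEjacobian.
Qed.

Lemma open_chart_imageI (d : chart R n M) (A : set M) x : open A -> A x -> cdom d x ->
  open (cmap d @` (A `&` cdom d)) /\ (cmap d @` (A `&` cdom d)) (cmap d x).
Proof. by move=> oA Ax dx; split; [exact: open_chart_image|exists x]. Qed.

Lemma zero_ext_vector_field (c : chart R n M) y0 r X : atlas c ->
  (forall y, `|y - y0| <= r -> (cmap c @` cdom c) y) ->
  smooth_on setT X -> (forall y, r <= `|y - y0| -> X y = 0) ->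
  vector_field (zero_ext_field c X).
Proof.
move=> ac rO sX X0 d ad; apply: smooth_on_local => _ [x dx <-].
have [cx|[A [oA Ax AP]]] := chart_ball_cases x rO.
  exists (overlap d c); split; [exact: open_overlap|exact: overlap_cmap|].
  have st := smooth_transition ad ac; have oo := @open_overlap _ _ _ d c.
  have sJ : smooth_on (overlap d c) (total_derivative (transition c d) \o transition d c).
    have sT := smooth_total_derivative (@open_overlap _ _ _ c d) (smooth_transition ac ad).
    apply: (smooth_comp_mx oo (@open_overlap _ _ _ c d) _ st sT) => _ [x' [dx' cx'] <-].
    by rewrite transition_cmap //; exact: overlap_cmap.
  have sXt : smooth_on (overlap d c) (X \o transition d c).
    exact: (smooth_comp_mx oo openT (fun _ _ => I) st sX).
  apply: eq_smooth_on (smooth_mulmx oo sXt sJ) => // _ [x' [dx' cx'] <-].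
  rewrite /= (vf_in_cmap _ dx') (zero_ext_fieldE _ cx') (transition_cmap c dx').
  rewrite -jacobian_total; last exact: differentiable_transition.
  rewrite -JchartE (Jchart_comp ac (atlas_chart_at x') ad cx' (cdom_chart_at x') dx').
  by rewrite mulmxA.
have [oV Vx] := open_chart_imageI oA Ax dx.
exists (cmap d @` (A `&` cdom d)); split=> //.
apply: (@eq_smooth_on _ _ _ _ (fun=> 0)) => //; last exact: smooth_cst.
move=> _ [x' [Ax' dx'] <-]; rewrite (vf_in_cmap _ dx') /zero_ext_field.
case: asboolP => [cx'|_]; last by rewrite mul0mx.
by rewrite X0 ?mul0mx //; exact/ltW/AP.
Qed.

Lemma zero_ext_smooth_fun (c : chart R n M) y0 r f : atlas c ->
  (forall y, `|y - y0| <= r -> (cmap c @` cdom c) y) ->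
  smooth_on setT f -> (forall y, r <= `|y - y0| -> f y = 0) ->
  smooth_fun setT (zero_ext_fun c f).
Proof.
move=> ac rO sf f0 d ad; rewrite setTI; apply: smooth_on_local => _ [x dx <-].
have [cx|[A [oA Ax AP]]] := chart_ball_cases x rO.
  exists (overlap d c); split; [exact: open_overlap|exact: overlap_cmap|].
  have oo := @open_overlap _ _ _ d c.
  apply: (eq_smooth_on oo) (smooth_comp oo (fun _ _ => I) (smooth_transition ad ac) sf).
  move=> _ [x' [dx' cx'] <-].
  by rewrite /transition /= (cmapK dx') (zero_ext_funE _ cx').
have [oV Vx] := open_chart_imageI oA Ax dx.
exists (cmap d @` (A `&` cdom d)); split=> //.
apply: (@eq_smooth_on _ _ _ _ (fun=> 0 : R)) => //; last exact: smooth_cst.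
move=> _ [x' [Ax' dx'] <-]; rewrite /= cmapK // /zero_ext_fun.
by case: asboolP => [cx'|//]; rewrite f0 //; exact/ltW/AP.
Qed.

Lemma vector_fieldD (X Y : M -> 'rV[R]_n) : vector_field X -> vector_field Y ->
  vector_field (fun x => X x + Y x).
Proof.
move=> vX vY c ac; have oc := @open_cimg _ _ _ c.
apply: (eq_smooth_on oc) (smooth_onD oc (vX c ac) (vY c ac)) => y _.
by rewrite !vf_inE mulmxDl.
Qed.

Lemma vector_fieldZ (f : M -> R) (X : M -> 'rV[R]_n) : smooth_fun setT f -> vector_field X ->
  vector_field (fun x => f x *: X x).
Proof.
move=> sf vX c ac; have oc := @open_cimg _ _ _ c; have := sf c ac; rewrite setTI => sfc.
apply: (eq_smooth_on oc) (smooth_scale oc sfc (vX c ac)) => y _.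
by rewrite !vf_inE scalemxAl.
Qed.

Lemma vector_field0 : vector_field (fun _ : M => 0 : 'rV[R]_n).
Proof.
move=> c ac; apply: (@eq_smooth_on _ _ _ _ (fun=> 0)); first exact: open_cimg.
  by move=> y _; rewrite vf_inE mul0mx.
exact: smooth_cst.
Qed.

Lemma vector_field_local (X : M -> 'rV[R]_n) :
  (forall x, exists (A : set M) (Y : M -> 'rV[R]_n), [/\ open A, A x, vector_field Y &
    forall x', A x' -> X x' = Y x']) -> vector_field X.
Proof.
move=> H c ac; apply: smooth_on_local => _ [x cx <-]; have [A [Y [oA Ax vY XY]]] := H x.
have [oV Vx] := open_chart_imageI oA Ax cx.
exists (cmap c @` (A `&` cdom c)); split=> //.
apply: (eq_smooth_on oV) (smooth_onS _ (vY c ac)).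
  by move=> _ [x' [Ax' cx'] <-]; rewrite !(vf_in_cmap _ cx') XY.
by move=> _ [x' [_ cx'] <-]; exists x'.
Qed.

Lemma smooth_funM (f g : M -> R) : smooth_fun setT f -> smooth_fun setT g ->
  smooth_fun setT (fun x => f x * g x).
Proof.
move=> sf sg c ac; have oc := @open_cimg _ _ _ c.
have := sf c ac; have := sg c ac; rewrite setTI => sgc sfc.
exact: (smooth_onM oc sfc sgc).
Qed.

Lemma smooth_fun_onem (f : M -> R) : smooth_fun setT f -> smooth_fun setT (fun x => 1 - f x).
Proof.
move=> sf c ac; have oc := @open_cimg _ _ _ c; have := sf c ac; rewrite setTI => sfc.
by apply: (smooth_onD oc (@smooth_cst _ _ _ _ (1 : R)) (smooth_onN oc sfc)).
Qed.

Lemma smooth_fun1 : smooth_fun setT (fun _ : M => 1 : R).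
Proof. by move=> c ac; exact: (@smooth_cst _ _ _ _ (1 : R)). Qed.

Lemma open_chart_ball (c : chart R n M) y0 (r : R) :
  open [set x | cdom c x /\ `|cmap c x - y0| < r].
Proof.
have := @open_preim_near M 'rV[R]_n (cdom c) [set y | `|y - y0| < r] (cmap c)
  (@open_cdom _ _ _ c) (@open_norm_ball R n y0 r) (@cmap_continuous _ _ _ c).
by [].
Qed.

End ZeroExtension.

(** Choose a centre for each basic open set that is contained in some [A x]. *)
Lemma lindelof (T : topologicalType) (A : T -> set T) (p : T) : @second_countable T ->
  (forall x, open (A x)) -> (forall x, A x x) ->
  exists s : nat -> T, forall x, exists k, A (s k) x.
Proof.
move=> [B /countable_injP[e einj] [_ Bx]] oA Ax.
have /choice[s sP] : forall k, exists x, forall b, B b -> e b = k ->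
    (exists x', b `<=` A x') -> b `<=` A x.
  move=> k; have [[b [Bb eb [x' bx']]]|H] :=
      pselect (exists b, [/\ B b, e b = k & exists x', b `<=` A x']).
    exists x' => b' Bb' eb' _; suff -> : b' = b by [].
    by apply: einj; rewrite ?inE // eb eb'.
  by exists p => b Bb eb bA; exfalso; apply: H; exists b.
exists s => x; have [b [Bb bx] bA] : filter_from [set U | B U /\ U x] id (A x).
  by apply: Bx; apply: open_nbhs_nbhs; split; [exact: oA|exact: Ax].
by exists (e b); apply: (sP (e b) b Bb erefl) bx; exists x.
Qed.

Section Liouville.
Variables (R : realType) (n : nat) (M : smooth_manifold R n).
Variables (tau : M -> 'rV[R]_n) (omega : M -> 'M[R]_n).
Hypotheses (ftau : form1 tau) (fomega : form2 omega).

Lemma liouville_in_chart (c : chart R n M) x (v : 'rV[R]_n) : atlas c -> cdom c x ->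
  v *m form2_in omega c (cmap c x) = form1_in tau c (cmap c x) <->
  (v *m from_chart c x) *m omega x = tau x.
Proof.
move=> ac cx.
have e : v *m form2_in omega c (cmap c x) = (v *m from_chart c x *m omega x) *m (from_chart c x)^T.
  by rewrite (form2_in_cmap omega cx) !mulmxA.
rewrite e (form1_in_cmap tau cx); split=> [|->//].
exact: tr_from_chart_inj.
Qed.

(** Hypothesis (b) speaks of fields on the whole of M; a field given near a point
    is multiplied by a cutoff and extended by 0 before it is applied. *)
Lemma Delta_invariant_in (Delta : M -> 'rV[R]_n) (c : chart R n M) (V : set 'rV[R]_n)
    (X : 'rV[R]_n -> 'rV[R]_n) : vector_field Delta ->
  (forall Gamma, vector_field Gamma -> takes_values_in Gamma (Ker2 omega) ->
     takes_values_in (lie_bracket Delta Gamma) (Ker2 omega)) ->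
  atlas c -> open V -> V `<=` cmap c @` cdom c -> smooth_on V X ->
  (forall z, V z -> X z *m form2_in omega c z = 0) ->
  forall y, V y -> bracket (vf_in Delta c) X y *m form2_in omega c y = 0.
Proof.
move=> vD Hb ac oV VO sX kX y Vy; have [x cx xy] := VO y Vy; subst y.
have [chi [r [rV schi chi1 chi0 chiX]]] := smooth_cutoff oV Vy.
pose X1 z := chi z *: X z; have sX1 : smooth_on setT X1 by exact: chiX.
have kX1 z : X1 z *m form2_in omega c z = 0.
  rewrite /X1 -scalemxAl; have [zr|zr] := leP r `|z - cmap c x|; first by rewrite chi0 // scale0r.
  by rewrite kX ?scaler0 //; exact/rV/ltW.
pose Gamma := zero_ext_field c X1.
have rO z : `|z - cmap c x| <= r -> (cmap c @` cdom c) z by move=> /rV/VO.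
have vG : vector_field Gamma.
  by apply: (zero_ext_vector_field ac rO sX1) => z /chi0; rewrite /X1 => ->; rewrite scale0r.
have Gto x' : cdom c x' -> Gamma x' *m to_chart c x' = X1 (cmap c x').
  by move=> cx'; rewrite /Gamma (zero_ext_fieldE _ cx') -mulmxA (from_chartK ac cx') mulmx1.
have kG : takes_values_in Gamma (Ker2 omega).
  move=> x'; apply/sub_kermxP; have [cx'|ncx'] := pselect (cdom c x'); last first.
    by rewrite /Gamma /zero_ext_field (asboolF ncx') mul0mx.
  apply: (ker_form2_in omega _ ac cx').1.
  by apply: etrans (kX1 (cmap c x')); congr (_ *m _); exact: Gto.
have /sub_kermxP kb := Hb Gamma vG kG x.
have H := (ker_form2_in omega (lie_bracket Delta Gamma x) ac cx).2 kb.
have E : \forall z \near cmap c x, X z = vf_in Gamma c z.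
  have nV : nbhs (cmap c x) V by exact: open_nbhs_nbhs.
  apply: filterS (filterI nV chi1) => z [Vz chiz]; have [x' cx' xz] := VO z Vz.
  by rewrite -xz (vf_in_cmap _ cx') Gto // xz /X1 chiz scale1r.
have e := etrans (near_eq_bracket (vf_in Delta c) E) (lie_bracket_in vD vG ac cx).
exact: (etrans (congr1 (fun z => z *m form2_in omega c (cmap c x)) e) H).
Qed.

Hypothesis kernel_sub : forall x, (kermx (omega x) <= kermx (tau x)^T)%MS.
Hypothesis const_rank : forall x x', \rank (omega x) = \rank (omega x').

Lemma tau_sub_omega x : (tau x <= omega x)%MS.
Proof.
have sk := fomega.1 x; rewrite submxE.
have : ((cokermx (omega x))^T <= kermx (tau x)^T)%MS.
  apply: submx_trans (kernel_sub x); apply/sub_kermxP; apply: trmx_inj.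
  by rewrite trmx_mul trmxK sk mulNmx mulmx_coker oppr0 trmx0.
by move=> /sub_kermxP/(congr1 trmx); rewrite trmx_mul !trmxK trmx0 => ->.
Qed.

(** Near a point the equation iota_E omega = tau has a smooth solution, because
    the rank of omega is constant and Ker omega is contained in Ker tau. Multiplied by a
    cutoff phi it becomes a global field [E], for the right-hand side phi tau. *)
Lemma local_liouville x0 : exists (phi : M -> R) (E : M -> 'rV[R]_n) (A : set M),
  [/\ smooth_fun setT phi, vector_field E, open A, A x0 &
      (forall x, A x -> phi x = 1) /\ forall x, E x *m omega x = phi x *: tau x].
Proof.
pose c := chart_at x0; have ac : atlas c by exact: atlas_chart_at.
have cx0 : cdom c x0 by exact: cdom_chart_at.
pose O := cmap c @` cdom c; have oO : open O by exact: open_cimg.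
have Ox0 : O (cmap c x0) by exists x0.
have [|_ [x cx <-]|V [delta [oV Vx0 VO sdelta deltaP]]] :=
  smooth_solution oO Ox0 (fomega.2 c ac) (ftau ac).
- move=> _ [x cx <-]; apply: etrans (rank_form2_in omega ac cx) _.
  exact: etrans (const_rank x x0) (esym (rank_form2_in omega ac cx0)).
- have /submxP[D DE] := tau_sub_omega x.
  have De : (D *m to_chart c x) *m from_chart c x *m omega x = tau x.
    rewrite DE; move: (to_chart c x) (from_chart c x) (to_chartK ac cx) => J F JF.
    by rewrite -(mulmxA D J F) JF mulmx1.
  have e := (liouville_in_chart (D *m to_chart c x) ac cx).2 De.
  exact: (eq_ind _ (fun z => (z <= form2_in omega c (cmap c x))%MS) (submxMl _ _) _ e).
have [chi [r [rV schi chi1 chi0 chiX]]] := smooth_cutoff oV Vx0.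
have rO z : `|z - cmap c x0| <= r -> O z by move=> /rV/VO.
have [r1 r10 r1P] := norm_ball_nbhs chi1.
exists (zero_ext_fun c chi), (zero_ext_field c (fun z => chi z *: delta z)).
exists [set x | cdom c x /\ `|cmap c x - cmap c x0| < r1]; split.
- exact: zero_ext_smooth_fun rO schi chi0.
- apply: (zero_ext_vector_field ac rO); first exact: chiX.
  by move=> z /chi0 ->; rewrite scale0r.
- exact: open_chart_ball.
- by split=> //; rewrite subrr normr0.
split=> [x [cx /r1P]|x]; first by rewrite (zero_ext_funE _ cx).
have [cx|ncx] := pselect (cdom c x); last first.
  by rewrite /zero_ext_fun /zero_ext_field (asboolF ncx) mul0mx scale0r.
rewrite (zero_ext_funE _ cx) (zero_ext_fieldE _ cx) -!scalemxAl.
have [zr|zr] := leP r `|cmap c x - cmap c x0|; first by rewrite chi0 // !scale0r.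
congr (_ *: _); apply: (liouville_in_chart (delta (cmap c x)) ac cx).1.
exact/deltaP/rV/ltW.
Qed.

(** The hypothesis (b) concerns global Liouville fields and would say nothing if
    there were none. With E_k the fields of [local_liouville] for cutoffs phi_k
    that are 1 on sets covering M, the sum of prod_(j < k) (1 - phi_j) E_k over k is a Liouville field: the
    contractions with omega telescope to (1 - prod_(j < k) (1 - phi_j)) tau, and the
    products vanish from some k on near every point. *)
Lemma exists_liouville (p : M) : exists Delta, liouville tau omega Delta.
Proof.
have /choice[phi /choice[E /choice[A AP]]] := local_liouville.
have [|x|s sP] := lindelof p (@msecond_countable _ _ M) (A := A).
- by move=> x; have [] := AP x.
- by have [] := AP x.
pose P := fix P k x : R := if k is k'.+1 then P k' x * (1 - phi (s k') x) else 1.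
pose D := fix D k x : 'rV[R]_n := if k is k'.+1 then D k' x + P k' x *: E (s k') x else 0.
have sP' k : smooth_fun setT (P k).
  elim: k => [|k IH] /=; first exact: smooth_fun1.
  by apply: smooth_funM => //; apply: smooth_fun_onem; have [] := AP (s k).
have vD k : vector_field (D k).
  elim: k => [|k IH] /=; first exact: vector_field0.
  by apply: vector_fieldD => //; apply: vector_fieldZ => //; have [] := AP (s k).
have DE k x : D k x *m omega x = (1 - P k x) *: tau x.
  elim: k => [|k IH] /=; first by rewrite mul0mx subrr scale0r.
  have [_ _ _ _ [_ EE]] := AP (s k).
  by rewrite mulmxDl -scalemxAl IH EE scalerA -scalerDl; congr (_ *: _); ring.
have P0 k x m : A (s k) x -> (k < m)%N -> P m x = 0.
  move=> Akx; elim: m => // m IH; rewrite ltnS leq_eqVlt => /predU1P[<-|km] /=.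
    by have [_ _ _ _ [phi1 _]] := AP (s k); rewrite phi1 // subrr mulr0.
  by rewrite IH // mul0r.
have Dstat k x m : A (s k) x -> (k < m)%N -> D m x = D k.+1 x.
  move=> Akx; elim: m => // m IH; rewrite ltnS leq_eqVlt => /predU1P[<- //|km].
  by rewrite -IH // [LHS]/= (P0 k) // scale0r addr0.
have /choice[kk kkP] := sP.
exists (fun x => D (kk x).+1 x); split.
  apply: vector_field_local => x; exists (A (s (kk x))), (D (kk x).+1).
  have [_ _ oA _ _] := AP (s (kk x)); split=> // x' Ax'.
  rewrite -(Dstat (kk x') x' (maxn (kk x) (kk x')).+1) ?ltnS ?leq_maxr //.
  by rewrite (Dstat (kk x)) // ltnS leq_maxl.
by move=> x; rewrite /interior_product DE (P0 (kk x)) // subr0 scale1r.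
Qed.

End Liouville.

(** * The rescaled pair *)

Lemma derive_expR_comp (R : realType) n (f : 'rV[R]_n -> R) y v : differentiable f y ->
  'D_v (fun z => expR (f z)) y = expR (f y) * 'D_v f y.
Proof.
move=> df; have dexp : differentiable (expR : R -> R) (f y).
  by apply/derivable1_diffP; have := is_derive_expR (f y) => -[].
apply: etrans (deriveE_comp v df dexp) _.
rewrite (deriveE _ dexp) -[X in 'd _ _ X]mulr1 linearZ /= -(deriveE _ dexp) mulrC.
by congr (_ * _); case: (is_derive_expR (f y)) => _ ->.
Qed.

Section Gauge.
Variables (R : realType) (n r : nat) (M : smooth_manifold R n).
Variables (tau : M -> 'rV[R]_n) (omega : M -> 'M[R]_n).
Hypothesis Hdoublet : doublet_of_class (2 * r + 2) tau omega.

(** This is where the class being even is used. *)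
Lemma even_doublet_kernel x :
  (kermx (omega x) <= kermx (tau x)^T)%MS /\ \rank (omega x) = (2 * r + 2)%N.
Proof.
have [_ [sk _] cl] := Hdoublet.
have e : (2 * r + 2 = 2 * r.+1)%N by rewrite mulnS addnC.
by rewrite e; apply: even_class_kernel (sk x) _; rewrite -e; exact: cl.
Qed.

Hypothesis Htau : forall x : M, tau x != 0.

(** With g = exp f the equations Delta f = - 1 and v f = 0 on Ker omega become
    Delta g = - g and v g = 0, the hypotheses of [gauged_class]. *)
Lemma chart_gauge (c : chart R n M) (W : set 'rV[R]_n) (f : 'rV[R]_n -> R)
    (Delta : M -> 'rV[R]_n) : atlas c -> liouville tau omega Delta ->
  open W -> W `<=` cmap c @` cdom c -> smooth_on W f ->
  (forall y, W y -> 'D_(vf_in Delta c y) f y = - 1 /\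
     forall v, v *m form2_in omega c y = 0 -> 'D_v f y = 0) ->
  let V := cdom c `&` cmap c @^-1` W in let g := fun x => expR (f (cmap c x)) in
  [/\ open V, smooth_fun V g & forall x, V x ->
     pair_class (fun x => g x *: tau x)
       (fun x => wedge_form1 (differential g x) (tau x) + g x *: omega x) x = (2 * r + 1)%N].
Proof.
move=> ac [vD lD] oW WO sf fP V g; have [ftau [sk fomega] _] := Hdoublet.
have oV : open V by apply: open_preim_near (@open_cdom _ _ _ c) oW (@cmap_continuous _ _ _ c).
split=> // [c' ac'|x [cx Wx]].
  have oI : open (cmap c' @` (V `&` cdom c')) by exact: open_chart_image.
  have st : smooth_on (cmap c' @` (V `&` cdom c')) (transition c' c).
    apply: smooth_onS (smooth_transition ac' ac) => _ [x [[cx _] c'x] <-].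
    exact: overlap_cmap.
  have TW y : (cmap c' @` (V `&` cdom c')) y -> W (transition c' c y).
    by move=> [x [[_ Wx] c'x] <-]; rewrite transition_cmap.
  exact: (smooth_expR oI (smooth_comp oI TW st sf)).
have [kx rx] := even_doublet_kernel x.
have dfy : differentiable f (cmap c x) by exact: smooth_on_diff sf Wx.
have gE : \forall y \near cmap c x, expR (f y) = (g \o cinv c) y.
  apply: (near_open_eq oW Wx) => y /WO[x' cx' <-].
  by rewrite /g /= cmapK.
have dexp : differentiable (fun y => expR (f y)) (cmap c x).
  exact: smooth_on_diff (smooth_expR oW sf) Wx.
have dgv (v : 'rV[R]_n) : v *m (differential g x)^T =
    (g x * 'D_(v *m to_chart c x) f (cmap c x))%:M.
  apply: etrans (differential_in v ac cx (near_eq_differentiable gE dexp)) _.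
  congr (_ %:M); apply: etrans (esym (near_eq_derive _ gE)) _.
  exact: derive_expR_comp.
have [fD fK] := fP _ Wx.
have := @gauged_class _ n (omega x) (tau x) (Delta x) (differential g x) (g x)
  (sk x) kx (Htau x) (lD x) (lt0r_neq0 (expR_gt0 _)).
rewrite rx addn2 /= addn1; apply.
- rewrite dgv -mulrN1; congr (_ * _)%:M; apply: etrans fD.
  exact: (congr1 (fun w => 'D_w f (cmap c x)) (esym (vf_in_cmap Delta cx))).
- move=> v v0; rewrite dgv (fK _ ((ker_form2_in omega v ac cx).2 v0)).
  by rewrite mulr0; apply/matrixP => i j; rewrite !ord1 !mxE.
Qed.

End Gauge.

Theorem proposition6p8 (R : realType) (n r : nat) (M : smooth_manifold R n)
  (tau : M -> 'rV[R]_n) (omega : M -> 'M[R]_n)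
  (Hdoublet : doublet_of_class (2 * r + 2) tau omega)
  (Htau : forall x : M, tau x != 0)
  (Ha : integrable_distribution (char_dist tau omega))
  (Hb : forall Delta Gamma : M -> 'rV[R]_n,
     liouville tau omega Delta ->
     vector_field Gamma -> takes_values_in Gamma (Ker2 omega) ->
     takes_values_in (lie_bracket Delta Gamma) (Ker2 omega)) :
  forall p : M, exists V : set M, exists g : M -> R,
    [/\ open V, V p, smooth_fun V g, (forall x : M, V x -> g x != 0) &
        forall x : M, V x ->
          pair_class (fun x => g x *: tau x)
            (fun x => wedge_form1 (differential g x) (tau x) + g x *: omega x) x
          = (2 * r + 1)%N].
Proof.
move=> p; have [ftau fomega _] := Hdoublet.
have kx x := (even_doublet_kernel Hdoublet x).1.
have rx x := (even_doublet_kernel Hdoublet x).2.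
have [|Delta lD] := exists_liouville ftau fomega kx _ p.
  by move=> x x'; exact: etrans (rx x) (esym (rx x')).
have [vD DE] := lD.
pose c := chart_at p; have ac : atlas c by exact: atlas_chart_at.
have cp : cdom c p by exact: cdom_chart_at.
have oO : open (cmap c @` cdom c) by exact: open_cimg.
have Op : (cmap c @` cdom c) (cmap c p) by exists p.
have [|||||W [f [oW Wp WO sf fP]]] := @local_gauge R n (cmap c @` cdom c)
  (form2_in omega c) (form1_in tau c) (vf_in Delta c) (cmap c p) oO Op
  (fomega.2 c ac) (ftau c ac) (vD c ac).
- move=> _ [x cx <-]; apply: etrans (rank_form2_in omega ac cx) _.
  apply: etrans (rx x) _; apply: etrans (esym (rx p)) _.
  exact: esym (rank_form2_in omega ac cp).
- move=> _ [x cx <-]; rewrite (form1_in_cmap tau cx); apply/eqP => t0.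
  have /eqP := Htau x; apply; apply: (tr_from_chart_inj ac cx).
  by rewrite mul0mx.
- move=> _ [x cx <-]; rewrite (vf_in_cmap Delta cx).
  apply: etrans (contract_form2_in omega (Delta x) ac cx) _.
  by rewrite (form1_in_cmap tau cx); congr (_ *m _); exact: DE.
- move=> V X Y oV VO sX sY kX kY y Vy.
  exact: (involutive_in Ha kx ac oV VO sX sY kX kY Vy).
- move=> V X oV VO sX kX y Vy.
  apply: (Delta_invariant_in vD _ ac oV VO sX kX Vy) => Gamma.
  exact: Hb.
have [oV sg gP] := chart_gauge Hdoublet Htau ac lD oW WO sf fP.
exists (cdom c `&` cmap c @^-1` W), (fun x => expR (f (cmap c x))); split=> //.
by move=> x _; exact: lt0r_neq0 (expR_gt0 _).
Qed.
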